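(* Let $n\in\mathbb{N}$, $\beta\in(0,n)$, and $\boldsymbol{\alpha}=(\alpha_1,\ldots,\alpha_n)\in\mathbb{R}^n$ with $\alpha_k\notin\pi\mathbb{Z}$ for every $k\in\{1,\ldots,n\}$. Then for every $f\in\mathscr{S}(\mathbb{R}^n)$, $$\mathcal{F}_{\boldsymbol{\alpha}}\left(I_\beta^{\boldsymbol{\alpha}}f\right)(\boldsymbol{u})=(2\pi)^{-\beta}|\widetilde{\boldsymbol{u}}|^{-\beta}\,\mathcal{F}_{\boldsymbol{\alpha}}(f)(\boldsymbol{u})\quad\text{in }\mathscr{S}'(\mathbb{R}^n),$$ where, for $\boldsymbol{u}=(u_1,\ldots,u_n)\in\mathbb{R}^n$, $\widetilde{\boldsymbol{u}}:=(u_1\csc(\alpha_1),\ldots,u_n\csc(\alpha_n))$; that is, the tempered distribution $\mathcal{F}_{\boldsymbol{\alpha}}(I_\beta^{\boldsymbol{\alpha}}f)$ equals the tempered distribution given by the locally integrable function $\boldsymbol{u}\mapsto(2\pi)^{-\beta}|\widetilde{\boldsymbol{u}}|^{-\beta}\mathcal{F}_{\boldsymbol{\alpha}}(f)(\boldsymbol{u})$.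
   Context: $\mathscr{S}(\mathbb{R}^n)$ is the space of (complex-valued) Schwartz functions and $\mathscr{S}'(\mathbb{R}^n)$ the space of tempered distributions. Let $\boldsymbol{\alpha}=(\alpha_1,\ldots,\alpha_n)\in\mathbb{R}^n$ with $\alpha_k\notin\pi\mathbb{Z}$ for all $k$. Put $a(\alpha_k):=\frac{\cot(\alpha_k)}{2}$, $c(\alpha_k):=\sqrt{1-i\cot(\alpha_k)}$ (principal square root), $c(\boldsymbol{\alpha}):=c(\alpha_1)\cdots c(\alpha_n)$, $\csc(\alpha_k):=1/\sin(\alpha_k)$. Chirp function: $e_{\boldsymbol{\alpha}}(\boldsymbol{x}):=e^{2\pi i\sum_{k=1}^n a(\alpha_k)x_k^2}$ for $\boldsymbol{x}\in\mathbb{R}^n$. Multidimensional fractional Fourier transform: for $f\in L^1(\mathbb{R}^n)$ and $\boldsymbol{u}\in\mathbb{R}^n$, $\mathcal{F}_{\boldsymbol{\alpha}}(f)(\boldsymbol{u}):=\int_{\mathbb{R}^n}f(\boldsymbol{x})K_{\boldsymbol{\alpha}}(\boldsymbol{x},\boldsymbol{u})\,d\boldsymbol{x}$, where $K_{\boldsymbol{\alpha}}(\boldsymbol{x},\boldsymbol{u}):=c(\boldsymbol{\alpha})e_{\boldsymbol{\alpha}}(\boldsymbol{x})e_{\boldsymbol{\alpha}}(\boldsymbol{u})e^{-2\pi i\sum_{k=1}^n x_ku_k\csc(\alpha_k)}$. It maps $\mathscr{S}(\mathbb{R}^n)$ into $\mathscr{S}(\mathbb{R}^n)$. For a tempered distribution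 $v$, $\mathcal{F}_{\boldsymbol{\alpha}}v$ is defined by $\langle\mathcal{F}_{\boldsymbol{\alpha}}v,\varphi\rangle:=\langle v,\mathcal{F}_{\boldsymbol{\alpha}}\varphi\rangle$ for all $\varphi\in\mathscr{S}(\mathbb{R}^n)$. Fractional Riesz potential related to chirp functions: for $\beta\in(0,n)$, $f\in\mathscr{S}(\mathbb{R}^n)$ and $\boldsymbol{x}\in\mathbb{R}^n$, $$I_\beta^{\boldsymbol{\alpha}}(f)(\boldsymbol{x}):=\frac{1}{\gamma(\beta)}e_{-\boldsymbol{\alpha}}(\boldsymbol{x})\int_{\mathbb{R}^n}\frac{f(\boldsymbol{y})}{|\boldsymbol{x}-\boldsymbol{y}|^{n-\beta}}e_{\boldsymbol{\alpha}}(\boldsymbol{y})\,d\boldsymbol{y},\qquad \gamma(\beta):=\frac{\pi^{n/2}2^\beta\Gamma(\beta/2)}{\Gamma((n-\beta)/2)}.$$ The function $I_\beta^{\boldsymbol{\alpha}}f$ is regarded as a tempered distribution. *)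

(* Defs.v *)
From HB Require Import structures.
From mathcomp Require Import all_boot all_order all_algebra.
From mathcomp Require Import all_classical all_reals all_analysis.
From mathcomp Require Import complex.

Set Implicit Arguments.
Unset Strict Implicit.
Unset Printing Implicit Defensive.

Import Order.TTheory GRing.Theory Num.Theory.
Import numFieldNormedType.Exports.
Import ComplexField.Normc.

Local Open Scope classical_set_scope.
Local Open Scope ring_scope.
Local Open Scope complex_scope.

Definition rV_display : measure_display. Proof. exact. Qed.

Section measurable_rV.
Variables (R : realType) (n : nat).

Definition rV_coord (i : 'I_n) (x : 'rV[R]_n) : measurableTypeR R := x 0 i.

Let rV_set0 : g_sigma_preimage rV_coord set0.
Proof. exact: sigma_algebra0. Qed.

Let rV_setC A : g_sigma_preimage rV_coord A -> g_sigma_preimage rV_coord (~` A).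
Proof. exact: sigma_algebraC. Qed.

Let rV_bigcup (F : (set 'rV[R]_n)^nat) :
  (forall i, g_sigma_preimage rV_coord (F i)) ->
  g_sigma_preimage rV_coord (\bigcup_i (F i)).
Proof. exact: sigma_algebra_bigcup. Qed.

HB.instance Definition _ := @isMeasurable.Build rV_display
  'rV[R]_n (g_sigma_preimage rV_coord) rV_set0 rV_setC rV_bigcup.

Lemma measurable_rV_coord (i : 'I_n) :
  measurable_fun [set: 'rV[R]_n] (rV_coord i).
Proof.
move=> _ Y mY; rewrite setTI; apply: sub_sigma_algebra => /=.
rewrite -bigcup_seq/=; exists i => /=; first by rewrite mem_index_enum.
by exists Y => //; rewrite setTI.
Qed.

Lemma measurable_fun_rVP d (T : measurableType d) (f : T -> 'rV[R]_n) :
  measurable_fun [set: T] f <->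
  forall i, measurable_fun [set: T] (rV_coord i \o f).
Proof.
split=> [mf i|mf].
  exact: (measurableT_comp (measurable_rV_coord i) mf).
move=> _ A; rewrite setTI => mA.
have : g_sigma_preimage (fun i => rV_coord i \o f) (f @^-1` A).
  by rewrite g_sigma_preimage_comp; exists A => //; rewrite setTI.
apply: smallest_sub; first exact: sigma_algebra_measurable.
rewrite -bigcup_seq => B [i _ [C mC <-]].
exact: mf.
Qed.

End measurable_rV.

Section lebesgue_rV.
Variable R : realType.
Local Open Scope ereal_scope.

Definition cons_rV n (p : measurableTypeR R * 'rV[R]_n) : 'rV[R]_n.+1 :=
  row_mx (p.1 : R)%:M p.2 : 'rV[R]_(1 + n).

Lemma measurable_cons_rV n : measurable_fun setT (@cons_rV n).
Proof.
apply/measurable_fun_rVP => i.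
pose j : 'I_(1 + n) := i.
rewrite (_ : _ \o _ = fun p : measurableTypeR R * 'rV[R]_n =>
    (row_mx (p.1 : R)%:M p.2 : 'rV_(1 + n)) ord0 j) //.
case: (splitP j) => k jk.
  rewrite (_ : (fun p => _) = fst) //.
  apply/funext => p; rewrite (_ : j = lshift n k); last exact/val_inj.
  by rewrite row_mxEl (ord1 k) mxE eqxx mulr1n.
rewrite (_ : (fun p => _) = rV_coord k \o snd).
  exact: (measurableT_comp (measurable_rV_coord k)).
apply/funext => p; rewrite (_ : j = rshift 1 k); last exact/val_inj.
by rewrite row_mxEr.
Qed.



Definition uncons_rV n (x : 'rV[R]_n.+1) : measurableTypeR R * 'rV[R]_n :=
  (x ord0 ord0, rsubmx (x : 'rV[R]_(1 + n))).

Lemma cons_rVK n : cancel (@cons_rV n) (@uncons_rV n).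
Proof.
move=> [x y]; congr (_, _); last by rewrite /= row_mxKr.
rewrite /cons_rV /=.
transitivity (((x : R)%:M : 'M[R]_1) ord0 ord0); last by rewrite mxE eqxx mulr1n.
rewrite -(row_mxEl (x : R)%:M y).
by congr (row_mx _ _ _ _); exact/val_inj.
Qed.

Lemma measurable_uncons_rV n : measurable_fun setT (@uncons_rV n).
Proof.
apply/measurable_fun_pairP; split; first exact: (measurable_rV_coord ord0).
apply/measurable_fun_rVP => i.
rewrite (_ : _ \o _ = rV_coord (rshift 1 i : 'I_n.+1)).
  exact: measurable_rV_coord.
by apply/funext => x; rewrite /rV_coord /= mxE.
Qed.

Section lebesgue_rV_step.
Variables (n : nat) (m : {sigma_finite_measure set 'rV[R]_n -> \bar R}).

Definition lebesgue_rV_step : set 'rV[R]_n.+1 -> \bar R :=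
  pushforward (lebesgue_measure \x m) (@cons_rV n).

Let mcons := @measurable_cons_rV n.

Let step0 : lebesgue_rV_step set0 = 0.
Proof. exact: measure0. Qed.

Let step_ge0 A : 0 <= lebesgue_rV_step A.
Proof. exact: measure_ge0. Qed.

Let step_sigma_additive : semi_sigma_additive lebesgue_rV_step.
Proof. exact: measure_semi_sigma_additive. Qed.

HB.instance Definition _ := isMeasure.Build _ _ _ lebesgue_rV_step
  step0 step_ge0 step_sigma_additive.

Let step_sigma_finite : sigma_finite setT lebesgue_rV_step.
Proof.
have /sigma_finiteP[F [TF ndF Foo]] := sigma_finiteT (@lebesgue_measure R).
have /sigma_finiteP[G [TG ndG Goo]] := sigma_finiteT m.
exists (fun i => @uncons_rV n @^-1` (F i `*` G i)).
  rewrite -preimage_bigcup (_ : \bigcup_i _ = setT) ?preimage_setT//.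
  apply/seteqP; split=> // -[x y] _.
  have : [set: R] x by [].
  have : [set: 'rV[R]_n] y by [].
  rewrite TF TG => -[k _ Gky] [j _ Fjx]; exists (maxn j k) => //; split.
  - by move: x Fjx; exact/subsetPset/ndF/leq_maxl.
  - by move: y Gky; exact/subsetPset/ndG/leq_maxr.
move=> i; have [mF Fi] := Foo i; have [mG Gi] := Goo i.
have mFG : measurable (F i `*` G i) by exact: measurableX.
split.
  by rewrite -[X in measurable X]setTI; exact: measurable_uncons_rV.
rewrite /lebesgue_rV_step /pushforward -comp_preimage.
rewrite (_ : _ \o _ = id); last by rewrite funeqE => x /=; rewrite cons_rVK.
by rewrite preimage_id product_measure1E// lte_mul_pinfty// ge0_fin_numE.
Qed.

HB.instance Definition _ := Measure_isSigmaFinite.Build _ _ _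
  lebesgue_rV_step step_sigma_finite.

End lebesgue_rV_step.

(* The n-fold product of the one-dimensional Lebesgue measure. *)
Fixpoint lebesgue_rV n : set 'rV[R]_n -> \bar R :=
  match n with
  | 0%N => dirac (0%R : 'rV[R]_0)
  | m.+1 => pushforward (lebesgue_measure \x @lebesgue_rV m) (@cons_rV m)
  end.
Arguments lebesgue_rV : clear implicits.

Let lebesgue_rV_sigma_finite n :
  {m : {sigma_finite_measure set 'rV[R]_n -> \bar R} | lebesgue_rV n = m}.
Proof.
elim: n => [|n [m IH]].
  by exists (dirac (0%R : 'rV[R]_0)).
by exists (lebesgue_rV_step m); rewrite /= IH.
Qed.

Section instances.
Variable n : nat.

Let leb0 : lebesgue_rV n set0 = 0.
Proof. by have [m ->] := lebesgue_rV_sigma_finite n; exact: measure0. Qed.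

Let leb_ge0 A : 0 <= lebesgue_rV n A.
Proof. by have [m ->] := lebesgue_rV_sigma_finite n; exact: measure_ge0. Qed.

Let leb_sigma_additive : semi_sigma_additive (lebesgue_rV n).
Proof.
by have [m ->] := lebesgue_rV_sigma_finite n;
  exact: measure_semi_sigma_additive.
Qed.

HB.instance Definition _ := isMeasure.Build _ _ _ (lebesgue_rV n)
  leb0 leb_ge0 leb_sigma_additive.

Let leb_sigma_finite : sigma_finite setT (lebesgue_rV n).
Proof. by have [m ->] := lebesgue_rV_sigma_finite n; exact: sigma_finiteT. Qed.

HB.instance Definition _ := Measure_isSigmaFinite.Build _ _ _ (lebesgue_rV n)
  leb_sigma_finite.

End instances.

End lebesgue_rV.
Arguments lebesgue_rV : clear implicits.

Section complex_functions.
Context d (T : measurableType d) (R : realType) (mu : {measure set T -> \bar R}).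

Definition cintegrable (D : set T) (f : T -> R[i]) : Prop :=
  mu.-integrable D (fun x => (complex.Re (f x))%:E) /\
  mu.-integrable D (fun x => (complex.Im (f x))%:E).

Definition cintegral (D : set T) (f : T -> R[i]) : R[i] :=
  (\int[mu]_(x in D) complex.Re (f x)) +i* (\int[mu]_(x in D) complex.Im (f x)).

End complex_functions.

Section schwartz.
Variables (R : realType) (n : nat).
Implicit Types (f g phi psi : 'rV[R]_n -> R[i]) (a b : 'I_n -> nat).

(* R[i] carries no normed module structure over R, so derivatives are taken on
   the real and imaginary parts. *)
Definition partial (i : 'I_n) f : 'rV[R]_n -> R[i] := fun x =>
  ('D_(delta_mx 0 i) (fun y => complex.Re (f y)) x)
  +i* ('D_(delta_mx 0 i) (fun y => complex.Im (f y)) x).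

Definition partials (s : seq 'I_n) f : 'rV[R]_n -> R[i] := foldr partial f s.

Definition smooth f : Prop := forall s : seq 'I_n,
  [/\ continuous (fun x => complex.Re (partials s f x)),
      continuous (fun x => complex.Im (partials s f x)) &
      forall (i : 'I_n) x,
        derivable (fun y => complex.Re (partials s f y)) x (delta_mx 0 i) /\
        derivable (fun y => complex.Im (partials s f y)) x (delta_mx 0 i)].

Definition multi_order a : nat := (\sum_i a i)%N.

Definition monomial a (x : 'rV[R]_n) : R := \prod_i x 0 i ^+ a i.

Definition multi_partial b f : 'rV[R]_n -> R[i] :=
  partials (flatten [seq nseq (b i) i | i <- enum 'I_n]) f.

Definition schwartz_seminorm a b f : \bar R :=
  ereal_sup (range (fun x => (normc ((monomial a x)%:C * multi_partial b f x))%:E)).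

Definition schwartz f : Prop :=
  smooth f /\ forall a b, (schwartz_seminorm a b f < +oo)%E.

(* [v] only matters through its values on Schwartz functions.  The second
   conjunct is continuity for the locally convex topology of the seminorms,
   a basis of neighbourhoods of [phi] being indexed by [N] and [delta]. *)
Definition tempered (v : ('rV[R]_n -> R[i]) -> R[i]) : Prop :=
  (forall (c : R[i]) phi psi, schwartz phi -> schwartz psi ->
     v (fun x => c * phi x + psi x) = c * v phi + v psi) /\
  (forall phi, schwartz phi -> forall e : R, 0 < e ->
     exists (N : nat) (delta : R), 0 < delta /\
       forall psi, schwartz psi ->
         (forall a b, (multi_order a <= N)%N -> (multi_order b <= N)%N ->
            (schwartz_seminorm a b (fun x => (psi x - phi x)%R) < delta%:E)%E) ->
         normc (v psi - v phi) < e).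

Definition eq_tempered (v w : ('rV[R]_n -> R[i]) -> R[i]) : Prop :=
  [/\ tempered v, tempered w & forall phi, schwartz phi -> v phi = w phi].

Definition distribution_of g : ('rV[R]_n -> R[i]) -> R[i] :=
  fun phi => cintegral (lebesgue_rV R n) setT (fun x => g x * phi x).

(* Integrability is required explicitly because [cintegral] is total. *)
Definition tempered_function g : Prop :=
  [/\ forall K : set 'rV[R]_n, compact K -> cintegrable (lebesgue_rV R n) K g,
      forall phi, schwartz phi ->
        cintegrable (lebesgue_rV R n) setT (fun x => g x * phi x) &
      tempered (distribution_of g)].

End schwartz.

Section fractional.
Variable R : realType.

Definition cot (t : R) : R := cos t / sin t.

Definition csc (t : R) : R := (sin t)^-1.

(* The complex number exp (i t); every exponential below is of this form. *)
Definition expi (t : R) : R[i] := cos t +i* sin t.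

Definition Gamma (s : R) : R :=
  \int[lebesgue_measure]_(t in `]0, +oo[) (t `^ (s - 1) * expR (- t)).

Variable n : nat.
Implicit Types (alpha x u : 'rV[R]_n) (f phi : 'rV[R]_n -> R[i]).

(* The library norm on 'rV[R]_n is the sup norm. *)
Definition enorm x : R := Num.sqrt (\sum_i x 0 i ^+ 2).

Definition chirp alpha x : R[i] :=
  expi (2 * pi * \sum_i (cot (alpha 0 i) / 2) * x 0 i ^+ 2).

(* [sqrtc] is the principal square root, with nonnegative real part; it differs
   from [sqrtC], whose value has nonnegative imaginary part. *)
Definition frft_const alpha : R[i] :=
  \prod_i sqrtc (1 -i* cot (alpha 0 i)).

Definition frft_kernel alpha x u : R[i] :=
  frft_const alpha * chirp alpha x * chirp alpha u *
  expi (- (2 * pi * \sum_i x 0 i * u 0 i * csc (alpha 0 i))).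

Definition frft alpha f u : R[i] :=
  cintegral (lebesgue_rV R n) setT (fun x => f x * frft_kernel alpha x u).

Definition frft_distribution alpha (v : ('rV[R]_n -> R[i]) -> R[i]) :
    ('rV[R]_n -> R[i]) -> R[i] :=
  fun phi => v (frft alpha phi).

Definition riesz_const (beta : R) : R :=
  pi `^ (n%:R / 2) * 2 `^ beta * Gamma (beta / 2) / Gamma ((n%:R - beta) / 2).

(* At [y = x] the integrand is divided by [0 `^ (n - beta) = 0] and is hence 0 by
   the library's conventions; this affects a null set only. *)
Definition riesz_potential (beta : R) alpha f x : R[i] :=
  ((riesz_const beta)^-1)%:C * chirp (- alpha) x *
  cintegral (lebesgue_rV R n) setT
    (fun y => f y / (enorm (x - y) `^ (n%:R - beta))%:C * chirp alpha y).

Definition tilde alpha u : 'rV[R]_n := \row_i (u 0 i * csc (alpha 0 i)).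

End fractional.

(* Main.v *)
(** With [s = (n - beta) / 2], [b = beta / 2] and the subordination formula
    [Gamma(s) |z|^(-2s) = int_0^oo t^(s-1) exp(- t |z|^2) dt], the Riesz kernel
    is a superposition of Gaussians.  Testing it against the Fourier transform
    of the chirped test function moves that transform onto the Gaussians, where
    it is explicit; integrating in [t] again (after the inversion [t -> c / t])
    yields [|tilde u|^(-2b)], because [s + b = n / 2].  The chirps of the kernel
    cancel those of the potential, and Fubini's theorem gives the duality.

    All exchanges of integrals are dominated by the tensor weight
    [prod_k 1 / (1 + x_k^2)], which is integrable also against the singular
    kernels.  That the transform of a Schwartz function is [O] of this weight
    follows by integrating by parts [2 n] times in the single variable for which
    [|x_k|] is maximal, so that only pure derivatives occur and the symmetry of
    mixed partial derivatives is never needed. *)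

Require Import Defs.
From mathcomp Require Import all_boot all_order all_algebra.
From mathcomp Require Import all_classical all_reals all_analysis.
From mathcomp Require Import complex.
From mathcomp Require Import measurable_realfun ring lra.

Import Order.TTheory GRing.Theory Num.Theory.
Import numFieldNormedType.Exports.
Import ComplexField.Normc.

Set Implicit Arguments.
Unset Strict Implicit.
Unset Printing Implicit Defensive.

Local Open Scope classical_set_scope.
Local Open Scope ring_scope.
Local Open Scope complex_scope.

(** * Complex-valued integrals *)

(** The triple integral over [t], [x] and [u] is not absolutely convergent: the Gaussian of rate [t]
    has mass of order t^(-n/2), and t^(s-1-n/2) is not integrable at 0 because s < n/2. The
    transform is therefore moved at fixed [t], between two double exchanges that do converge
    absolutely: one in (x, t), where the decay of the transform of the chirped test function
    controls small [t], and one in (u, t), where exp(- pi^2 |tilde u|^2 / t) controls it. This is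
    why the decay of that transform has to be proved beforehand. For the decay, the chirp is kept in
    the phase, so that the amplitude is the Schwartz function as given; the part of the phase
    derivative that grows linearly is absorbed into a twisted derivative, under which the class of
    amplitudes is stable. The distribution on the left is shown to be tempered last, as a
    consequence of its agreement with the explicit one on the right. *)

Section complex_numbers.
Variable R : realType.
Implicit Types (x y : R[i]) (a b : R).

Lemma Re_add x y : complex.Re (x + y) = complex.Re x + complex.Re y.
Proof. by case: x; case: y. Qed.

Lemma Im_add x y : complex.Im (x + y) = complex.Im x + complex.Im y.
Proof. by case: x; case: y. Qed.

Lemma Re_mul x y :
  complex.Re (x * y) = complex.Re x * complex.Re y - complex.Im x * complex.Im y.
Proof. by case: x; case: y. Qed.

Lemma Im_mul x y :
  complex.Im (x * y) = complex.Re x * complex.Im y + complex.Im x * complex.Re y.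
Proof. by case: x; case: y. Qed.

Lemma Re_realM a x : complex.Re (a%:C * x) = a * complex.Re x.
Proof. by rewrite Re_mul /= mul0r subr0. Qed.

Lemma Im_realM a x : complex.Im (a%:C * x) = a * complex.Im x.
Proof. by rewrite Im_mul /= mul0r addr0. Qed.

Lemma normcE x : normc x = Num.sqrt (complex.Re x ^+ 2 + complex.Im x ^+ 2).
Proof. by case: x. Qed.

Lemma normc_ge0 x : 0 <= normc x.
Proof. by rewrite normcE sqrtr_ge0. Qed.

Lemma normc_real a : normc a%:C = `|a|.
Proof. by rewrite normcE /= expr0n addr0 sqrtr_sqr. Qed.

Lemma normc_realM a x : normc (a%:C * x) = `|a| * normc x.
Proof. by rewrite normcM normc_real. Qed.

Lemma normc_expi a : normc (expi a) = 1.
Proof. by rewrite normcE /= cos2Dsin2 sqrtr1. Qed.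

Lemma normRe_le x : `|complex.Re x| <= normc x.
Proof.
by rewrite normcE -sqrtr_sqr ler_wsqrtr// lerDl sqr_ge0.
Qed.

Lemma normIm_le x : `|complex.Im x| <= normc x.
Proof.
by rewrite normcE -sqrtr_sqr ler_wsqrtr// lerDr sqr_ge0.
Qed.

Lemma normc_le x : normc x <= `|complex.Re x| + `|complex.Im x|.
Proof.
rewrite normcE -[leRHS]ger0_norm ?addr_ge0// -sqrtr_sqr ler_wsqrtr// sqrrD.
rewrite !real_normK ?num_real// -addrAC lerDl.
by rewrite mulrn_wge0// mulr_ge0.
Qed.

Lemma expiD a b : expi (a + b) = expi a * expi b.
Proof.
by rewrite /expi cosD sinD; congr Complex; rewrite addrC mulrC [X in _ + X]mulrC.
Qed.

Lemma expi0 : expi (0 : R) = 1.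
Proof. by rewrite /expi cos0 sin0. Qed.

Lemma expi_sum (I : Type) (s : seq I) (P : pred I) (F : I -> R) :
  expi (\sum_(i <- s | P i) F i) = \prod_(i <- s | P i) expi (F i).
Proof. exact: (big_morph (@expi R) expiD expi0). Qed.

End complex_numbers.

Section cmeasurable.
Context d (T : measurableType d) (R : realType).
Implicit Types f g : T -> R[i].

Definition cmeasurable f : Prop :=
  measurable_fun setT (fun x => complex.Re (f x)) /\
  measurable_fun setT (fun x => complex.Im (f x)).

Lemma cmeasurable_real (h : T -> R) :
  measurable_fun setT h -> cmeasurable (fun x => (h x)%:C).
Proof. by move=> mh; split => //=; exact: measurable_cst. Qed.

Lemma cmeasurable_cst (c : R[i]) : cmeasurable (fun=> c).
Proof. by split; exact: measurable_cst. Qed.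

Lemma cmeasurableD f g :
  cmeasurable f -> cmeasurable g -> cmeasurable (fun x => f x + g x).
Proof.
move=> [rf jf] [rg jg]; split.
- by under eq_fun do rewrite Re_add; exact: measurable_funD.
- by under eq_fun do rewrite Im_add; exact: measurable_funD.
Qed.

Lemma cmeasurableM f g :
  cmeasurable f -> cmeasurable g -> cmeasurable (fun x => f x * g x).
Proof.
move=> [rf jf] [rg jg]; split.
- under eq_fun do rewrite Re_mul.
  by apply: measurable_funB; exact: measurable_funM.
- under eq_fun do rewrite Im_mul.
  by apply: measurable_funD; exact: measurable_funM.
Qed.

Lemma cmeasurable_expi (h : T -> R) :
  measurable_fun setT h -> cmeasurable (fun x => expi (h x)).
Proof.
move=> mh; split => /=.
- by apply: (measurableT_comp _ mh); apply: continuous_measurable_fun; exact: continuous_cos.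
- by apply: (measurableT_comp _ mh); apply: continuous_measurable_fun; exact: continuous_sin.
Qed.

Lemma cmeasurable_prod (I : eqType) (s : seq I) (h : I -> T -> R[i]) :
  (forall i, cmeasurable (h i)) -> cmeasurable (fun x => \prod_(i <- s) h i x).
Proof.
move=> mh; elim: s => [|i s IH].
  by under eq_fun do rewrite big_nil; exact: cmeasurable_cst.
by under eq_fun do rewrite big_cons; exact: cmeasurableM.
Qed.

Lemma measurable_normc f : cmeasurable f ->
  measurable_fun setT (fun x => normc (f x)).
Proof.
move=> [rf jf]; under eq_fun do rewrite normcE.
apply: (@measurableT_comp _ _ _ _ _ _ (@Num.sqrt R)).
  by apply: continuous_measurable_fun; exact: sqrt_continuous.
by apply: measurable_funD; exact: measurable_funX.
Qed.

End cmeasurable.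

Lemma cmeasurable_comp d1 d2 (T1 : measurableType d1) (T2 : measurableType d2)
    (R : realType) (phi : T1 -> T2) (f : T2 -> R[i]) :
  measurable_fun setT phi -> cmeasurable f -> cmeasurable (fun x => f (phi x)).
Proof.
move=> mphi [rf jf]; split.
- exact: (measurableT_comp rf mphi).
- exact: (measurableT_comp jf mphi).
Qed.

Section cintegral.
Context d (T : measurableType d) (R : realType) (mu : {measure set T -> \bar R}).
Implicit Types f g : T -> R[i].

Lemma cintegrable_cmeasurable f : cintegrable mu setT f -> cmeasurable f.
Proof.
by move=> [/integrableP[/measurable_EFinP rf _] /integrableP[/measurable_EFinP jf _]].
Qed.

Lemma cintegrable_le f (h : T -> R) : cmeasurable f ->
  mu.-integrable setT (EFin \o h) -> (forall x, normc (f x) <= h x) ->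
  cintegrable mu setT f.
Proof.
move=> [rf jf] ih fh; split.
- apply: (le_integrable _ _ _ ih) => //; first exact/measurable_EFinP.
  move=> x _; rewrite lee_fin.
  by rewrite (le_trans (normRe_le _))// (le_trans (fh x))// ler_norm.
- apply: (le_integrable _ _ _ ih) => //; first exact/measurable_EFinP.
  move=> x _; rewrite lee_fin.
  by rewrite (le_trans (normIm_le _))// (le_trans (fh x))// ler_norm.
Qed.

Lemma cintegrable_normc f : cintegrable mu setT f ->
  mu.-integrable setT (EFin \o (fun x => normc (f x))).
Proof.
move=> f_int; have mf := cintegrable_cmeasurable f_int.
have [rf jf] := f_int.
have := integrableD measurableT (integrable_abse rf) (integrable_abse jf).
apply: le_integrable => //.
  by apply/measurable_EFinP; exact: measurable_normc.
move=> x _ /=; rewrite lee_fin (ger0_norm (normc_ge0 _)).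
by rewrite (le_trans (normc_le _)) ?ler_norm.
Qed.

Lemma cintegrableZl (c : R[i]) f :
  cintegrable mu setT f -> cintegrable mu setT (fun x => c * f x).
Proof.
move=> f_int; apply: (@cintegrable_le _ (fun x => normc c * normc (f x))).
- apply: cmeasurableM; first exact: cmeasurable_cst.
  exact: cintegrable_cmeasurable.
- apply: eq_integrable (integrableZl measurableT (normc c) (cintegrable_normc f_int)) => //.
- by move=> x; rewrite normcM.
Qed.

Lemma cintegrableD f g : cintegrable mu setT f -> cintegrable mu setT g ->
  cintegrable mu setT (fun x => f x + g x).
Proof.
move=> [rf jf] [rg jg]; split.
- apply: eq_integrable (integrableD measurableT rf rg) => // x _ /=.
  by rewrite Re_add EFinD.
- apply: eq_integrable (integrableD measurableT jf jg) => // x _ /=.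
  by rewrite Im_add EFinD.
Qed.

Lemma cintegralD f g : cintegrable mu setT f -> cintegrable mu setT g ->
  cintegral mu setT (fun x => f x + g x) =
  cintegral mu setT f + cintegral mu setT g.
Proof.
move=> [rf jf] [rg jg]; rewrite /cintegral.
under eq_Rintegral do rewrite Re_add.
rewrite RintegralD//.
under [in X in _ +i* X]eq_Rintegral do rewrite Im_add.
by rewrite RintegralD.
Qed.

Lemma cintegralZl (c : R[i]) f : cintegrable mu setT f ->
  cintegral mu setT (fun x => c * f x) = c * cintegral mu setT f.
Proof.
move=> [rf jf]; rewrite /cintegral.
have iZ r h : mu.-integrable setT (EFin \o h) ->
    mu.-integrable setT (EFin \o (fun x : T => r * h x)).
  by move=> ih; apply: eq_integrable (integrableZl measurableT r ih).
case: c => a b.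
under eq_Rintegral do rewrite Re_mul/=.
rewrite RintegralB//; [|exact: iZ..].
rewrite !RintegralZl//.
under [in X in _ +i* X]eq_Rintegral do rewrite Im_mul/=.
by rewrite RintegralD//; [rewrite !RintegralZl|exact: iZ..].
Qed.

Lemma eq_cintegral f g : f =1 g -> cintegral mu setT f = cintegral mu setT g.
Proof. by move=> /funext->. Qed.

Lemma ae_eq_cintegral f g : cmeasurable f -> cmeasurable g ->
  {ae mu, forall x, f x = g x} ->
  cintegral mu setT f = cintegral mu setT g.
Proof.
move=> [rf jf] [rg jg] fg; rewrite /cintegral /Rintegral.
congr (fine _ +i* fine _); apply: ae_eq_integral => //; try exact/measurable_EFinP.
- by apply: filterS fg => x -> _.
- by apply: filterS fg => x -> _.
Qed.

(** Real and imaginary parts are estimated separately by [B], whence the factor 2. The constants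
    obtained from it are never meant to be sharp. *)
Lemma normc_cintegral_le f (h : T -> R) (B : R) : cintegrable mu setT f ->
  mu.-integrable setT (EFin \o h) ->
  (forall x, normc (f x) <= h x) ->
  (\int[mu]_x h x <= B) -> normc (cintegral mu setT f) <= 2 * B.
Proof.
move=> [rf jf] ih fh hB; apply: le_trans (normc_le _) _ => /=.
have bnd (p : T -> R) : mu.-integrable setT (EFin \o p) ->
    (forall x, `|p x| <= normc (f x)) -> `|\int[mu]_x p x| <= B.
  move=> ip pf; apply: (le_trans (le_normr_Rintegral _ _)) => //.
  apply: le_trans hB; apply: le_Rintegral => //.
    exact: (integrable_norm ip).
  by move=> x _; exact: le_trans (fh x).
by rewrite mulr_natl mulr2n lerD// bnd// => x; [exact: normRe_le|exact: normIm_le].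
Qed.

Lemma cintegral_real (h : T -> R) :
  cintegral mu setT (fun x => (h x)%:C) = (\int[mu]_x h x)%:C.
Proof.
rewrite /cintegral/= /Rintegral; congr (_ +i* _).
by rewrite [X in fine X]integral0_eq.
Qed.

Lemma cintegrable_real (h : T -> R) : mu.-integrable setT (EFin \o h) ->
  cintegrable mu setT (fun x => (h x)%:C).
Proof. by move=> ih; split => //=; exact: integrable0. Qed.

Lemma cintegral0 : cintegral mu setT (fun=> 0) = 0.
Proof. by rewrite /cintegral/= /Rintegral integral0_eq. Qed.

(** Fubini's theorem yields partial integrals in the extended reals that are finite only almost
    everywhere; passing to [fine] alters them on a null set. *)
Lemma integrable_fine (F : T -> \bar R) : mu.-integrable setT F ->
  mu.-integrable setT (EFin \o (fine \o F)) /\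
  \int[mu]_x fine (F x) = fine (\int[mu]_x F x)%E.
Proof.
move=> iF; have mF := measurable_int _ iF.
have mfF : measurable_fun setT (EFin \o (fine \o F)).
  by apply/measurable_EFinP; apply: measurableT_comp.
have aeF : ae_eq mu setT F (EFin \o (fine \o F)).
  have := integrable_ae measurableT iF; apply: filterS => x Fx xT /=.
  by rewrite fineK//; exact: Fx.
split; last by rewrite /Rintegral; congr fine; apply/esym/ae_eq_integral.
apply: le_integrable iF => // x _ /=.
by case: (F x) => [r| |] /=; rewrite ?normr0 ?leey.
Qed.

End cintegral.

(** * Tonelli and Fubini for complex-valued functions *)

Section cfubini.
Context d1 d2 (T1 : measurableType d1) (T2 : measurableType d2) (R : realType).
Variable m1 : {sigma_finite_measure set T1 -> \bar R}.
Variable m2 : {sigma_finite_measure set T2 -> \bar R}.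
Implicit Types f : T1 * T2 -> R[i].

Lemma cintegrable_prod1 f : cmeasurable f ->
  (\int[m1]_x \int[m2]_y (normc (f (x, y)))%:E < +oo)%E ->
  cintegrable (m1 \x m2)%E setT f.
Proof.
move=> mf foo; have mn := measurable_normc mf.
apply: (@cintegrable_le _ _ _ _ _ (fun z => normc (f z))) => //.
apply/integrable12ltyP; first exact/measurable_EFinP.
rewrite (_ : (\int[m1]_x _)%E = (\int[m1]_x \int[m2]_y (normc (f (x, y)))%:E)%E)//.
by apply: eq_integral => x _; apply: eq_integral => y _ /=; rewrite ger0_norm ?normc_ge0.
Qed.

Lemma cintegrable_prod2 f : cmeasurable f ->
  (\int[m2]_y \int[m1]_x (normc (f (x, y)))%:E < +oo)%E ->
  cintegrable (m1 \x m2)%E setT f.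
Proof.
move=> mf foo; apply: cintegrable_prod1 => //.
rewrite (fubini_tonelli (fun z => (normc (f z))%:E))//.
- by apply/measurable_EFinP; exact: measurable_normc.
- by move=> z; rewrite lee_fin normc_ge0.
Qed.

Lemma cintegrable_tensor f (a : T1 -> R) (b : T2 -> R) : cmeasurable f ->
  m1.-integrable setT (EFin \o a) -> m2.-integrable setT (EFin \o b) ->
  (forall x y, normc (f (x, y)) <= a x * b y) ->
  cintegrable (m1 \x m2)%E setT f.
Proof.
move=> mf ia ib fab; apply: cintegrable_prod1 => //.
have mn := measurable_normc mf.
have /integrableP[/measurable_EFinP ma _] := ia.
have /integrableP[/measurable_EFinP mb _] := ib.
(* The factors [a] and [b] carry no sign assumption, so the estimate runs through their absolute
   values. *)
have ma' : measurable_fun setT (fun x => `|a x|) by exact: measurableT_comp.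
have mb' : measurable_fun setT (fun y => `|b y|) by exact: measurableT_comp.
have /integrableP[_ ia'] := integrable_norm ia.
have /integrableP[_ ib'] := integrable_norm ib.
pose B := (\int[m2]_y (`|b y|%:E))%E.
have Boo : (B < +oo)%E.
  by apply: le_lt_trans ib'; apply: ge0_le_integral => //=;
    do ?[exact/measurable_EFinP/measurableT_comp|exact/measurable_EFinP] => y _;
    rewrite lee_fin ler_norm.
have Aoo : (\int[m1]_x (`|a x|%:E) < +oo)%E.
  by apply: le_lt_trans ia'; apply: ge0_le_integral => //=;
    do ?[exact/measurable_EFinP/measurableT_comp|exact/measurable_EFinP] => x _;
    rewrite lee_fin ler_norm.
have B0 : (0 <= B)%E by apply: integral_ge0 => y _; rewrite lee_fin.
have Bfin : B \is a fin_num by rewrite ge0_fin_numE.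
apply: (@le_lt_trans _ _ (\int[m1]_x (`|a x|%:E * B))%E).
  apply: ge0_le_integral => //.
  - by move=> x _; apply: integral_ge0 => y _; rewrite lee_fin normc_ge0.
  - apply: (measurable_fun_fubini_tonelli_F (fun z => (normc (f z))%:E)) => //.
    + exact/measurable_EFinP.
    + by move=> z; rewrite lee_fin normc_ge0.
  - by apply: emeasurable_funM; [exact/measurable_EFinP|exact: measurable_cst].
  - move=> x _; rewrite /B -ge0_integralZl//; last exact/measurable_EFinP.
    apply: ge0_le_integral => //.
    + by move=> y _; rewrite lee_fin normc_ge0.
    + by apply/measurable_EFinP; apply: (measurableT_comp mn).
    + by apply: emeasurable_funM; [exact: measurable_cst|exact/measurable_EFinP].
    + by move=> y _; rewrite -EFinM lee_fin -normrM (le_trans (fab x y))// ler_norm.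
rewrite ge0_integralZr//; last exact/measurable_EFinP.
by rewrite lte_mul_pinfty// ?ge0_fin_numE// integral_ge0.
Qed.

Lemma integrable_swap (F : T1 * T2 -> \bar R) :
  (m1 \x m2)%E.-integrable setT F -> (m2 \x m1)%E.-integrable setT (fun z => F (z.2, z.1)).
Proof.
move=> iF; have mF := measurable_int _ iF.
apply/integrable12ltyP.
  apply: (measurableT_comp mF); apply/measurable_fun_pairP.
  by split; [exact: measurable_snd|exact: measurable_fst].
exact: (integrable21ltyP m1 m2 mF).1.
Qed.

(** The first two conclusions also serve as the source of measurability for integrals that depend on
    a parameter. *)
Lemma cfubini f : cintegrable (m1 \x m2)%E setT f ->
  [/\ cintegrable m1 setT (fun x => cintegral m2 setT (fun y => f (x, y))),
      cintegrable m2 setT (fun y => cintegral m1 setT (fun x => f (x, y))) &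
      cintegral m1 setT (fun x => cintegral m2 setT (fun y => f (x, y))) =
      cintegral m2 setT (fun y => cintegral m1 setT (fun x => f (x, y)))].
Proof.
move=> [rf jf].
have [rF rFE] := integrable_fine (integrable_fubini_F rf).
have [rG rGE] := integrable_fine (integrable_fubini_F (integrable_swap rf)).
have [jF jFE] := integrable_fine (integrable_fubini_F jf).
have [jG jGE] := integrable_fine (integrable_fubini_F (integrable_swap jf)).
split; [by split|by split|].
rewrite /cintegral; congr (_ +i* _).
- rewrite [LHS]rFE [RHS]rGE /fubini_F /fubini_G.
  by rewrite (Fubini rf).
- rewrite [LHS]jFE [RHS]jGE /fubini_F /fubini_G.
  by rewrite (Fubini jf).
Qed.

End cfubini.

(** * Integrals over row vectors *)

Section measurable_topology_rV.
Variables (R : realType) (n : nat).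

Lemma measurable_rV_entry (i : 'I_n) :
  measurable_fun [set: 'rV[R]_n] (fun x : 'rV[R]_n => x ord0 i).
Proof. exact: (measurable_rV_coord i). Qed.

(** The sigma-algebra is generated by the coordinates and the topology by the matrix norm. They meet
    in the boxes with rational centre and radius: an open set is the countable union of the boxes it
    contains. *)
Lemma open_measurable_rV (A : set 'rV[R]_n) : open A -> measurable A.
Proof.
move=> oA.
pose B (q : {ffun 'I_n -> rat} * rat) : set 'rV[R]_n :=
  [set x | forall i, `|ratr (q.1 i) - x ord0 i| < ratr q.2].
pose U q : set 'rV[R]_n := if `[< B q `<=` A >] then B q else set0.
have mB q : measurable (B q).
  rewrite (_ : B q = \big[setI/setT]_(i < n)
      ((fun x : 'rV[R]_n => `|ratr (q.1 i) - x ord0 i|) @^-1` `]-oo, ratr q.2[)).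
    apply: bigsetI_measurable => i _; rewrite -[X in measurable X]setTI.
    have mi : measurable_fun setT
        (fun x : 'rV[R]_n => `|ratr (q.1 i) - x ord0 i|).
      apply: measurableT_comp => //; apply: measurable_funB => //.
      exact: measurable_rV_entry.
    exact: (mi measurableT _ (measurable_itv _)).
  apply/seteqP; split => [x Bx|x].
    rewrite -bigcap_seq => i _ /=; rewrite in_itv/=; exact: Bx.
  rewrite -bigcap_seq => Bx i; have := Bx i (mem_index_enum _).
  by rewrite /= in_itv.
rewrite (_ : A = \bigcup_q U q); last first.
  apply/seteqP; split => [x Ax|x [q _]]; last first.
    by rewrite /U; case: asboolP => // BA; exact: BA.
  have /nbhs_ballP[e /= e0 eA] : nbhs x A by exact: open_nbhs_nbhs.
  (* Half of [e], since both [x] and [y] are compared with the rational centre. *)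
  have [k ke] : exists k : rat, (0 : R) < ratr k < e / 2.
    have e20 : 0 < e / 2 by rewrite divr_gt0.
    have := @dense_rat R `]0, (e / 2)[%classic.
    case=> [||y [/= + [k _ ky]]].
    - by exists (e / 4) => /=; rewrite in_itv/=; apply/andP; split; lra.
    - exact: interval_open.
    by rewrite in_itv/= -ky; exists k.
  have /choice[q hq] : forall i : 'I_n, exists q : rat,
      `|ratr q - x ord0 i| < ratr k.
    move=> i; have /andP[k0 _] := ke.
    have := @dense_rat R `](x ord0 i - ratr k), (x ord0 i + ratr k)[%classic.
    case=> [||y [/= + [q _ qy]]].
    - by exists (x ord0 i) => /=; rewrite in_itv/=; apply/andP; split; lra.
    - exact: interval_open.
    by rewrite in_itv/= -qy => ?; exists q; rewrite ltr_distl.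
  exists ([ffun i => q i], k) => //; rewrite /U asboolT.
    by move=> i /=; rewrite ffunE; exact: hq.
  move=> y By; apply: eA; split => // i j; rewrite (ord1 i).
  have := By j; rewrite /= ffunE => yj; have xj := hq j.
  rewrite /ball/= -(subrK (ratr (q j)) (x ord0 j)) -addrA.
  have /andP[_ k2] := ke.
  rewrite (le_lt_trans (ler_normD _ _))// distrC.
  rewrite [e]splitr; apply: ltrD; exact: lt_trans k2.
apply: countable_bigcupT_measurable => //.
by move=> q; rewrite /U; case: ifP.
Qed.

Lemma continuous_measurable_fun_rV (f : 'rV[R]_n -> R) :
  continuous f -> measurable_fun setT f.
Proof.
move=> /continuousP cf.
apply: (measurability _ (RGenOpens.measurableE R)).
move=> _ [_ [a [b ->] <-]]; rewrite setTI; apply: open_measurable_rV.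
by apply: cf; exact: interval_open.
Qed.

Lemma closed_measurable_rV (A : set 'rV[R]_n) : closed A -> measurable A.
Proof.
rewrite -openC => oA; rewrite -[A]setCK.
by apply: measurableC; exact: open_measurable_rV.
Qed.

Lemma compact_measurable_rV (A : set 'rV[R]_n) : compact A -> measurable A.
Proof.
by move=> cA; apply: closed_measurable_rV; exact: compact_closed.
Qed.

End measurable_topology_rV.

Section integral_rV.
Variable R : realType.
Local Notation leb := (@lebesgue_measure R).

Lemma integrable_rVS n (f : 'rV[R]_n.+1 -> \bar R) : measurable_fun setT f ->
  (lebesgue_rV R n.+1).-integrable setT f <->
  (leb \x lebesgue_rV R n)%E.-integrable setT (f \o @cons_rV R n).
Proof.
move=> mf; have mfc := measurableT_comp mf (@measurable_cons_rV R n).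
have E : (\int[lebesgue_rV R n.+1]_x `|f x| =
    \int[leb \x lebesgue_rV R n]_x `|(f \o @cons_rV R n) x|)%E.
  rewrite (ge0_integral_pushforward (@measurable_cons_rV R n)
    (leb \x lebesgue_rV R n)%E measurableT)//; exact: measurableT_comp.
by split=> /integrableP[_ foo]; apply/integrableP; split=> //;
  [rewrite -E|rewrite E].
Qed.

Lemma cintegrable_rVS n (f : 'rV[R]_n.+1 -> R[i]) : cmeasurable f ->
  cintegrable (leb \x lebesgue_rV R n)%E setT (f \o @cons_rV R n) ->
  cintegrable (lebesgue_rV R n.+1) setT f.
Proof.
move=> [rf jf] [rc jc]; split; apply/integrable_rVS => //; exact/measurable_EFinP.
Qed.

Lemma cintegral_rVS n (f : 'rV[R]_n.+1 -> R[i]) :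
  cintegrable (lebesgue_rV R n.+1) setT f ->
  cintegral (lebesgue_rV R n.+1) setT f =
  cintegral leb setT
    (fun a => cintegral (lebesgue_rV R n) setT (fun y => f (cons_rV (a, y)))).
Proof.
move=> f_int; have [mrf mjf] := cintegrable_cmeasurable f_int.
have [rf jf] := f_int.
have E (h : 'rV[R]_n.+1 -> R) : measurable_fun setT h ->
    (lebesgue_rV R n.+1).-integrable setT (EFin \o h) ->
    \int[lebesgue_rV R n.+1]_x h x =
    \int[leb]_a \int[lebesgue_rV R n]_y h (cons_rV (a, y)).
  move=> mh ih.
  have mE : measurable_fun setT (EFin \o h) by exact/measurable_EFinP.
  have ihc := (integrable_rVS mE).1 ih.
  have [_ FE] := integrable_fine (integrable_fubini_F ihc).
  rewrite {1}/Rintegral (@integral_pushforward _ _ _ _ R _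
    (@measurable_cons_rV R n) (leb \x lebesgue_rV R n)%E setT _ mE)//.
  by rewrite preimage_setT -(integral12_prod_meas1 ihc); exact/esym.
by rewrite /cintegral (E _ mrf rf) (E _ mjf jf).
Qed.

Lemma cons_rV0 n (p : R * 'rV[R]_n) : cons_rV p ord0 ord0 = p.1.
Proof.
exact: (congr1 fst (cons_rVK p)).
Qed.

Lemma cons_rV_lift n (p : R * 'rV[R]_n) (i : 'I_n) :
  cons_rV p ord0 (lift ord0 i) = p.2 ord0 i.
Proof.
have := congr1 (fun q : R * 'rV[R]_n => q.2 ord0 i) (cons_rVK p).
by rewrite /uncons_rV [LHS]mxE => <-; congr fun_of_matrix; exact: val_inj.
Qed.

Lemma cmeasurable_tensor n (h : 'I_n -> R -> R[i]) :
  (forall i, cmeasurable (h i)) ->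
  cmeasurable (fun x : 'rV[R]_n => \prod_i h i (x ord0 i)).
Proof.
move=> mh; apply: (@cmeasurable_prod _ _ _ _ _ (fun i (x : 'rV[R]_n) => h i (x ord0 i))) => i.
exact: (cmeasurable_comp (@measurable_rV_entry R n i) (mh i)).
Qed.

Lemma cintegral_tensor n (h : 'I_n -> R -> R[i]) :
  (forall i, cintegrable leb setT (h i)) ->
  cintegrable (lebesgue_rV R n) setT (fun x : 'rV[R]_n => \prod_i h i (x ord0 i)) /\
  cintegral (lebesgue_rV R n) setT (fun x : 'rV[R]_n => \prod_i h i (x ord0 i)) =
  \prod_i cintegral leb setT (h i).
Proof.
elim: n h => [|n IH] h ih.
  under [X in cintegral _ _ X]eq_fun do rewrite big_ord0.
  under [X in cintegrable _ _ X]eq_fun do rewrite big_ord0.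
  (* In dimension 0 the measure is a Dirac mass, matching the empty product 1. *)
  have D (r : R) : (\int[lebesgue_rV R 0]_x r%:E)%E = r%:E.
    by rewrite /= integral_dirac// diracT mul1e.
  rewrite big_ord0; split; last by rewrite /cintegral /Rintegral !D.
  by split; apply/integrableP; split; rewrite ?D ?ltry//; exact: measurable_cst.
have {IH}[IHi IHE] := IH (fun i => h (lift ord0 i)) (fun i => ih _).
have mh i := cintegrable_cmeasurable (ih i).
have hS a (y : 'rV[R]_n) : \prod_i h i (cons_rV (a, y) ord0 i) =
    h ord0 a * \prod_i h (lift ord0 i) (y ord0 i).
  rewrite big_ord_recl cons_rV0; congr (_ * _).
  by apply: eq_bigr => i _; rewrite cons_rV_lift.
have ip : cintegrable (lebesgue_rV R n.+1) setT
    (fun x : 'rV[R]_n.+1 => \prod_i h i (x ord0 i)).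
  apply: cintegrable_rVS; first exact: cmeasurable_tensor.
  apply: (@cintegrable_tensor _ _ _ _ R leb (lebesgue_rV R n) _ (fun a => normc (h ord0 a))
    (fun y : 'rV[R]_n => normc (\prod_i h (lift ord0 i) (y ord0 i)))).
  - by apply: (cmeasurable_comp (@measurable_cons_rV R n)); exact: cmeasurable_tensor.
  - exact: cintegrable_normc.
  - exact: cintegrable_normc.
  - by move=> a y; rewrite /comp hS normcM.
split=> //; rewrite cintegral_rVS// big_ord_recl -IHE mulrC -cintegralZl//.
apply: eq_cintegral => a; rewrite mulrC -cintegralZl//.
by apply: eq_cintegral => y; rewrite hS.
Qed.

Lemma integral_tensor n (h : 'I_n -> R -> R) :
  (forall i, leb.-integrable setT (EFin \o h i)) ->
  (lebesgue_rV R n).-integrable setT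
    (EFin \o (fun x : 'rV[R]_n => \prod_i h i (x ord0 i))) /\
  \int[lebesgue_rV R n]_x (\prod_i h i (x ord0 i)) =
  \prod_i \int[leb]_t h i t.
Proof.
move=> ih.
have [i1 E] := @cintegral_tensor n (fun i t => (h i t)%:C) (fun i => cintegrable_real (ih i)).
have P (x : 'rV[R]_n) : \prod_i (h i (x ord0 i))%:C = (\prod_i h i (x ord0 i))%:C.
  by rewrite rmorph_prod.
split.
  by have [+ _] := i1; under eq_fun do rewrite P.
apply: complexI; rewrite -cintegral_real; under eq_fun do rewrite -P.
rewrite E rmorph_prod; apply: eq_bigr => i _; exact: cintegral_real.
Qed.

End integral_rV.

(** * One-dimensional calculus *)

Section one_dimensional_calculus.
Variable R : realType.
Local Notation leb := (@lebesgue_measure R).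
Implicit Types (f h d : R -> R).

(** By monotone convergence. Improper integrals are bounded in this way by the fundamental theorem
    of calculus on compact intervals, with a bound independent of the interval. *)
Lemma ge0_integral_bigcup_le dT (T : measurableType dT) (mu : {measure set T -> \bar R})
    (F : (set T)^nat) (f : T -> \bar R) (B : \bar R) :
  {homo F : n m / (n <= m)%N >-> (n <= m)%O} ->
  (forall i, measurable (F i)) -> measurable_fun (\bigcup_i F i) f ->
  (forall x, 0 <= f x)%E ->
  (forall i, \int[mu]_(x in F i) f x <= B)%E ->
  (\int[mu]_(x in \bigcup_i F i) f x <= B)%E.
Proof.
move=> ndF mF mf f0 FB.
have mFf i : measurable_fun (F i) f.
  apply: measurable_funS mf; first exact: bigcupT_measurable.
  exact: bigcup_sup.
have cv := ge0_nondecreasing_set_cvg_integral (mu := mu) ndF mF mFf (fun i x _ => f0 x).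
rewrite -(cvg_lim _ cv)//.
by apply: lime_le; [exact: cvgP cv|exact: nearW].
Qed.

Lemma integral_itv_derive f (F : R -> R) (a b : R) : a < b ->
  (forall x : R, x \in `[a, b] -> is_derive x 1 F (f x)) ->
  (forall x : R, x \in `[a, b] -> {for x, continuous f}) ->
  (\int[leb]_(x in `[a, b]) (f x)%:E = (F b - F a)%:E)%E.
Proof.
move=> ab dF cf.
have inab : a \in `[a, b] /\ b \in `[a, b] by rewrite !in_itv/= !lexx ltW.
have cF x : x \in `[a, b] -> {for x, continuous F}.
  move=> xab; apply/differentiable_continuous/derivable1_diffP.
  by have [] := dF _ xab.
rewrite (@continuous_FTC2 _ f F)//.
- by apply: continuous_in_subspaceT => x /set_mem; exact: cf.
- split.
  + move=> x xab; have [|//] := dF x; exact: subset_itv_oo_cc xab.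
  + by apply: cvg_at_right_filter; exact: cF inab.1.
  + by apply: cvg_at_left_filter; exact: cF inab.2.
- move=> x xab; rewrite derive1E; apply: derive_val.
  by apply: dF; exact: subset_itv_oo_cc xab.
Qed.

(** The inverse square of the Japanese bracket. It is integrable, being the derivative of the
    arctangent, and lies below 1/t, so that functions it dominates leave no boundary terms. *)
Definition japanese (t : R) : R := (1 + t ^+ 2)^-1.

Lemma japanese_gt0 t : 0 < japanese t.
Proof. by rewrite invr_gt0 ltr_pwDl// sqr_ge0. Qed.

Lemma japanese_ge0 t : 0 <= japanese t.
Proof. exact: ltW (japanese_gt0 t). Qed.

Lemma japanese_le1 t : japanese t <= 1.
Proof. by rewrite invf_le1 ?lerDl ?sqr_ge0// ltr_pwDl// sqr_ge0. Qed.

Lemma japaneseN t : japanese (- t) = japanese t.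
Proof. by rewrite /japanese sqrrN. Qed.

Lemma japanese_leV t : 0 < t -> japanese t <= t^-1.
Proof.
move=> t0; rewrite lef_pV2 ?posrE ?ltr_pwDl ?sqr_ge0//.
have := sqr_ge0 (t - 1); nra.
Qed.

Lemma continuous_japanese : continuous japanese.
Proof.
move=> t; apply: cvgV; first by rewrite gt_eqF// ltr_pwDl// sqr_ge0.
exact: (cvgD (cvg_cst _) (@exprn_continuous _ 2 t)).
Qed.

Lemma measurable_japanese : measurable_fun setT japanese.
Proof. by apply: continuous_measurable_fun; exact: continuous_japanese. Qed.

Lemma bigcup_itv_nat : \bigcup_k `[- k.+1%:R, k.+1%:R]%classic = [set: R].
Proof.
apply/seteqP; split => // x _; exists (Num.truncn `|x|) => //=.
by rewrite in_itv/= -ler_norml ltW// truncnS_gt.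
Qed.

Lemma nondecreasing_itv_nat :
  {homo (fun k : nat => `[- k.+1%:R, k.+1%:R]%classic : set R) :
    n m / (n <= m)%N >-> (n <= m)%O}.
Proof.
move=> k m km; apply/subsetPset => x /=; rewrite !in_itv/=.
have : k.+1%:R <= m.+1%:R :> R by rewrite ler_nat.
by move=> ? /andP[? ?]; apply/andP; split; lra.
Qed.

Lemma integrable_japanese : leb.-integrable setT (EFin \o japanese).
Proof.
apply/integrableP; split; first by apply/measurable_EFinP; exact: measurable_japanese.
rewrite -bigcup_itv_nat.
apply: (@le_lt_trans _ _ pi%:E); last by rewrite ltry.
apply: ge0_integral_bigcup_le => //.
- exact: nondecreasing_itv_nat.
- by rewrite bigcup_itv_nat; apply/measurable_EFinP/measurableT_comp => //;
    exact: measurable_japanese.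
- move=> k.
  under eq_integral do rewrite /= ger0_norm ?japanese_ge0//.
  rewrite (@integral_itv_derive _ (@atan R)).
  + rewrite lee_fin atanN opprK; have := atan_ltpi2 (k.+1%:R : R).
    by move=> ?; lra.
  + by rewrite (@lt_trans _ _ 0)// oppr_lt0.
  + by move=> x _; exact: continuous_japanese.
Qed.

(** Integration by parts in the form used throughout: over [-k-1, k+1] the integral is a difference
    of boundary values, which vanish in the limit by the bound on [h], while the bound on [d]
    permits dominated convergence. *)
Lemma integral_derive_eq0 h d (C : R) :
  (forall x : R, is_derive x 1 h (d x)) -> continuous d ->
  (forall x, `|h x| <= C * japanese x) -> (forall x, `|d x| <= C * japanese x) ->
  leb.-integrable setT (EFin \o d) /\ \int[leb]_x d x = 0.
Proof.
move=> hd cd hC dC.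
have md : measurable_fun setT d by exact: continuous_measurable_fun.
have iC : leb.-integrable setT (EFin \o (fun x => C * japanese x)).
  by apply: eq_integrable (integrableZl measurableT C integrable_japanese).
have C0 : 0 <= C.
  have := hC 0; rewrite /japanese expr0n/= addr0 invr1 mulr1.
  exact: le_trans.
have Cj x : 0 <= C * japanese x by rewrite mulr_ge0// japanese_ge0.
have idd : leb.-integrable setT (EFin \o d).
  apply: le_integrable iC => //; first exact/measurable_EFinP.
  by move=> x _ /=; rewrite lee_fin (ger0_norm (Cj x)).
split=> //.
pose I (k : nat) : set R := `[- k.+1%:R, k.+1%:R]%classic.
pose g (k : nat) x := (d x * \1_(I k) x)%:E.
have gI k : (\int[leb]_x g k x = (h k.+1%:R - h (- k.+1%:R))%:E)%E.
  rewrite -(@integral_itv_derive d h).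
  - rewrite [RHS]integral_mkcond; apply: eq_integral => x _.
    rewrite patchE /g indicE; case: ifP => _; by rewrite ?mulr1 ?mulr0.
  - by rewrite (@lt_trans _ _ 0)// oppr_lt0.
  - by move=> x _; exact: cd.
have mg k : measurable_fun setT (g k).
  apply/measurable_EFinP; apply: measurable_funM => //.
  by apply: measurable_indic; exact: measurable_itv.
have gd x : g ^~ x @ \oo --> (d x)%:E.
  apply: cvg_near_cst; exists (Num.truncn `|x|) => // k /= xk.
  rewrite /g /I indicE mem_set ?mulr1//= in_itv/= -ler_norml ltW//.
  by rewrite (lt_le_trans (truncnS_gt _))// ler_nat.
have gC x k : (`|g k x| <= (C * japanese x)%:E)%E.
  rewrite /g /= lee_fin normrM indicE.
  by case: (_ \in _); rewrite ?normr1 ?mulr1// normr0 mulr0.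
have mE : measurable_fun setT (EFin \o d) by exact/measurable_EFinP.
have [||_ _ gcvg] := @dominated_convergence _ _ _ leb setT measurableT g
    (EFin \o d) (EFin \o (fun x => C * japanese x)) mg mE _ iC _.
- by apply: aeW => x _; exact: gd.
- by apply: aeW => x k _; exact: gC.
have h0 : (fun k : nat => (h k.+1%:R - h (- k.+1%:R))%:E) @ \oo --> (0 : R)%:E.
  apply: cvg_EFin; first exact: nearW.
  have C0cvg : (fun k : nat => 2 * (C * (k.+1%:R)^-1)) @ \oo --> (0 : R).
    rewrite -[X in _ --> X](mulr0 2); apply: cvgMr.
    rewrite -[X in _ --> X](mulr0 C); apply: cvgMr.
    exact: cvg_harmonic.
  apply: norm_cvg0; apply: squeeze_cvgr (cvg_cst 0) C0cvg.
  apply: nearW => k /=; rewrite normr_ge0/= (le_trans (ler_normB _ _))//.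
  by rewrite mulr_natl mulr2n lerD// (le_trans (hC _))// ler_wpM2l// ?japaneseN
    japanese_leV.
suff : (\int[leb]_x (d x)%:E = (0 : R)%:E)%E by rewrite /Rintegral => ->.
rewrite -(cvg_lim _ gcvg)//; apply/cvg_lim => //.
by apply: cvg_trans h0; apply: near_eq_cvg; apply: nearW => k /=; rewrite gI.
Qed.

End one_dimensional_calculus.

Section pointwise_derivatives.
Variable R : realType.
Implicit Types (f g : R -> R) (x a b c : R).

Lemma is_derive_add f g x a b : is_derive x 1 f a -> is_derive x 1 g b ->
  is_derive x 1 (fun t => f t + g t) (a + b).
Proof. exact: is_deriveD. Qed.

Lemma is_derive_sub f g x a b : is_derive x 1 f a -> is_derive x 1 g b ->
  is_derive x 1 (fun t => f t - g t) (a - b).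
Proof. exact: is_deriveB. Qed.

Lemma is_derive_mul f g x a b : is_derive x 1 f a -> is_derive x 1 g b ->
  is_derive x 1 (fun t => f t * g t) (a * g x + f x * b).
Proof.
move=> df dg; apply: is_derive_eq (is_deriveM df dg) _.
by rewrite /GRing.scale/= addrC mulrC.
Qed.

Lemma is_derive_const c x : is_derive x 1 (fun=> c) (0 : R).
Proof. exact: is_derive_cst. Qed.

Lemma is_derive_var x : is_derive x 1 (fun t : R => t) (1 : R).
Proof. exact: is_derive_id. Qed.

Lemma is_derive_mulc c f x a : is_derive x 1 f a ->
  is_derive x 1 (fun t => c * f t) (c * a).
Proof.
move=> df; apply: is_derive_eq (is_derive_mul (is_derive_const c x) df) _.
by rewrite mul0r add0r.
Qed.

Lemma is_derive_affine c b x : is_derive x 1 (fun t => c * t + b) c.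
Proof.
apply: is_derive_eq
  (is_derive_add (is_derive_mulc c (is_derive_var x)) (is_derive_const b x)) _.
by rewrite mulr1 addr0.
Qed.

Lemma is_derive_after f g x a b : is_derive (g x) 1 f a -> is_derive x 1 g b ->
  is_derive x 1 (fun t => f (g t)) (a * b).
Proof. exact: is_derive1_comp. Qed.

Lemma is_derive_continuous f x a : is_derive x 1 f a -> {for x, continuous f}.
Proof.
by move=> [df _]; apply/differentiable_continuous/derivable1_diffP.
Qed.

End pointwise_derivatives.

(** * Gaussians and their one-dimensional Fourier transforms *)

Section gaussian.
Variable R : realType.
Local Notation leb := (@lebesgue_measure R).
Implicit Types tau x y xi theta : R.

Definition gaussian tau y x : R := expR (- (tau * (x - y) ^+ 2)).

Lemma gaussian_ge0 tau y x : 0 <= gaussian tau y x.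
Proof. exact: expR_ge0. Qed.

Lemma is_derive_gaussian tau y x :
  is_derive x 1 (gaussian tau y) (- (2 * tau * (x - y)) * gaussian tau y x).
Proof.
have d1 : is_derive x 1 (fun t => 1 * t + - y) 1 by exact: is_derive_affine.
have d2 := is_derive_mulc (- tau) (is_derive_mul d1 d1).
have := is_derive_after (is_derive_expR _) d2.
rewrite (_ : (fun t => expR _) = gaussian tau y); last first.
  by apply/funext => t; rewrite /gaussian mul1r -expr2 mulNr.
move=> d3; apply: is_derive_eq d3 _.
by rewrite !mul1r -expr2 mulNr -/(gaussian _ _ _); ring.
Qed.

(** Put z = x - y. From exp w >= 1 + w^2 / 2 at w = tau z^2 the Gaussian is of order (1 + z^2)^(-2).
    One factor absorbs 1 + |z|; Peetre's inequality [s2] recentres the other from [y] to the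
    origin. *)
Lemma gaussian_decay tau y : 0 < tau ->
  {C : R | forall x, (1 + `|x - y|) * gaussian tau y x <= C * japanese x}.
Proof.
move=> tau0; exists (4 * (1 + y ^+ 2) * (2 + 4 / tau ^+ 2)) => x.
rewrite /japanese ler_pdivlMr ?ltr_pwDl ?sqr_ge0//.
rewrite /gaussian expRN -mulrAC ler_pdivrMr ?expR_gt0//.
set z := x - y; have -> : x = z + y by rewrite subrK.
have e1 : 1 + (tau * z ^+ 2) ^+ 2 / 2 <= expR (tau * z ^+ 2).
  by apply: (expR_ge1Dxn 1); rewrite mulr_ge0 ?sqr_ge0// ltW.
have s2 : 1 + (z + y) ^+ 2 <= 2 * (1 + y ^+ 2) * (1 + z ^+ 2).
  have := sqr_ge0 (z - y); have := mulr_ge0 (sqr_ge0 z) (sqr_ge0 y); nra.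
have s3 : 1 + `|z| <= 2 * (1 + z ^+ 2).
  have := sqr_ge0 (`|z| - 1); rewrite -(real_normK (num_real z)).
  by have := sqr_ge0 `|z|; nra.
have s4 : (1 + z ^+ 2) ^+ 2 <= (2 + 4 / tau ^+ 2) * (1 + (tau * z ^+ 2) ^+ 2 / 2).
  have -> : (2 + 4 / tau ^+ 2) * (1 + (tau * z ^+ 2) ^+ 2 / 2) =
      2 + 4 / tau ^+ 2 + (tau * z ^+ 2) ^+ 2 + 2 * (z ^+ 2) ^+ 2.
    by field; rewrite gt_eqF.
  have := sqr_ge0 (tau * z ^+ 2); have := sqr_ge0 (z ^+ 2 - 1).
  have : 0 <= 4 / tau ^+ 2 by rewrite divr_ge0// sqr_ge0.
  nra.
have y0 : 0 <= 1 + y ^+ 2 by rewrite addr_ge0 ?sqr_ge0.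
have z0 : 0 <= 1 + z ^+ 2 by rewrite addr_ge0 ?sqr_ge0.
have t0 : 0 <= 2 + 4 / tau ^+ 2 by rewrite addr_ge0// divr_ge0// sqr_ge0.
apply: (@le_trans _ _ (2 * (1 + z ^+ 2) * (2 * (1 + y ^+ 2) * (1 + z ^+ 2)))).
  by apply: ler_pM => //; rewrite addr_ge0// sqr_ge0.
have -> : 2 * (1 + z ^+ 2) * (2 * (1 + y ^+ 2) * (1 + z ^+ 2)) =
  4 * (1 + y ^+ 2) * (1 + z ^+ 2) ^+ 2 by ring.
apply: le_trans (ler_wpM2l _ s4) _; first by rewrite mulr_ge0.
by rewrite mulrA ler_wpM2l// mulr_ge0// mulr_ge0.
Qed.

Lemma integral_gaussian tau y : 0 < tau ->
  leb.-integrable setT (EFin \o gaussian tau y) /\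
  \int[leb]_x gaussian tau y x = Num.sqrt (pi / tau).
Proof.
(* The standard deviation for which 1 / (2 s^2) = tau, so that the Gaussian is a multiple of a
   normal density. *)
move=> tau0; pose s : R := Num.sqrt (2 * tau)^-1.
have s2 : s ^+ 2 = (2 * tau)^-1 by rewrite sqr_sqrtr// invr_ge0 mulr_ge0// ltW.
have s0 : s != 0 by rewrite gt_eqF// sqrtr_gt0 invr_gt0 mulr_gt0.
have spi : s ^+ 2 * pi *+ 2 = pi / tau.
  by rewrite s2 -mulr_natr; field; rewrite gt_eqF.
have pdfE x : normal_pdf y s x = (Num.sqrt (pi / tau))^-1 * gaussian tau y x.
  rewrite normal_pdfE// /normal_peak /normal_fun spi; congr (_ * expR _).
  by rewrite s2 -mulr_natr; field; rewrite gt_eqF.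
have sp0 : 0 < Num.sqrt (pi / tau) by rewrite sqrtr_gt0 divr_gt0// pi_gt0.
have gE x : gaussian tau y x = Num.sqrt (pi / tau) * normal_pdf y s x.
  by rewrite pdfE mulrA divff ?mul1r// gt_eqF.
have ipdf := integrable_normal_pdf y s.
have -> : gaussian tau y = (fun x => Num.sqrt (pi / tau) * normal_pdf y s x).
  exact/funext.
split; first by apply: eq_integrable (integrableZl measurableT (Num.sqrt (pi / tau)) ipdf).
rewrite RintegralZl// /Rintegral integral_normal_pdf /= mulr1//.
Qed.

(** Let F(z) be the integral at frequency z. Differentiation under the integral sign followed by
    integration by parts against the Gaussian gives F' = - z / (2 tau) F, so F(z) exp(z^2 / (4 tau))
    is constant and is read off at z = 0. The phase [theta] lets one computation serve for the
    cosine and, shifted by pi / 2, for the sine. *)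
Lemma integral_gaussian_cos tau y theta xi : 0 < tau ->
  leb.-integrable setT
    (EFin \o (fun x => gaussian tau y x * cos (xi * (x - y) + theta))) /\
  \int[leb]_x (gaussian tau y x * cos (xi * (x - y) + theta)) =
  cos theta * (Num.sqrt (pi / tau) * expR (- (xi ^+ 2 / (4 * tau)))).
Proof.
move=> tau0; have [ig gE] := integral_gaussian y tau0.
have [C gC] := gaussian_decay y tau0.
pose g := gaussian tau y; have g0 x : 0 <= g x := gaussian_ge0 tau y x.
have mg : measurable_fun setT g by apply/measurable_EFinP; exact: measurable_int ig.
pose p (z x : R) := z * (x - y) + theta.
have mp z : measurable_fun setT (p z).
  by apply: measurable_funD => //; apply: measurable_funM => //; exact: measurable_funB.
have mcos z : measurable_fun setT (fun x => cos (p z x)).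
  by apply: measurableT_comp => //; apply: continuous_measurable_fun; exact: continuous_cos.
have msin z : measurable_fun setT (fun x => sin (p z x)).
  by apply: measurableT_comp => //; apply: continuous_measurable_fun; exact: continuous_sin.
have msub : measurable_fun setT (fun x : R => x - y) by exact: measurable_funB.
pose K z x := g x * cos (p z x).
pose S z x := - ((x - y) * g x * sin (p z x)).
have dp (z x : R) : is_derive z 1 (p ^~ x) (x - y).
  have := is_derive_affine (x - y) theta z.
  by rewrite (_ : (fun t => _) = p ^~ x)//; apply/funext => t; rewrite /p mulrC.
have dpx (z x : R) : is_derive x 1 (p z) z.
  have := is_derive_affine z (theta - z * y) x.
  rewrite (_ : (fun t => _) = p z)//; apply/funext => t; rewrite /p; ring.
have dK (z x : R) : is_derive z 1 (K ^~ x) (S z x).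
  apply: is_derive_eq (is_derive_mulc (g x) (is_derive_after (is_derive_cos _) (dp z x))) _.
  by rewrite /S; ring.
have iK z : leb.-integrable setT (EFin \o K z).
  apply: le_integrable ig => //.
    by apply/measurable_EFinP; exact: (measurable_funM mg (mcos z)).
  move=> x _ /=; rewrite lee_fin normrM ler_piMr// ler_norml.
  by rewrite cos_geN1 cos_le1.
split; first exact: iK.
pose G x := `|x - y| * g x.
have iG : leb.-integrable setT (EFin \o G).
  apply: (le_integrable _ _ _ (integrableZl measurableT C (integrable_japanese R))) => //.
    apply/measurable_EFinP; apply: measurable_funM => //.
    by apply: measurableT_comp => //; exact: measurable_funB.
  move=> x _ /=; rewrite lee_fin /G normrM normr_id (ger0_norm (g0 x)).
  rewrite (le_trans _ (ler_norm _))// (le_trans _ (gC x))//.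
  by rewrite ler_wpM2r// lerDr.
pose F z := \int[leb]_x K z x.
have K1 (z x : R) : (partial1of2 K) z x = S z x.
  by rewrite partial1of2E; have := dK z x => dKzx; rewrite derive_val.
have dF (z : R) : is_derive z 1 F (\int[leb]_x S z x).
  (* Any neighbourhood of [z] will do, since the dominating function [G] is independent of the
     frequency. *)
  have zI : `]z - 1, z + 1[%classic z.
    by rewrite /= in_itv/=; apply/andP; split; lra.
  have bnd (t x : R) : `]z - 1, z + 1[%classic t -> setT x -> `|partial1of2 K t x| <= G x.
    move=> _ _; rewrite K1 /S normrN !normrM (ger0_norm (g0 x)) ler_piMr//.
      by rewrite mulr_ge0.
    by rewrite ler_norml sin_geN1 sin_le1.
  have dKx (t x : R) : `]z - 1, z + 1[%classic t -> setT x -> derivable (K ^~ x) t 1.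
    by move=> _ _; have [] := dK t x.
  have G0 x : 0 <= G x by rewrite mulr_ge0.
  have D1 := @derivable_under_integral R _ _ leb K setT measurableT z _ _ zI
    (fun t _ => iK t) dKx G G0 iG bnd.
  have D2 := @differentiation_under_integral R _ _ leb K setT measurableT z _ _ zI
    (fun t _ => iK t) dKx G G0 iG bnd.
  apply: DeriveDef => //; rewrite -derive1E D2.
  by apply: eq_Rintegral => x _; rewrite -K1.
have iS z : leb.-integrable setT (EFin \o S z).
  apply: le_integrable iG => //.
    apply/measurable_EFinP.
    exact: (measurable_funN (measurable_funM (measurable_funM msub mg) (msin z))).
  move=> x _; rewrite lee_fin /S /G normrN !normrM normr_id ler_piMr// ?mulr_ge0//.
  by rewrite ler_norml sin_geN1 sin_le1.
have ode z : \int[leb]_x S z x = - (z / (2 * tau)) * F z.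
  (* [d] is the derivative of [h]; the vanishing of its integral is the differential equation. *)
  pose h x := g x * sin (p z x).
  pose d x := (2 * tau) * S z x + z * K z x.
  have dh (x : R) : is_derive x 1 h (d x).
    apply: is_derive_eq (is_derive_mul (is_derive_gaussian tau y x)
      (is_derive_after (is_derive_sin _) (dpx z x))) _.
    by rewrite /d /S /K -/g; ring.
  have cp : continuous (p z) by move=> x; exact: is_derive_continuous (dpx z x).
  have cg : continuous g by move=> x; exact: is_derive_continuous (is_derive_gaussian tau y x).
  have cd : continuous d.
    move=> x; apply: cvgD.
      apply: cvgMr; apply: cvgN; apply: cvgM.
        apply: cvgM; last exact: cg.
        by apply: cvgB; [exact: cvg_id|exact: cvg_cst].
      by apply: (cvg_comp (p z) sin); [exact: cp|exact: continuous_sin].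
    apply: cvgMr; apply: cvgM; first exact: cg.
    by apply: (cvg_comp (p z) cos); [exact: cp|exact: continuous_cos].
  have gCx x : g x <= C * japanese x.
    by rewrite (le_trans _ (gC x))// ler_peMl// lerDl.
  have GCx x : G x <= C * japanese x.
    by rewrite (le_trans _ (gC x))// ler_wpM2r// lerDr.
  have Cj x : 0 <= C * japanese x by rewrite (le_trans _ (gCx x)).
  (* One constant for both bounds: the summand 1 serves for [h], and [2 * tau] and [|z|] for the two
     terms of [d]. *)
  pose C' := (1 + (2 * tau + `|z|)) * C.
  have C'E x : C' * japanese x = (1 + (2 * tau + `|z|)) * (C * japanese x).
    by rewrite mulrA.
  have tau20 : 0 <= 2 * tau by rewrite mulr_ge0// ltW.
  have t0 : 0 <= 2 * tau + `|z| by rewrite addr_ge0.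
  have [||_] := @integral_derive_eq0 R h d C' dh cd.
  - move=> x; rewrite C'E (le_trans (y := C * japanese x))//; last first.
      by rewrite ler_peMl// lerDl.
    rewrite (le_trans _ (gCx x))// /h normrM (ger0_norm (g0 x)) ler_piMr//.
    by rewrite ler_norml sin_geN1 sin_le1.
  - move=> x; rewrite C'E mulrDl (le_trans (y := (2 * tau + `|z|) * (C * japanese x)))//.
      rewrite mulrDl (le_trans (ler_normD _ _))// lerD//.
        rewrite normrM (ger0_norm tau20); apply: ler_wpM2l => //.
        rewrite (le_trans _ (GCx x))// /S normrN !normrM (ger0_norm (g0 x)) ler_piMr//.
          by rewrite mulr_ge0.
        by rewrite ler_norml sin_geN1 sin_le1.
      rewrite normrM ler_wpM2l// (le_trans _ (gCx x))// /K normrM (ger0_norm (g0 x)).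
      by rewrite ler_piMr// ler_norml cos_geN1 cos_le1.
    by rewrite mul1r lerDr.
  have iZ r f : leb.-integrable setT (EFin \o f) ->
      leb.-integrable setT (EFin \o (fun x => r * f x)).
    by move=> iff; apply: eq_integrable (integrableZl measurableT r iff).
  rewrite /d RintegralD//; [|exact: iZ..].
  rewrite !RintegralZl// -/(F z) => E.
  have -> : \int[leb]_x S z x = (2 * tau * \int[leb]_x S z x) / (2 * tau).
    by rewrite mulrAC divff ?mul1r// gt_eqF// mulr_gt0.
  rewrite -[X in X / _](addrK (z * F z)) E; field; by rewrite gt_eqF.
pose H z := F z * expR (z ^+ 2 / (4 * tau)).
have dH (z : R) : is_derive z 1 H 0.
  have dz := is_derive_mulc (4 * tau)^-1 (is_derive_mul (is_derive_var z) (is_derive_var z)).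
  have de := is_derive_after (is_derive_expR _) dz.
  have dH := is_derive_mul (dF z) de.
  rewrite (_ : H = fun t => F t * expR ((4 * tau)^-1 * (t * t))).
    apply: is_derive_eq dH _; rewrite ode; field; by rewrite gt_eqF.
  by apply/funext => t; rewrite /H mulrC [X in expR X]mulrC expr2 mulrC.
have H0 : H 0 = cos theta * Num.sqrt (pi / tau).
  rewrite /H expr0n/= mul0r expR0 mulr1 /F -gE -RintegralZl//.
  by apply: eq_Rintegral => x _; rewrite /K /p mul0r add0r mulrC.
rewrite mulrA -H0 -(is_derive_0_is_cst xi 0 dH) /H -mulrA -expRD subrr expR0.
by rewrite mulr1.
Qed.

Lemma cintegral_gaussian tau y xi : 0 < tau ->
  cintegrable leb setT (fun x => (gaussian tau y x)%:C * expi (xi * x)) /\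
  cintegral leb setT (fun x => (gaussian tau y x)%:C * expi (xi * x)) =
  (Num.sqrt (pi / tau) * expR (- (xi ^+ 2 / (4 * tau))))%:C * expi (xi * y).
Proof.
move=> tau0.
have [ic cE] := integral_gaussian_cos y (xi * y) xi tau0.
have [is_ sE] := integral_gaussian_cos y (xi * y + pi / 2) xi tau0.
have E x : xi * (x - y) + xi * y = xi * x by rewrite mulrBr subrK.
have ReE x : complex.Re ((gaussian tau y x)%:C * expi (xi * x)) =
    gaussian tau y x * cos (xi * (x - y) + xi * y).
  by rewrite Re_realM E.
have ImE x : complex.Im ((gaussian tau y x)%:C * expi (xi * x)) =
    (-1) * (gaussian tau y x * cos (xi * (x - y) + (xi * y + pi / 2))).
  by rewrite Im_realM addrA E cosDpihalf mulN1r mulrN opprK.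
split.
  split; first by under eq_fun do rewrite ReE.
  under eq_fun do rewrite ImE.
  by apply: eq_integrable (integrableZl measurableT (-1) is_).
rewrite /cintegral; under eq_Rintegral do rewrite ReE.
rewrite cE; under [X in _ +i* X]eq_Rintegral do rewrite ImE.
rewrite RintegralZl// sE cosDpihalf; apply/eqP; rewrite eq_complex Re_realM Im_realM /=.
by apply/andP; split; apply/eqP; ring.
Qed.

End gaussian.

(** * Gamma integrals *)

Section positive_half_line.
Variable R : realType.
Local Notation leb := (@lebesgue_measure R).
Implicit Types (a b c s t p : R) (G : R -> R).

(** The inversion t -> c / t carries these intervals onto the ones with c = 1, so substitutions can
    be made on compact intervals. The shift by 2 makes each of them nondegenerate. *)
Lemma bigcup_itv_pos c : 0 < c ->
  \bigcup_k `[c / k.+2%:R, c * k.+2%:R]%classic = `]0, +oo[%classic :> set R.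
Proof.
move=> c0; apply/seteqP; split => [x [k _]|x].
  rewrite /= !in_itv/= andbT => /andP[+ _]; apply: lt_le_trans.
  by rewrite divr_gt0.
rewrite /= in_itv/= andbT => x0.
exists (Num.truncn (x / c) + Num.truncn (c / x))%N => //=.
rewrite in_itv/= ler_pdivrMr// -ler_pdivrMl// mulrC -[X in _ && X]ler_pdivrMl//.
rewrite [c^-1 * x]mulrC; apply/andP; split.
- by rewrite ltW// (lt_le_trans (truncnS_gt _))// ler_nat ltnS leqW// leq_addl.
- by rewrite ltW// (lt_le_trans (truncnS_gt _))// ler_nat ltnS leqW// leq_addr.
Qed.

Lemma nondecreasing_itv_pos c : 0 < c ->
  {homo (fun k : nat => `[c / k.+2%:R, c * k.+2%:R]%classic : set R) :
    n m / (n <= m)%N >-> (n <= m)%O}.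
Proof.
move=> c0 k m km; apply/subsetPset => x /=; rewrite !in_itv/= => /andP[h1 h2].
apply/andP; split.
  by rewrite (le_trans _ h1)// ler_pM2l// lef_pV2 ?posrE// ler_nat.
by rewrite (le_trans h2)// ler_pM2l// ler_nat.
Qed.

Lemma measurable_fun_pos G : (forall t, 0 < t -> {for t, continuous G}) ->
  measurable_fun (`]0, +oo[%classic : set R) G.
Proof.
move=> cG; apply: open_continuous_measurable_fun; first exact: interval_open.
by move=> t; rewrite inE/= in_itv/= andbT; exact: cG.
Qed.

Lemma ge0_integral_pos_cvg c G : 0 < c ->
  (forall t, 0 < t -> {for t, continuous G}) ->
  (forall t, 0 < t -> 0 <= G t) ->
  (\int[leb]_(t in `[(c / k.+2%:R)%R, (c * k.+2%:R)%R]) (G t)%:E)%E @[k --> \oo] -->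
  (\int[leb]_(t in `]0%R, +oo[) (G t)%:E)%E.
Proof.
move=> c0 cG G0; rewrite -(bigcup_itv_pos c0).
have pos k x : `[c / k.+2%:R, c * k.+2%:R]%classic x -> 0 < x.
  by rewrite /= in_itv/= => /andP[+ _]; apply: lt_le_trans; rewrite divr_gt0.
apply: ge0_nondecreasing_set_cvg_integral.
- exact: nondecreasing_itv_pos.
- by move=> k; exact: measurable_itv.
- move=> k; apply/measurable_EFinP; apply: measurable_funS (measurable_fun_pos cG).
    exact: measurable_itv.
  by move=> x /pos; rewrite /= in_itv/= andbT.
- by move=> k x /pos x0; rewrite lee_fin G0.
Qed.

Lemma is_derive_divl c t : t != 0 ->
  is_derive t 1 (fun u => c / u) (- (c / t ^+ 2)).
Proof.
move=> t0; apply: is_derive_eq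
  (is_derive_mulc c (is_deriveV t0 (is_derive_var t))) _.
by rewrite /GRing.scale /= mulr1 mulrN.
Qed.

Lemma cvg_derive_divl (c x : R) : 0 < x ->
  derive1 (fun u : R => c / u) t @[t --> x] --> - (c / x ^+ 2).
Proof.
move=> x0; have dE t : 0 < t -> - (c / t ^+ 2) = derive1 (fun u : R => c / u) t.
  move=> t0; rewrite derive1E; have dt := @is_derive_divl c t (lt0r_neq0 t0).
  by rewrite derive_val.
have cx : {for x, continuous (fun t : R => - (c / t ^+ 2))}.
  apply: cvgN; apply: cvgMr; apply: cvgV; last exact: exprn_continuous.
  by rewrite gt_eqF// exprn_gt0.
apply: cvg_trans cx; apply: near_eq_cvg; near=> t; apply: dE; near: t.
exact: lt_nbhsr.
Unshelve. end_near. Qed.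

(** On each compact interval this is the substitution u = c / t, where the reversal of orientation
    cancels the sign of the derivative. Both sides are then limits of monotone exhaustions, hence
    equal even if infinite. *)
Lemma ge0_integral_inversion c G : 0 < c ->
  (forall t, 0 < t -> {for t, continuous G}) ->
  (forall t, 0 < t -> 0 <= G t) ->
  (\int[leb]_(t in `]0%R, +oo[) (G t)%:E =
   \int[leb]_(t in `]0%R, +oo[) (G (c / t) * (c / t ^+ 2))%:E)%E.
Proof.
move=> c0 cG G0.
have cF t : 0 < t -> {for t, continuous (fun u : R => c / u)}.
  by move=> t0; apply: is_derive_continuous (is_derive_divl c (lt0r_neq0 t0)).
have c1 := ge0_integral_pos_cvg ltr01 cG G0.
have cH t : 0 < t -> {for t, continuous (fun t => G (c / t) * (c / t ^+ 2))}.
  move=> t0; apply: cvgM.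
    apply: (cvg_comp (fun u : R => c / u) G); first exact: cF.
    by apply: cG; rewrite divr_gt0.
  apply: cvgMr; apply: cvgV; last exact: exprn_continuous.
  by rewrite gt_eqF// exprn_gt0.
have H0 t : 0 < t -> 0 <= G (c / t) * (c / t ^+ 2).
  by move=> t0; rewrite mulr_ge0 ?G0 ?divr_gt0// divr_ge0 ?sqr_ge0// ltW.
have c2 := ge0_integral_pos_cvg c0 cH H0.
rewrite -(cvg_lim _ c1)// -(cvg_lim _ c2)//.
apply: (congr1 (fun u : (\bar R)^nat => limn u)); apply/funext => k.
pose a := c / k.+2%:R; pose b := c * k.+2%:R.
have k2 : 1 < k.+2%:R :> R by rewrite ltr1n.
have k0 : 0 < k.+2%:R :> R by rewrite ltr0n.
have a0 : 0 < a by rewrite divr_gt0.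
have ab : a < b.
  by rewrite ltr_pM2l// (lt_trans _ k2)// invf_lt1.
have Fa : c / a = 1 * k.+2%:R.
  by rewrite /a; field; rewrite !gt_eqF.
have Fb : c / b = 1 / k.+2%:R.
  by rewrite /b; field; rewrite !gt_eqF.
rewrite -Fa -Fb -/a -/b.
have pos x : x \in `[a, b] -> 0 < x.
  by rewrite in_itv/= => /andP[+ _]; exact: lt_le_trans.
rewrite (@integration_by_substitution_decreasing _ (fun u => c / u) G a b (ltW ab)).
- apply: eq_integral => t; rewrite inE/= => /pos t0; congr EFin.
  rewrite /= !fctE; congr (_ * _).
  rewrite derive1E; have dt := @is_derive_divl c t (lt0r_neq0 t0).
  by rewrite derive_val opprK.
- move=> x y /pos x0 /pos y0 yx; rewrite ltr_pM2l// ltf_pV2 ?posrE//.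
- move=> x xab; have x0 : 0 < x by apply: pos; exact: subset_itv_oo_cc xab.
  have dx := @is_derive_divl c x (lt0r_neq0 x0).
  have E : derive1 (fun u : R => c / u) x = - (c / x ^+ 2).
    by rewrite derive1E derive_val.
  by have := @cvg_derive_divl c x x0; rewrite -E.
- by apply: cvgP; apply: cvg_at_right_filter; exact: cvg_derive_divl.
- by apply: cvgP; apply: cvg_at_left_filter; apply: cvg_derive_divl; exact: lt_trans ab.
- split.
  + move=> x xab; have x0 : 0 < x by apply: pos; exact: subset_itv_oo_cc xab.
    by have [] := @is_derive_divl c x (lt0r_neq0 x0).
  + by apply: cvg_at_right_filter; exact: cF.
  + by apply: cvg_at_left_filter; apply: cF; exact: lt_trans ab.
- apply: continuous_in_subspaceT => x; rewrite inE/= in_itv/= Fb => /andP[h _].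
  by apply: cG; rewrite (lt_le_trans _ h)// divr_gt0.
Qed.

End positive_half_line.

(** * Mellin integrals of exponentials *)

Section gamma_integrals.
Variable R : realType.
Local Notation leb := (@lebesgue_measure R).
Implicit Types (a b s t p A : R) (k : R -> R).

(** The Mellin density on the half-line, extended by zero so that Fubini's theorem is applied on
    full product spaces. Negative [s] occurs too, against exp(- A / t). *)
Definition hpow s t : R := if 0 < t then t `^ (s - 1) else 0.

Lemma hpow_ge0 s t : 0 <= hpow s t.
Proof. by rewrite /hpow; case: ifP => // _; exact: powR_ge0. Qed.

Lemma hpow_patch s k : (fun t => (hpow s t * k t)%:E) =
  (fun t => (t `^ (s - 1) * k t)%:E) \_ `]0, +oo[%classic.
Proof.
apply/funext => t; rewrite patchE /hpow; case: ifPn => [t0|/negP t0].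
  by rewrite mem_set//= in_itv/= t0.
by rewrite memNset ?mul0r//= in_itv/= andbT.
Qed.

Lemma measurable_hpow s : measurable_fun setT (hpow s).
Proof.
have -> : hpow s = (fun t => t `^ (s - 1) * \1_(`]0, +oo[%classic) t).
  apply/funext => t; rewrite /hpow indicE; case: ifPn => [t0|/negP t0].
    by rewrite mem_set ?mulr1//= in_itv/= t0.
  by rewrite memNset ?mulr0//= in_itv/= andbT.
apply: measurable_funM; first exact: measurable_powR.
by apply: measurable_indic; exact: measurable_itv.
Qed.

Lemma integral_hpow s k (B : R) : measurable_fun (`]0, +oo[%classic : set R) k ->
  (forall t, 0 < t -> 0 <= k t) ->
  (\int[leb]_(t in `]0%R, +oo[) (t `^ (s - 1) * k t)%:E = B%:E)%E ->
  leb.-integrable setT (EFin \o (fun t => hpow s t * k t)) /\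
  \int[leb]_t (hpow s t * k t) = B.
Proof.
move=> mk k0 E.
have EB : (\int[leb]_t (hpow s t * k t)%:E = B%:E)%E.
  by rewrite hpow_patch -integral_mkcond.
split; last by rewrite /Rintegral EB.
have mI : measurable (`]0, +oo[%classic : set R) by exact: measurable_itv.
rewrite /comp hpow_patch; apply: (iffLR (@integrable_mkcond _ (measurableTypeR R) R leb _ _ mI)).
apply/integrableP; split.
  apply/measurable_EFinP; apply: measurable_funM => //.
  by apply: measurable_funTS; exact: measurable_powR.
apply: (@le_lt_trans _ _ B%:E); last by rewrite ltry.
rewrite -E le_eqVlt; apply/orP; left; apply/eqP/eq_integral => t.
rewrite inE/= in_itv/= andbT => t0.
by rewrite ger0_norm// mulr_ge0 ?powR_ge0 ?k0.
Qed.

Lemma continuous_powR_pos s t : 0 < t -> {for t, continuous (fun u => u `^ s)}.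
Proof. by move=> t0; exact: is_derive_continuous (is_derive1_powR s t0). Qed.

Lemma integral_powR_itv a b s : 0 < a -> a < b -> s != 0 ->
  (\int[leb]_(t in `[a, b]) (t `^ (s - 1))%:E = ((b `^ s - a `^ s) / s)%:E)%E.
Proof.
move=> a0 ab s0.
have dF (t : R) : t \in `[a, b] ->
    is_derive t 1 (fun t => s^-1 * t `^ s) (t `^ (s - 1)).
  rewrite in_itv/= => /andP[at_ _]; have t0 := lt_le_trans a0 at_.
  apply: is_derive_eq (is_derive_mulc s^-1 (is_derive1_powR s t0)) _.
  by rewrite mulrA mulVf// mul1r.
have cf (t : R) : t \in `[a, b] -> {for t, continuous (fun t => t `^ (s - 1))}.
  rewrite in_itv/= => /andP[at_ _].
  exact: continuous_powR_pos (lt_le_trans a0 at_).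
by rewrite (integral_itv_derive ab dF cf) -mulrBr mulrC.
Qed.

(** The two terms are the integrals of t^(s-1) over (0, 1] and of t^(s-p-1) over [1, oo), where the
    minimum is 1 and t^(-p) respectively. *)
Lemma integral_powR_min s p : 0 < s -> s < p ->
  (\int[leb]_(t in `]0%R, +oo[) (t `^ (s - 1) * Num.min 1 (t `^ (- p)))%:E
   <= (s^-1 + (p - s)^-1)%:E)%E.
Proof.
move=> s0 sp.
pose q t : R := t `^ (s - 1) * Num.min 1 (t `^ (- p)).
have mq : measurable_fun setT q.
  apply: measurable_funM; first exact: measurable_powR.
  by apply: measurable_minr => //; exact: measurable_powR.
have q0 t : 0 <= q t.
  by rewrite mulr_ge0 ?powR_ge0// le_min ler01 powR_ge0.
pose I (k : nat) : set R := `[1 / k.+2%:R, 1 * k.+2%:R]%classic.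
rewrite -(bigcup_itv_pos (@ltr01 R)); apply: ge0_integral_bigcup_le => //.
- exact: nondecreasing_itv_pos.
- by apply/measurable_EFinP; exact: measurable_funS mq.
move=> k; rewrite !mul1r.
set b : R := k.+2%:R.
have b1 : 1 < b by rewrite ltr1n.
have b0 : 0 < b by rewrite ltr0n.
have bi0 : 0 < b^-1 by rewrite invr_gt0.
have bi1 : b^-1 < 1 by rewrite invf_lt1.
have -> : `[b^-1, b]%classic = `[b^-1, 1]%classic `|` `]1, b]%classic :> set R.
  rewrite -(@itv_bndbnd_setU _ _ (BLeft b^-1) (BRight 1) (BRight b))// bnd_simp;
  exact: ltW.
have mS (S : set R) : measurable_fun S (fun t => (q t)%:E).
  by apply/measurable_EFinP; exact: measurable_funS mq.
have mP (S : set R) r : measurable_fun S (fun t : R => (t `^ r)%:E).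
  apply/measurable_EFinP; apply: measurable_funTS.
  exact: measurable_powR.
rewrite ge0_integral_setU//; [|exact: mS|by move=> t _; rewrite lee_fin q0|]; last first.
  rewrite disj_set2E; apply/eqP/seteqP; split => // x [] /=; rewrite !in_itv/=.
  by move=> /andP[_ +] /andP[+ _] => /le_lt_trans h /h; rewrite ltxx.
rewrite EFinD; apply: leeD.
- apply: (@le_trans _ _ (\int[leb]_(t in `[(b^-1)%R, 1%R]) (t `^ (s - 1))%:E)%E).
    apply: ge0_le_integral; [exact: measurable_itv|..].
    + by move=> t _; rewrite lee_fin q0.
    + exact: mS.
    + exact: mP.
    + by move=> t _; rewrite lee_fin /q ler_piMr ?powR_ge0// ge_min lexx.
  rewrite integral_powR_itv// ?gt_eqF// lee_fin powR1.
  by rewrite ler_pdivrMr// mulVf ?gt_eqF// gerBl powR_ge0.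
- apply: (@le_trans _ _ (\int[leb]_(t in `]1%R, b]) (t `^ ((s - p) - 1))%:E)%E).
    apply: ge0_le_integral; [exact: measurable_itv|..].
    + by move=> t _; rewrite lee_fin q0.
    + exact: mS.
    + exact: mP.
    + move=> t; rewrite /= in_itv/= => /andP[t1 _]; rewrite lee_fin /q.
      rewrite addrAC [leRHS]powRD; last by rewrite (gt_eqF (lt_trans ltr01 t1)) implybT.
      by rewrite ler_wpM2l ?powR_ge0// ge_min lexx orbT.
  rewrite integral_itv_obnd_cbnd//.
  rewrite integral_powR_itv// ?subr_eq0 ?lt_eqF// lee_fin powR1.
  rewrite -opprB -[(s - p)]opprB invrN mulrNN ler_pdivrMr ?subr_gt0//.
  by rewrite mulVf ?gt_eqF ?subr_gt0// gerBl powR_ge0.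
Qed.

Lemma integrable_hpow_min s p : 0 < s -> s < p ->
  leb.-integrable setT (EFin \o (fun t => hpow s t * Num.min 1 (t `^ (- p)))).
Proof.
move=> s0 sp; have h := integral_powR_min s0 sp.
have mm : measurable_fun (`]0, +oo[%classic : set R)
    (fun t : R => Num.min 1 (t `^ (- p))).
  apply: measurable_funTS.
  by apply: measurable_minr => //; exact: measurable_powR.
have m0 t : 0 <= Num.min 1 (t `^ (- p)) by rewrite le_min ler01 powR_ge0.
have I0 : (0 <= \int[leb]_(t in `]0%R, +oo[) (t `^ (s - 1) * Num.min 1 (t `^ (- p)))%:E)%E.
  by apply: integral_ge0 => t _; rewrite lee_fin mulr_ge0// powR_ge0.
have := @fineK _ (\int[leb]_(t in `]0%R, +oo[) (t `^ (s - 1) * Num.min 1 (t `^ (- p)))%:E)%E.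
rewrite ge0_fin_numE// (le_lt_trans h) ?ltry// => /(_ isT)/esym E.
by have [] := integral_hpow mm (fun t _ => m0 t) E.
Qed.

(** [Gamma] is the finite part of an extended integral, so finiteness is the content. Since exp t >=
    t^m / m! for an integer m > s, the integrand is at most m! t^(s-1) min(1, t^(-m)). *)
Lemma GammaE s : 0 < s ->
  (\int[leb]_(t in `]0%R, +oo[) (t `^ (s - 1) * expR (- t))%:E = (Gamma s)%:E)%E.
Proof.
move=> s0; rewrite /Gamma /Rintegral fineK// ge0_fin_numE; last first.
  by apply: integral_ge0 => t _; rewrite lee_fin mulr_ge0 ?powR_ge0 ?expR_ge0.
pose m := (Num.truncn s).+1.
have sm : s < m%:R by rewrite truncnS_gt.
have mexp : measurable_fun (`]0, +oo[%classic : set R)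
    (fun t : R => (t `^ (s - 1) * expR (- t))%:E).
  apply/measurable_EFinP; apply: measurable_funTS.
  apply: measurable_funM; first exact: measurable_powR.
  by apply: measurableT_comp => //; exact: measurableT_comp.
have mmin : measurable_fun (`]0, +oo[%classic : set R)
    (fun t : R => (t `^ (s - 1) * Num.min 1 (t `^ (- m%:R)))%:E).
  apply/measurable_EFinP; apply: measurable_funTS.
  apply: measurable_funM; first exact: measurable_powR.
  by apply: measurable_minr => //; exact: measurable_powR.
apply: (@le_lt_trans _ _ (\int[leb]_(t in `]0%R, +oo[)
    ((m`!%:R)%:E * (t `^ (s - 1) * Num.min 1 (t `^ (- m%:R)))%:E))%E).
  apply: ge0_le_integral => //.
  - by move=> t _; rewrite lee_fin mulr_ge0 ?powR_ge0 ?expR_ge0.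
  - by apply: emeasurable_funM.
  - move=> t; rewrite /= in_itv/= andbT => t0; rewrite -EFinM lee_fin mulrCA.
    rewrite ler_wpM2l ?powR_ge0// minr_pMr// mulr1 le_min; apply/andP; split.
      apply: (@le_trans _ _ 1); last by rewrite ler1n fact_gt0.
      by rewrite -expR0 ler_expR oppr_le0 ltW.
    rewrite expRN (powR_invn _ (ltW t0)) -[leRHS]invrK lef_pV2 ?posrE ?expR_gt0//; last first.
      by rewrite invr_gt0 mulr_gt0 ?invr_gt0 ?exprn_gt0// ltr0n fact_gt0.
    rewrite invfM invrK mulrC (le_trans _ (expR_ge1Dxn (Num.truncn s) (ltW t0)))//.
    by rewrite lerDr.
rewrite ge0_integralZl//; last first.
  by move=> t _; rewrite lee_fin mulr_ge0 ?powR_ge0// le_min ler01 powR_ge0.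
by rewrite lte_mul_pinfty// (le_lt_trans (integral_powR_min s0 sm))// ltry.
Qed.

Lemma Gamma_gt0 s : 0 < s -> 0 < Gamma s.
Proof.
move=> s0; rewrite -lte_fin -GammaE//.
have mg (S : set R) : measurable_fun S (fun t : R => (t `^ (s - 1) * expR (- t))%:E).
  apply/measurable_EFinP; apply: measurable_funTS.
  apply: measurable_funM; first exact: measurable_powR.
  by apply: measurableT_comp => //; exact: measurableT_comp.
have g0 t : (0 <= (t `^ (s - 1) * expR (- t))%:E)%E.
  by rewrite lee_fin mulr_ge0 ?powR_ge0 ?expR_ge0.
(* On [1, 2] one has t^(s-1) >= 1/t >= 1/2, because s > 0, and exp(- t) >= exp(- 2). *)
apply: (@lt_le_trans _ _ (\int[leb]_(t in `[1%R, 2%R]) (2^-1 * expR (- 2))%:E)%E).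
  rewrite integral_cst//= lebesgue_measure_itv/= lte_fin ltr1n/= -EFinB -EFinM lte_fin.
  by rewrite mulr_gt0// ?mulr_gt0 ?expR_gt0//; lra.
apply: (@le_trans _ _ (\int[leb]_(t in `[1%R, 2%R]) (t `^ (s - 1) * expR (- t))%:E)%E).
  apply: ge0_le_integral; [exact: measurable_itv|..|exact: mg|].
  - by move=> t _; rewrite lee_fin mulr_ge0 ?invr_ge0 ?expR_ge0.
  - exact: measurable_cst.
  - move=> t; rewrite /= in_itv/= => /andP[t1 t2]; rewrite lee_fin ler_pM ?expR_ge0//.
      rewrite (@le_trans _ _ (t `^ (- 1)))//.
        by rewrite powR_inv1 ?(le_trans _ t1)// lef_pV2 ?posrE// (lt_le_trans _ t1).
      by rewrite ler_powR// lerBrDl subrr ltW.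
    by rewrite ler_expR lerN2.
apply: ge0_subset_integral;
  [exact: measurable_itv|exact: measurable_itv|exact: mg|by move=> t _; exact: g0|].
move=> t; rewrite /= !in_itv/= andbT => /andP[t1 _].
exact: lt_le_trans t1.
Qed.

Lemma continuous_expR_divl A t : 0 < t ->
  {for t, continuous (fun u : R => expR (- (A / u)))}.
Proof.
move=> t0.
apply: (cvg_comp (fun u : R => - (A / u)) expR); last exact: continuous_expR.
by apply: cvgN; apply: is_derive_continuous (is_derive_divl A (lt0r_neq0 t0)).
Qed.

(** The inversion t -> A / t in the Gamma integral: (A / t)^(b-1) A / t^2 = A^b t^(-b-1). *)
Lemma integral_powR_expRV b A : 0 < b -> 0 < A ->
  (\int[leb]_(t in `]0%R, +oo[) (t `^ (- b - 1) * expR (- (A / t)))%:E =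
   (Gamma b * A `^ (- b))%:E)%E.
Proof.
move=> b0 A0.
have c1 t : 0 < t -> {for t, continuous (fun u : R => u `^ (b - 1) * expR (- u))}.
  move=> t0; apply: cvgM; first exact: continuous_powR_pos.
  apply: (cvg_comp (fun u : R => - u) expR); last exact: continuous_expR.
  by apply: cvgN; exact: cvg_id.
have := ge0_integral_inversion A0 c1.
rewrite GammaE// => /(_ _)/esym.
have mg : measurable_fun (`]0, +oo[%classic : set R)
    (fun t : R => (t `^ (- b - 1) * expR (- (A / t)))%:E).
  apply/measurable_EFinP; apply: measurable_fun_pos => t t0; apply: cvgM.
    exact: continuous_powR_pos.
  exact: continuous_expR_divl.
under eq_integral => t.
  rewrite inE/= in_itv/= andbT => t0.
  rewrite (_ : _ * _ = A `^ b * (t `^ (- b - 1) * expR (- (A / t)))).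
    rewrite EFinM; over.
  rewrite powRM ?invr_ge0 ?ltW// -[t^-1]powR_inv1 ?ltW// -powRrM.
  have -> : A / t ^+ 2 = A `^ 1 * t `^ (- 2).
    by rewrite powRr1 ?ltW// powR_invn// ltW.
  rewrite mulrAC mulrACA -!powRD ?(gt_eqF A0) ?(gt_eqF t0) ?implybT//.
  rewrite subrK -mulrA (_ : -1 * (b - 1) + -2 = - b - 1)//; ring.
rewrite ge0_integralZl//; last 2 first.
- by move=> t _; rewrite lee_fin mulr_ge0 ?powR_ge0 ?expR_ge0.
- by rewrite lee_fin powR_ge0.
move=> /(_ _)E; rewrite powRN.
have Ab : A `^ b != 0 by rewrite gt_eqF// powR_gt0.
rewrite EFinM -E; last by move=> t t0; rewrite mulr_ge0 ?powR_ge0 ?expR_ge0.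
by rewrite muleC muleA -EFinM mulVf// mul1e.
Qed.

(** The dilation by [A] is a composite of two inversions; the second, t -> 1 / t, is applied to
    [integral_powR_expRV]. *)
Lemma integral_powR_expR b A : 0 < b -> 0 < A ->
  (\int[leb]_(t in `]0%R, +oo[) (t `^ (b - 1) * expR (- (t * A)))%:E =
   (Gamma b * A `^ (- b))%:E)%E.
Proof.
move=> b0 A0.
have c1 t : 0 < t -> {for t, continuous (fun u : R => u `^ (- b - 1) * expR (- (A / u)))}.
  by move=> t0; apply: cvgM; [exact: continuous_powR_pos|exact: continuous_expR_divl].
rewrite -integral_powR_expRV// (ge0_integral_inversion ltr01 c1); last first.
  by move=> t t0; rewrite mulr_ge0 ?powR_ge0 ?expR_ge0.
apply: eq_integral => t; rewrite inE/= in_itv/= andbT => t0; congr EFin.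
rewrite div1r invrK [A * t]mulrC mulrAC; congr (_ * _).
rewrite -[t^-1]powR_inv1 ?ltW// -powRrM div1r -powR_invn ?ltW//.
rewrite -powRD ?(gt_eqF t0) ?implybT//; congr (_ `^ _); ring.
Qed.

Lemma integral_hpow_expR s A : 0 < s -> 0 < A ->
  leb.-integrable setT (EFin \o (fun t => hpow s t * expR (- (t * A)))) /\
  \int[leb]_t (hpow s t * expR (- (t * A))) = Gamma s * A `^ (- s).
Proof.
move=> s0 A0; apply: integral_hpow => //; last exact: integral_powR_expR.
apply: measurable_funTS.
by apply: measurableT_comp => //; apply: measurableT_comp => //; exact: measurable_funM.
Qed.

(** The form that arises once the Gaussians have been Fourier transformed and their rates have
    become proportional to 1 / t. *)
Lemma integral_hpow_expRV s A : 0 < s -> 0 < A ->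
  leb.-integrable setT (EFin \o (fun t => hpow (- s) t * expR (- (A / t)))) /\
  \int[leb]_t (hpow (- s) t * expR (- (A / t))) = Gamma s * A `^ (- s).
Proof.
move=> s0 A0; apply: integral_hpow => //; last exact: integral_powR_expRV.
by apply: measurable_fun_pos => t t0; exact: continuous_expR_divl.
Qed.

End gamma_integrals.

(** * The Riesz kernel *)

Section riesz_kernel.
Variables (R : realType) (n : nat).
Local Notation leb := (@lebesgue_measure R).
Local Notation lebn := (lebesgue_rV R n).
Implicit Types (x y : 'rV[R]_n) (d : 'I_n -> R) (s t : R).

(** A product over the coordinates instead of a power of the Euclidean bracket: integrals against
    Gaussians then factor, and slices of a dominated function are dominated by the weight in one
    dimension less. *)
Definition japanese_rV x : R := \prod_i japanese (x ord0 i).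

Lemma japanese_rV_gt0 x : 0 < japanese_rV x.
Proof. by apply: prodr_gt0 => i _; exact: japanese_gt0. Qed.

Lemma japanese_rV_ge0 x : 0 <= japanese_rV x.
Proof. exact: ltW (japanese_rV_gt0 x). Qed.

Lemma integrable_japanese_rV : lebn.-integrable setT (EFin \o japanese_rV).
Proof.
by have [] := @integral_tensor R n (fun=> @japanese R) (fun=> integrable_japanese R).
Qed.

Lemma measurable_japanese_rV : measurable_fun setT japanese_rV.
Proof. by apply/measurable_EFinP; exact: measurable_int integrable_japanese_rV. Qed.

(* The squared distance weighted by [d]: [d = 1] gives [|x - y|^2], and
   [d = csc], [y = 0] gives the square of [|tilde x|]. *)
Definition sqdist d x y : R := \sum_i (d i * (x ord0 i - y ord0 i)) ^+ 2.

Lemma sqdist_ge0 d x y : 0 <= sqdist d x y.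
Proof. by apply: sumr_ge0 => i _; exact: sqr_ge0. Qed.

Lemma sqdist_gt0 d x y : (forall i, d i != 0) -> x != y -> 0 < sqdist d x y.
Proof.
move=> d0 xy; rewrite lt_neqAle sqdist_ge0 andbT eq_sym.
apply: contra xy; rewrite psumr_eq0; last by move=> i _; exact: sqr_ge0.
move=> /allP h; apply/eqP/rowP => i; have := h i (mem_index_enum _).
by rewrite sqrf_eq0 mulf_eq0 (negbTE (d0 i))/= subr_eq0 => /eqP.
Qed.

Lemma measurable_sqdist dT (T : measurableType dT) d (p q : T -> 'rV[R]_n) :
  measurable_fun setT p -> measurable_fun setT q ->
  measurable_fun setT (fun z => sqdist d (p z) (q z)).
Proof.
move=> mp mq; apply: (@measurable_sum _ _ _ _ _ _
  (fun i z => (d i * (p z ord0 i - q z ord0 i)) ^+ 2)) => i.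
apply: measurable_funX; apply: measurable_funM => //; apply: measurable_funB.
- exact: (measurableT_comp (@measurable_rV_entry R n i) mp).
- exact: (measurableT_comp (@measurable_rV_entry R n i) mq).
Qed.

(** For [d = 1] this is the heat kernel at time 1 / (4 t), up to its normalising factor. *)
Definition heat d t x y : R := expR (- (t * sqdist d x y)).

Lemma heat_ge0 d t x y : 0 <= heat d t x y.
Proof. exact: expR_ge0. Qed.

Lemma heat_tensor d t x y :
  heat d t x y = \prod_i gaussian (t * d i ^+ 2) (y ord0 i) (x ord0 i).
Proof.
rewrite /heat /sqdist mulr_sumr -sumrN expR_sum; apply: eq_bigr => i _.
by rewrite /gaussian exprMn mulrA.
Qed.

Lemma measurable_heat dT (T : measurableType dT) d (r : T -> R) (p q : T -> 'rV[R]_n) :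
  measurable_fun setT r -> measurable_fun setT p -> measurable_fun setT q ->
  measurable_fun setT (fun z => heat d (r z) (p z) (q z)).
Proof.
move=> mr mp mq; apply: measurableT_comp => //; apply: measurableT_comp => //.
by apply: measurable_funM => //; exact: measurable_sqdist.
Qed.

(** Replacing the Gaussian by 1 leaves the integral of the weight; replacing the weight by 1 leaves
    that of the Gaussian, of order tau^(-1/2). The sum of the two constants serves for both and does
    not involve [y]. *)
Lemma integral_japanese_gaussian (tau y c : R) : 0 < tau -> c != 0 ->
  leb.-integrable setT
    (EFin \o (fun r : R => japanese r * gaussian (tau * c ^+ 2) y r)) /\
  \int[leb]_r (japanese r * gaussian (tau * c ^+ 2) y r) <=
  (\int[leb]_r japanese r + Num.sqrt (pi / c ^+ 2)) *
  Num.min 1 (tau `^ (- 2^-1)).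
Proof.
move=> tau0 c0; have c20 : 0 < c ^+ 2 by rewrite exprn_even_gt0.
have [ig gE] := integral_gaussian y (mulr_gt0 tau0 c20).
have ij := integrable_japanese R.
have g1 r : gaussian (tau * c ^+ 2) y r <= 1.
  rewrite -[leRHS]expR0 ler_expR oppr_le0; apply: mulr_ge0; last exact: sqr_ge0.
  by apply: mulr_ge0; rewrite ltW.
have j0 r : 0 <= @japanese R r := japanese_ge0 r.
have g0 r : 0 <= gaussian (tau * c ^+ 2) y r := gaussian_ge0 _ _ _.
have ijg : leb.-integrable setT
    (EFin \o (fun r : R => japanese r * gaussian (tau * c ^+ 2) y r)).
  apply: le_integrable ij => //.
    apply/measurable_EFinP; apply: measurable_funM; first exact: measurable_japanese.
    by apply/measurable_EFinP; exact: measurable_int ig.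
  move=> r _; rewrite /= lee_fin ger0_norm ?mulr_ge0// ger0_norm//.
  by rewrite ler_piMr.
split=> //; have J0 : 0 <= \int[leb]_r japanese r by apply: Rintegral_ge0.
rewrite minr_pMr ?addr_ge0 ?sqrtr_ge0// mulr1 le_min; apply/andP; split.
  rewrite (@le_trans _ _ (\int[leb]_r japanese r))// ?lerDl ?sqrtr_ge0//.
  by apply: le_Rintegral => // r _; rewrite ler_piMr.
apply: (@le_trans _ _ (\int[leb]_r gaussian (tau * c ^+ 2) y r)).
  by apply: le_Rintegral => // r _; rewrite ler_piMl ?japanese_le1.
have sE : Num.sqrt (pi / (tau * c ^+ 2)) = Num.sqrt (pi / c ^+ 2) * (Num.sqrt tau)^-1.
  rewrite -sqrtrV ?ltW// -sqrtrM ?divr_ge0 ?pi_ge0 ?ltW//.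
  by congr Num.sqrt; rewrite invfM mulrA mulrAC.
rewrite gE sE powRN (powR12_sqrt (ltW tau0)).
by apply: ler_wpM2r; rewrite ?invr_ge0 ?sqrtr_ge0// lerDr.
Qed.

Lemma integral_japanese_heat d t y : 0 < t -> (forall i, d i != 0) ->
  (\int[lebn]_x (japanese_rV x * heat d t x y)%:E <=
   ((\prod_i (\int[leb]_r japanese r + Num.sqrt (pi / d i ^+ 2))) *
     Num.min 1 (t `^ (- (n%:R / 2))))%:E)%E.
Proof.
move=> t0 d0.
pose h i r := japanese r * gaussian (t * d i ^+ 2) (y ord0 i) r.
have hE x : japanese_rV x * heat d t x y = \prod_i h i (x ord0 i).
  by rewrite heat_tensor /japanese_rV -big_split.
have [ih hP] := @integral_tensor R n h
  (fun i => (integral_japanese_gaussian (y ord0 i) t0 (d0 i)).1).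
under eq_integral do rewrite hE.
rewrite -(fineK (integrable_fin_num measurableT ih)) lee_fin.
rewrite -/(Rintegral _ _ _) hP.
apply: (@le_trans _ _ (\prod_i ((\int[leb]_r japanese r + Num.sqrt (pi / d i ^+ 2)) *
    Num.min 1 (t `^ (- 2^-1))))).
  apply: ler_prod => i _; rewrite Rintegral_ge0/=; last first.
    by move=> r _; rewrite mulr_ge0 ?japanese_ge0 ?gaussian_ge0.
  exact: (integral_japanese_gaussian (y ord0 i) t0 (d0 i)).2.
have p0 : 0 <= t `^ (- 2^-1) by exact: powR_ge0.
have m0 : 0 <= Num.min 1 (t `^ (- 2^-1)) by rewrite le_min ler01.
rewrite big_split/= prodr_const card_ord ler_wpM2l//.
  apply: prodr_ge0 => i _; rewrite addr_ge0 ?sqrtr_ge0// Rintegral_ge0// => r _.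
  exact: japanese_ge0.
rewrite le_min exprn_ile1// ?ge_min ?lexx//=.
have -> : t `^ (- (n%:R / 2)) = (t `^ (- 2^-1)) ^+ n.
  by rewrite -powR_mulrn// -powRrM; congr (_ `^ _); rewrite mulNr mulrC.
by apply: lerXn2r; rewrite ?nnegrE// ge_min lexx orbT.
Qed.

(** By Tonelli the integral in [x] comes first; its bound, a multiple of min(1, t^(-n/2)), is
    integrable against t^(s-1) in the range 0 < s < n/2. Uniformity in [y] later allows a second
    function to be integrated against the kernel. *)
Lemma integral_japanese_riesz d s : 0 < s -> s < n%:R / 2 -> (forall i, d i != 0) ->
  exists C : R, 0 <= C /\ forall y,
  (\int[lebn]_x \int[leb]_t (japanese_rV x * (hpow s t * heat d t x y))%:E <= C%:E)%E.
Proof.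
move=> s0 sn d0.
pose K := \prod_i (\int[leb]_r japanese r + Num.sqrt (pi / d i ^+ 2)).
have K0 : 0 <= K.
  apply: prodr_ge0 => i _; rewrite addr_ge0 ?sqrtr_ge0// Rintegral_ge0// => r _.
  exact: japanese_ge0.
pose q t := hpow s t * Num.min 1 (t `^ (- (n%:R / 2))).
have iq := integrable_hpow_min s0 sn.
have q0 t : 0 <= q t by rewrite mulr_ge0 ?hpow_ge0// le_min ler01 powR_ge0.
exists (K * \int[leb]_t q t); split.
  by rewrite mulr_ge0// Rintegral_ge0.
move=> y.
pose F (z : 'rV[R]_n * R) := japanese_rV z.1 * (hpow s z.2 * heat d z.2 z.1 y).
have F0 z : 0 <= F z.
  by rewrite /F mulr_ge0 ?japanese_rV_ge0// mulr_ge0 ?hpow_ge0 ?heat_ge0.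
have mF : measurable_fun setT F.
  apply: measurable_funM.
    exact: (measurableT_comp measurable_japanese_rV measurable_fst).
  apply: measurable_funM.
    exact: (measurableT_comp (@measurable_hpow R s) measurable_snd).
  exact: measurable_heat.
rewrite (fubini_tonelli (m1 := lebn) (m2 := leb) (fun z => (F z)%:E));
  [|exact/measurable_EFinP|by move=> z; rewrite lee_fin].
apply: (@le_trans _ _ (\int[leb]_t (K%:E * (q t)%:E))%E); last first.
  have E : (\int[leb]_t (q t)%:E)%E = (\int[leb]_t q t)%:E.
    by rewrite /Rintegral fineK//; exact: integrable_fin_num iq.
  rewrite ge0_integralZl ?E//; first by have := measurable_int _ iq.
  by move=> t _; rewrite lee_fin.
apply: ge0_le_integral => //.
- by move=> t _; apply: integral_ge0 => x _; rewrite lee_fin.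
- apply: (measurable_fun_fubini_tonelli_G (fun z => (F z)%:E)) => //.
  exact/measurable_EFinP.
- by apply: emeasurable_funM => //; exact: measurable_int iq.
move=> t _; rewrite -EFinM /F /q /=.
under eq_integral do rewrite mulrCA EFinM.
rewrite ge0_integralZl; [|exact: measurableT| | |by rewrite lee_fin hpow_ge0]; last 2 first.
- apply/measurable_EFinP; apply: measurable_funM; first exact: measurable_japanese_rV.
  by apply: measurable_heat.
- by move=> x _; rewrite lee_fin mulr_ge0 ?japanese_rV_ge0 ?heat_ge0.
have [t0|t0] := ltP 0 t; last by rewrite /hpow ltNge t0/= mul0e mul0r mulr0.
rewrite mulrCA EFinM lee_wpmul2l ?lee_fin ?hpow_ge0//.
exact: integral_japanese_heat.
Qed.

End riesz_kernel.

(** * Decay of oscillatory integrals *)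

Section integration_by_parts.
Variable R : realType.
Local Notation leb := (@lebesgue_measure R).

Lemma is_derive_shift (f : R -> R) (a b : R) :
  is_derive (0 : R) 1 (fun s : R => f (a + s)) b -> is_derive a 1 f b.
Proof.
move=> df; have dg := is_derive_affine 1 (- a) a.
have d0 : is_derive (1 * a + - a) 1 (fun s : R => f (a + s)) b.
  by rewrite mul1r subrr.
have := @is_derive_after R (fun s => f (a + s)) (fun t => 1 * t + - a) a b 1 d0 dg.
rewrite mulr1 (_ : (fun t => _) = f)//; apply/funext => t.
by rewrite mul1r addrC subrK.
Qed.

Lemma is_derive_line n (p : 'rV[R]_n -> R) (x v : 'rV[R]_n) :
  derivable p x v -> is_derive (0 : R) 1 (fun s : R => p (x + s *: v)) ('D_v p x).
Proof.
move=> dp.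
have E : (fun h : R => h^-1 *: ((fun s : R => p (x + s *: v)) (h *: 1 + 0) -
    (fun s : R => p (x + s *: v)) 0)) = (fun h : R => h^-1 *: (p (h *: v + x) - p x)).
  apply/funext => h; congr (_ *: (p _ - p _)).
    by rewrite addr0 /GRing.scale/= mulr1 addrC.
  by rewrite scale0r addr0.
apply: DeriveDef; first by rewrite /derivable E.
by rewrite /derive E.
Qed.

Lemma cons_rV_add0 n (a s : R) (y : 'rV[R]_n) :
  cons_rV (a, y) + s *: delta_mx 0 ord0 = cons_rV (a + s, y).
Proof.
apply/rowP => i; rewrite [LHS]mxE [X in _ + X]mxE [X in _ + _ * X]mxE.
case: (unliftP ord0 i) => [j ->|->].
  by rewrite !cons_rV_lift /= mulr0 addr0.
by rewrite !cons_rV0 /= mulr1.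
Qed.

Lemma cons_rV_addl n (a s : R) (y : 'rV[R]_n) j :
  cons_rV (a, y) + s *: delta_mx 0 (lift ord0 j) =
  cons_rV (a, y + s *: delta_mx 0 j).
Proof.
apply/rowP => i; rewrite [LHS]mxE [X in _ + X]mxE [X in _ + _ * X]mxE.
case: (unliftP ord0 i) => [l ->|->].
  by rewrite !cons_rV_lift /= !mxE (inj_eq (@lift_inj _ _)).
by rewrite !cons_rV0 /= mulr0 addr0.
Qed.

Lemma japanese_cons n (a : R) (y : 'rV[R]_n) :
  japanese_rV (cons_rV (a, y)) = japanese a * japanese_rV y.
Proof.
rewrite /japanese_rV big_ord_recl cons_rV0; congr (_ * _).
by apply: eq_bigr => i _; rewrite cons_rV_lift.
Qed.

Lemma integrable_japanese_le n (D : 'rV[R]_n -> R) (C : R) :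
  measurable_fun setT D -> (forall x, `|D x| <= C * japanese_rV x) ->
  (lebesgue_rV R n).-integrable setT (EFin \o D).
Proof.
move=> mD DC; apply: le_integrable (integrableZl measurableT C
  (integrable_japanese_rV R n)) => //; first exact/measurable_EFinP.
by move=> x _ /=; rewrite lee_fin (le_trans (DC x))// ler_norm.
Qed.

(** Induction on the dimension, splitting off the first coordinate. If [k] is a later coordinate,
    the slices fall under the induction hypothesis; if it is the first, Fubini makes its integral
    the inner one and [integral_derive_eq0] applies. Derivative and continuity are required along
    lines only, which is all that partial derivatives provide. *)
Lemma integral_partial_eq0 n (k : 'I_n) (H D : 'rV[R]_n -> R) (C : R) :
  measurable_fun setT D ->
  (forall x, is_derive (0 : R) 1 (fun s : R => H (x + s *: delta_mx 0 k)) (D x)) ->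
  (forall x, continuous (fun s : R => D (x + s *: delta_mx 0 k))) ->
  (forall x, `|H x| <= C * japanese_rV x) ->
  (forall x, `|D x| <= C * japanese_rV x) ->
  \int[lebesgue_rV R n]_x D x = 0.
Proof.
elim: n k H D C => [[]//|n IH] k H D C mD dH cD HC DC.
have iD := integrable_japanese_le mD DC.
have ciD := cintegrable_real iD.
apply: complexI; rewrite -cintegral_real cintegral_rVS//.
have mDa a : measurable_fun setT (fun y : 'rV[R]_n => D (cons_rV (a, y))).
  by apply: (measurableT_comp mD); apply: (measurableT_comp (@measurable_cons_rV R n)).
have mDy (y : 'rV[R]_n) : measurable_fun setT (fun a : R => D (cons_rV (a, y))).
  by apply: (measurableT_comp mD); apply: (measurableT_comp (@measurable_cons_rV R n)).
have HC' a y : `|H (cons_rV (a, y))| <= C * japanese a * japanese_rV y.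
  by rewrite -mulrA -japanese_cons.
have DC' a y : `|D (cons_rV (a, y))| <= C * japanese a * japanese_rV y.
  by rewrite -mulrA -japanese_cons.
case: (unliftP ord0 k) => [j kj|k0].
  transitivity (cintegral leb setT (fun=> 0 : R[i])); last first.
    exact: cintegral0.
  apply: eq_cintegral => a; rewrite cintegral_real; congr (_%:C).
  apply: (IH j (fun y => H (cons_rV (a, y))) _ (C * japanese a)) => // y.
  - have := dH (cons_rV (a, y)); rewrite kj.
    by under eq_fun do rewrite cons_rV_addl.
  - have := cD (cons_rV (a, y)); rewrite kj.
    by under eq_fun do rewrite cons_rV_addl.
have ci2 : cintegrable (leb \x lebesgue_rV R n)%E setT
    (fun z => (D (cons_rV z))%:C).
  split => /=; last exact: integrable0.
  by have := (integrable_rVS (measurable_int _ iD)).1 iD.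
have [_ _ ->] := cfubini ci2.
transitivity (cintegral (lebesgue_rV R n) setT (fun=> 0 : R[i])); last first.
  exact: cintegral0.
apply: eq_cintegral => y; rewrite cintegral_real; congr (_%:C).
have [//|||| _ ->//] := @integral_derive_eq0 R (fun a => H (cons_rV (a, y)))
  (fun a => D (cons_rV (a, y))) (C * japanese_rV y).
- move=> a; apply: is_derive_shift; have := dH (cons_rV (a, y)); rewrite k0.
  by under eq_fun do rewrite cons_rV_add0.
- have := cD (cons_rV (0, y)); rewrite k0.
  by under eq_fun do rewrite cons_rV_add0 add0r.
- by move=> a; rewrite mulrAC.
- by move=> a; rewrite mulrAC.
Qed.

End integration_by_parts.

(** * From monomial bounds to the tensor weight *)

Section weights.
Variables (R : realType) (n : nat).
Implicit Types (x : 'rV[R]_n) (e : 'I_n -> nat).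

(** Expanding prod_i (1 + x_i^2) produces one monomial, with exponents 0 or 2, for each subset [f]
    of the coordinates; here it is multiplied by x^e. *)
Definition weight_exponent e (f : {ffun 'I_n -> bool}) : 'I_n -> nat :=
  fun i => ((f i).*2 + e i)%N.

(** The inverse weight is the sum of the monomials just described, so finitely many monomial bounds
    add up to a bound by the weight. *)
Lemma weight_bound e (B : {ffun 'I_n -> bool} -> R) x (r : R) : 0 <= r ->
  (forall f, `|monomial (weight_exponent e f) x| * r <= B f) ->
  `|monomial e x| * r <= (\sum_f B f) * japanese_rV x.
Proof.
move=> r0 hB; rewrite -ler_pdivrMr ?japanese_rV_gt0//.
have -> : `|monomial e x| * r / japanese_rV x =
    \sum_(f : {ffun 'I_n -> bool}) `|monomial (weight_exponent e f) x| * r.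
  rewrite -mulr_suml mulrAC; congr (_ * _).
  transitivity (`|monomial e x| * \prod_i \sum_(b : bool) x ord0 i ^+ b.*2).
    congr (_ * _); rewrite /japanese_rV -prodfV; apply: eq_bigr => i _.
    by rewrite invrK big_bool /= expr0 addrC.
  rewrite bigA_distr_bigA mulr_sumr; apply: eq_bigr => f _.
  rewrite /monomial !normr_prod -big_split; apply: eq_bigr => i _.
  rewrite /weight_exponent exprD normrM mulrC; congr (_ * _).
  by rewrite ger0_norm// -mul2n exprM exprn_ge0// sqr_ge0.
exact: ler_sum.
Qed.

End weights.

Section pointwise_derivatives_rV.
Variables (R : realType) (V : normedModType R).
Implicit Types (p q : V -> R) (x v : V).

Lemma is_derive_linear (a dp dq : R) p q x v :
  is_derive x v p dp -> is_derive x v q dq ->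
  is_derive x v (fun y => a * p y + q y) (a * dp + dq).
Proof. by move=> hp hq; exact: (is_deriveD (is_deriveZ a hp) hq). Qed.

Lemma is_derive_product (dp dq : R) p q x v :
  is_derive x v p dp -> is_derive x v q dq ->
  is_derive x v (fun y => p y * q y) (p x * dq + q x * dp).
Proof. exact: is_deriveM. Qed.

End pointwise_derivatives_rV.

(** * Functions rapidly decreasing in one variable *)

Section directional_schwartz.
Variables (R : realType) (n : nat) (k : 'I_n).
Implicit Types (p q : 'rV[R]_n -> R) (x : 'rV[R]_n).
Local Notation ek := (delta_mx 0 k : 'rV[R]_n).

Definition dir_derive p : 'rV[R]_n -> R := fun x => 'D_ek p x.

(* Rapid decay is only required in the variable [k]; in the others the weight
   [japanese_rV], which makes functions integrable, suffices. *)
Definition dir_schwartz p : Prop := forall m,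
  [/\ continuous (iter m dir_derive p),
      forall x, derivable (iter m dir_derive p) x ek &
      forall j, exists C, forall x,
        `|x ord0 k| ^+ j * `|iter m dir_derive p x| <= C * japanese_rV x].

Lemma dir_schwartz_derive p : dir_schwartz p -> dir_schwartz (dir_derive p).
Proof. by move=> hp m; rewrite -iterSr; exact: hp. Qed.

Lemma dir_schwartz_le p j : dir_schwartz p ->
  exists C, forall x, `|x ord0 k| ^+ j * `|p x| <= C * japanese_rV x.
Proof. by move=> /(_ 0%N)[_ _]; exact. Qed.

Lemma dir_schwartz_derivable p x : dir_schwartz p -> derivable p x ek.
Proof. by move=> /(_ 0%N)[_ + _]; exact. Qed.

Lemma dir_schwartz_continuous p : dir_schwartz p -> continuous p.
Proof. by move=> /(_ 0%N)[+ _ _]; exact. Qed.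

Lemma iter_dir_derive_lin (a : R) p q m : dir_schwartz p -> dir_schwartz q ->
  iter m dir_derive (fun x => a * p x + q x) =
  (fun x => a * iter m dir_derive p x + iter m dir_derive q x).
Proof.
move=> hp hq; elim: m => // m IH; rewrite !iterS IH; apply/funext => x.
have [_ dp _] := hp m; have [_ dq _] := hq m.
have d := is_derive_linear a (derivableP (dp x)) (derivableP (dq x)).
by rewrite /dir_derive (@derive_val _ _ _ _ _ _ _ d).
Qed.

Lemma dir_schwartz_lin (a : R) p q : dir_schwartz p -> dir_schwartz q ->
  dir_schwartz (fun x => a * p x + q x).
Proof.
move=> hp hq m; rewrite iter_dir_derive_lin//.
have [cp dp bp] := hp m; have [cq dq bq] := hq m; split.
- by move=> x; exact: (cvgD (cvgM (cvg_cst a) (cp x)) (cq x)).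
- move=> x.
  by have [] := is_derive_linear a (derivableP (dp x)) (derivableP (dq x)).
- move=> j; have [C hC] := bp j; have [D hD] := bq j.
  exists (`|a| * C + D) => x.
  apply: le_trans (ler_wpM2l _ (ler_normD _ _)) _; first by rewrite exprn_ge0.
  by rewrite mulrDr mulrDl lerD// normrM mulrCA -mulrA ler_wpM2l.
Qed.

Lemma is_derive_coord x : is_derive x ek (fun y : 'rV[R]_n => y ord0 k) (1 : R).
Proof.
have E : (fun h : R => h^-1 *: ((h *: ek + x) ord0 k - x ord0 k)) @ 0^' --> (1 : R).
  apply: cvg_near_cst; near=> h.
  rewrite !mxE !eqxx mulr1 addrK /GRing.scale/= mulVf//.
  by near: h; exact: nbhs_dnbhs_neq.
apply: DeriveDef; first by apply/cvg_ex; exists (1 : R).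
exact/cvg_lim.
Unshelve. end_near. Qed.

(** Leibniz' rule, in which at most one derivative falls on the coordinate. At [m = 0] the truncated
    [m.-1] is multiplied by 0. *)
Lemma iter_dir_derive_mul p m : dir_schwartz p ->
  iter m dir_derive (fun x => x ord0 k * p x) =
  (fun x => x ord0 k * iter m dir_derive p x + m%:R * iter m.-1 dir_derive p x).
Proof.
move=> hp; elim: m => [|m IH].
  by apply/funext => x; rewrite /= mul0r addr0.
rewrite iterS IH; apply/funext => x.
have [_ dp _] := hp m; have [_ dp1 _] := hp m.-1.
have d := is_derive_linear m%:R (derivableP (dp1 x))
  (is_derive_product (is_derive_coord x) (derivableP (dp x))).
under eq_fun do rewrite addrC.
rewrite {1}/dir_derive (@derive_val _ _ _ _ _ _ _ d) addrCA; congr (_ + _).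
rewrite mulr1; case: m {IH dp dp1 d} => [|m] /=; first by rewrite mul0r add0r mul1r.
by rewrite -[X in _ + X]mul1r -mulrDl natr1.
Qed.

Lemma continuous_coord_rV (i : 'I_n) :
  continuous (fun x : 'rV[R]_n => x ord0 i).
Proof. exact: coord_continuous. Qed.

Lemma dir_schwartz_mul p : dir_schwartz p -> dir_schwartz (fun x => x ord0 k * p x).
Proof.
move=> hp m; rewrite iter_dir_derive_mul//.
have [cp dp bp] := hp m; have [cp1 dp1 bp1] := hp m.-1; split.
- move=> x; exact: (cvgD (cvgM (@continuous_coord_rV k x) (cp x))
    (cvgM (cvg_cst (m%:R : R)) (cp1 x))).
- move=> x; under eq_fun do rewrite addrC.
  by have [] := is_derive_linear m%:R (derivableP (dp1 x))
    (is_derive_product (is_derive_coord x) (derivableP (dp x))).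
(* The factor [x ord0 k] costs one power of decay, hence [j.+1] for the first term. *)
- move=> j; have [C hC] := bp j.+1; have [D hD] := bp1 j.
  exists (C + m%:R * D) => x.
  apply: le_trans (ler_wpM2l _ (ler_normD _ _)) _; first by rewrite exprn_ge0.
  rewrite mulrDr mulrDl lerD//.
    by rewrite normrM mulrA -exprSr.
  by rewrite normrM normr_nat mulrCA -mulrA ler_wpM2l.
Qed.

Lemma iter_dir_derive_partials (phi : 'rV[R]_n -> R[i]) m :
  iter m dir_derive (fun x => complex.Re (phi x)) =
    (fun x => complex.Re (partials (nseq m k) phi x)) /\
  iter m dir_derive (fun x => complex.Im (phi x)) =
    (fun x => complex.Im (partials (nseq m k) phi x)).
Proof. by elim: m => [//|m [IHr IHi]]; rewrite !iterS IHr IHi. Qed.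

Lemma multi_partial_pure (phi : 'rV[R]_n -> R[i]) m :
  multi_partial (fun i => if i == k then m else 0%N) phi = partials (nseq m k) phi.
Proof.
rewrite /multi_partial; congr (partials _ phi).
have E (s : seq 'I_n) : flatten [seq nseq (if i == k then m else 0%N) i | i <- s] =
    nseq (count_mem k s * m) k.
  elim: s => //= i s ->; case: eqP => [->|_] //=.
  by rewrite -nseqD mulnDl mul1n.
by rewrite E count_uniq_mem ?enum_uniq// mem_enum mul1n.
Qed.

Lemma schwartz_monomial_le (phi : 'rV[R]_n -> R[i]) a b : schwartz phi ->
  exists C : R, forall x, `|monomial a x| * normc (multi_partial b phi x) <= C.
Proof.
move=> [_ /(_ a b) h]; exists (fine (schwartz_seminorm a b phi)) => x.
have hx : ((normc ((monomial a x)%:C * multi_partial b phi x))%:E <=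
    schwartz_seminorm a b phi)%E by apply: ereal_sup_ubound; exists x.
rewrite -lee_fin fineK; first by rewrite normc_realM in hx.
rewrite ge0_fin_numE//; apply: le_trans hx.
by rewrite lee_fin normc_ge0.
Qed.

Lemma monomial_pure j x :
  `|monomial (fun i => if i == k then j else 0%N) x| = `|x ord0 k| ^+ j.
Proof.
rewrite /monomial normr_prod (bigD1 k)//= eqxx big1 ?mulr1 ?normrX//.
by move=> i /negPf ->; rewrite expr0 normr1.
Qed.

Lemma schwartz_pure_le (phi : 'rV[R]_n -> R[i]) m j : schwartz phi ->
  exists C : R, forall x, `|x ord0 k| ^+ j *
    normc (partials (nseq m k) phi x) <= C * japanese_rV x.
Proof.
move=> sphi; pose e := fun i : 'I_n => if i == k then j else 0%N.
pose b := fun i : 'I_n => if i == k then m else 0%N.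
have /choice[B hB] : forall f : {ffun 'I_n -> bool}, exists C : R, forall x,
    `|monomial (weight_exponent e f) x| * normc (multi_partial b phi x) <= C.
  by move=> f; exact: schwartz_monomial_le.
exists (\sum_f B f) => x; rewrite -monomial_pure -multi_partial_pure.
by apply: weight_bound; [exact: normc_ge0|move=> f; exact: hB].
Qed.

Lemma dir_schwartz_schwartz (phi : 'rV[R]_n -> R[i]) : schwartz phi ->
  dir_schwartz (fun x => complex.Re (phi x)) /\
  dir_schwartz (fun x => complex.Im (phi x)).
Proof.
move=> sphi; have [smooth_phi _] := sphi.
split=> m; have [cR cI dRI] := smooth_phi (nseq m k).
- rewrite (iter_dir_derive_partials phi m).1; split => //.
    by move=> x; have [] := dRI k x.
  move=> j; have [C hC] := schwartz_pure_le m j sphi; exists C => x.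
  by apply: le_trans (hC x); rewrite ler_wpM2l ?exprn_ge0// normRe_le.
- rewrite (iter_dir_derive_partials phi m).2; split => //.
    by move=> x; have [] := dRI k x.
  move=> j; have [C hC] := schwartz_pure_le m j sphi; exists C => x.
  by apply: le_trans (hC x); rewrite ler_wpM2l ?exprn_ge0// normIm_le.
Qed.

End directional_schwartz.

(** * Integration by parts against a quadratic phase *)

Section oscillatory_integrals.
Variables (R : realType) (n : nat).
Local Notation lebn := (lebesgue_rV R n).
Implicit Types (h : 'rV[R]_n -> R[i]) (u x : 'rV[R]_n) (A B : 'I_n -> R) (k : 'I_n).

(** [A] carries the chirp and stays fixed; [B] carries the frequency, in which decay is measured. *)
Definition quadratic_phase A B u : R := \sum_i (A i * u ord0 i ^+ 2 + B i * u ord0 i).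

Lemma continuous_quadratic_phase A B : continuous (quadratic_phase A B).
Proof.
rewrite /quadratic_phase; elim: (index_enum _) => [|i s IH] u.
  rewrite (_ : (fun u : 'rV[R]_n => _) = fun=> 0); first exact: cst_continuous.
  by apply/funext => v; rewrite big_nil.
have ci := @continuous_coord_rV R n i u.
have -> : (fun u : 'rV[R]_n => \sum_(j <- i :: s) (A j * u ord0 j ^+ 2 + B j * u ord0 j)) =
    (fun u => (A i * (u ord0 i * u ord0 i) + B i * u ord0 i) +
      \sum_(j <- s) (A j * u ord0 j ^+ 2 + B j * u ord0 j)).
  by apply/funext => v; rewrite big_cons expr2.
exact: (cvgD (cvgD (cvgM (cvg_cst (A i)) (cvgM ci ci)) (cvgM (cvg_cst (B i)) ci)) (IH u)).
Qed.

Lemma measurable_quadratic_phase A B : measurable_fun setT (quadratic_phase A B).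
Proof. exact: continuous_measurable_fun_rV (@continuous_quadratic_phase A B). Qed.

Lemma quadratic_phase_line A B k u (s : R) :
  quadratic_phase A B (u + s *: delta_mx 0 k) =
  quadratic_phase A B u + ((2 * A k * u ord0 k + B k) * s + A k * (s * s)).
Proof.
rewrite /quadratic_phase (bigD1 k)//= [in RHS](bigD1 k)//=.
rewrite (eq_bigr (fun i => A i * u ord0 i ^+ 2 + B i * u ord0 i)); last first.
  by move=> i ik; rewrite !mxE (negbTE ik) andbF mulr0 addr0.
by rewrite !mxE !eqxx/= mulr1; ring.
Qed.

Lemma is_derive_quadratic_phase A B k u :
  is_derive (0 : R) 1 (fun s : R => quadratic_phase A B (u + s *: delta_mx 0 k))
    (2 * A k * u ord0 k + B k).
Proof.
rewrite (_ : (fun s => _) = fun s : R => quadratic_phase A B u +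
  ((2 * A k * u ord0 k + B k) * s + A k * (s * s))); last first.
  by apply/funext => s; rewrite quadratic_phase_line.
have dv := is_derive_var (0 : R).
apply: is_derive_eq (is_derive_add (is_derive_const (quadratic_phase A B u) 0)
  (is_derive_add (is_derive_mulc (2 * A k * u ord0 k + B k) dv)
    (is_derive_mulc (A k) (is_derive_mul dv dv)))) _.
by rewrite mulr0 mul0r addr0 mulr0 addr0 add0r mulr1.
Qed.

Definition dir_cschwartz k h : Prop :=
  dir_schwartz k (fun u => complex.Re (h u)) /\
  dir_schwartz k (fun u => complex.Im (h u)).

(* [expi phase * twisted_derive h] is the derivative of [expi phase * h], up to
   the linear part [B] of the phase. *)
Definition twisted_derive A k h : 'rV[R]_n -> R[i] := fun u =>
  (dir_derive k (fun v => complex.Re (h v)) u - 2 * A k * (u ord0 k * complex.Im (h u)))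
  +i* (dir_derive k (fun v => complex.Im (h v)) u
       + 2 * A k * (u ord0 k * complex.Re (h u))).

Lemma dir_cschwartz_twisted A k h :
  dir_cschwartz k h -> dir_cschwartz k (twisted_derive A k h).
Proof.
move=> [hR hI]; split.
- have := dir_schwartz_lin (- (2 * A k)) (dir_schwartz_mul hI) (dir_schwartz_derive hR).
  rewrite (_ : (fun x => _ + _) = fun u => complex.Re (twisted_derive A k h u))//.
  by apply/funext => u /=; rewrite mulNr addrC.
- have := dir_schwartz_lin (2 * A k) (dir_schwartz_mul hR) (dir_schwartz_derive hI).
  rewrite (_ : (fun x => _ + _) = fun u => complex.Im (twisted_derive A k h u))//.
  by apply/funext => u /=; rewrite addrC.
Qed.

Lemma dir_cschwartz_le k h : dir_cschwartz k h ->
  exists C : R, forall u, normc (h u) <= C * japanese_rV u.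
Proof.
move=> [hR hI]; have [C hC] := dir_schwartz_le 0 hR; have [D hD] := dir_schwartz_le 0 hI.
exists (C + D) => u; rewrite (le_trans (normc_le _))// mulrDl lerD//.
- by have := hC u; rewrite expr0 mul1r.
- by have := hD u; rewrite expr0 mul1r.
Qed.

Lemma dir_cschwartz_measurable k h : dir_cschwartz k h -> cmeasurable h.
Proof.
by move=> [/dir_schwartz_continuous cR /dir_schwartz_continuous cI]; split;
  exact: continuous_measurable_fun_rV.
Qed.

(** The exponential has modulus one, so [M] depends on the amplitude alone; the order of the
    quantifiers matters for uniformity in the frequency. *)
Lemma oscillatory_bound h (C : R) : cmeasurable h ->
  (forall u, normc (h u) <= C * japanese_rV u) ->
  exists M : R, forall theta : 'rV[R]_n -> R, measurable_fun setT theta ->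
    cintegrable lebn setT (fun u => h u * expi (theta u)) /\
    normc (cintegral lebn setT (fun u => h u * expi (theta u))) <= M.
Proof.
move=> mh hC; exists (2 * \int[lebn]_u (C * japanese_rV u)) => theta mtheta.
have iC : lebn.-integrable setT (EFin \o (fun u => C * japanese_rV u)).
  by apply: eq_integrable (integrableZl measurableT C (integrable_japanese_rV R n)).
have hE u : normc (h u * expi (theta u)) <= C * japanese_rV u.
  by rewrite normcM normc_expi mulr1.
have ih : cintegrable lebn setT (fun u => h u * expi (theta u)).
  apply: (cintegrable_le _ iC) => //.
  by apply: cmeasurableM => //; exact: cmeasurable_expi.
by split => //; apply: (normc_cintegral_le ih iC).
Qed.

(** The derivative of the amplitude times the exponential integrates to zero. It splits into the
    twisted derivative, which does not involve [B], and the term i B_k h. *)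
Lemma oscillatory_parts A B k h : dir_cschwartz k h ->
  cintegral lebn setT (fun u => twisted_derive A k h u * expi (quadratic_phase A B u)) =
  (0 -i* B k) * cintegral lebn setT (fun u => h u * expi (quadratic_phase A B u)).
Proof.
move=> hh; have [hR hI] := hh.
pose p u := complex.Re (h u); pose q u := complex.Im (h u).
pose w u := quadratic_phase A B u.
pose dp := dir_derive k p; pose dq := dir_derive k q.
pose w' u := 2 * A k * u ord0 k + B k.
pose line u (s : R) : 'rV[R]_n := u + s *: delta_mx 0 k.
have hL := dir_cschwartz_twisted A hh.
have mh := dir_cschwartz_measurable hh; have mL := dir_cschwartz_measurable hL.
have mw := measurable_quadratic_phase A B.
have [C hC] := dir_cschwartz_le hh; have [C' hC'] := dir_cschwartz_le hL.
have [_ /(_ _ mw)[ih _]] := oscillatory_bound mh hC.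
have [_ /(_ _ mw)[iL _]] := oscillatory_bound mL hC'.
pose D u := twisted_derive A k h u + (0 +i* B k) * h u.
have mD : cmeasurable D.
  by apply: cmeasurableD => //; apply: cmeasurableM => //; exact: cmeasurable_cst.
have DE u : D u = (dp u - w' u * q u) +i* (dq u + w' u * p u).
  rewrite /D /twisted_derive -/p -/q -/dp -/dq /w' /p /q; case: (h u) => a b.
  by apply/eqP; rewrite eq_complex /=; apply/andP; split; apply/eqP; ring.
have DC u : normc (D u) <= (C' + `|B k| * C) * japanese_rV u.
  rewrite (le_trans (le_normcD _ _))// mulrDl lerD// normcM.
  rewrite -mulrA ler_pM ?normc_ge0//.
  by rewrite normcE /= expr0n add0r sqrtr_sqr.
have DeC u : normc (D u * expi (w u)) <= (C' + `|B k| * C) * japanese_rV u.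
  by rewrite normcM normc_expi mulr1.
have heC u : normc (h u * expi (w u)) <= C * japanese_rV u.
  by rewrite normcM normc_expi mulr1.
have C0 : 0 <= C.
  have := le_trans (normc_ge0 _) (hC 0); by rewrite pmulr_lge0// japanese_rV_gt0.
have C0' : 0 <= C'.
  have := le_trans (normc_ge0 _) (hC' 0); by rewrite pmulr_lge0// japanese_rV_gt0.
(* [integral_partial_eq0] takes a single constant for the function and its derivative. *)
pose K := C + (C' + `|B k| * C).
have K1 u : C * japanese_rV u <= K * japanese_rV u.
  by rewrite ler_wpM2r ?japanese_rV_ge0// lerDl addr_ge0// mulr_ge0.
have K2 u : (C' + `|B k| * C) * japanese_rV u <= K * japanese_rV u.
  by rewrite ler_wpM2r ?japanese_rV_ge0// lerDr.
have mDe : cmeasurable (fun u => D u * expi (w u)).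
  by apply: cmeasurableM => //; exact: cmeasurable_expi.
have cline u : continuous (line u).
  move=> s; apply: cvgD; first exact: cvg_cst.
  by apply: cvgZr_tmp; exact: cvg_id.
have cw u : continuous (fun s : R => w (line u s)).
  move=> s; apply: (cvg_comp (line u) w); first exact: cline.
  exact: continuous_quadratic_phase.
have cw' u : continuous (fun s : R => w' (line u s)).
  move=> s; apply: (cvg_comp (line u) w'); first exact: cline.
  exact: (cvgD (cvgM (cvg_cst (2 * A k)) (@continuous_coord_rV R n k _)) (cvg_cst (B k))).
have cl (r : 'rV[R]_n -> R) u : continuous r -> continuous (fun s : R => r (line u s)).
  by move=> cr s; apply: (cvg_comp (line u) r); [exact: cline|exact: cr].
have cp := cl p ^~ (dir_schwartz_continuous hR).
have cq := cl q ^~ (dir_schwartz_continuous hI).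
have cdp := cl dp ^~ (dir_schwartz_continuous (dir_schwartz_derive hR)).
have cdq := cl dq ^~ (dir_schwartz_continuous (dir_schwartz_derive hI)).
have ccos u : continuous (fun s : R => cos (w (line u s))).
  by move=> s; apply: (cvg_comp _ cos); [exact: cw|exact: continuous_cos].
have csin u : continuous (fun s : R => sin (w (line u s))).
  by move=> s; apply: (cvg_comp _ sin); [exact: cw|exact: continuous_sin].
have l0 u : line u 0 = u by rewrite /line scale0r addr0.
have dpl u : is_derive (0 : R) 1 (fun s : R => p (line u s)) (dp u).
  by apply: is_derive_line; exact: dir_schwartz_derivable.
have dql u : is_derive (0 : R) 1 (fun s : R => q (line u s)) (dq u).
  by apply: is_derive_line; exact: dir_schwartz_derivable.
have dwl u : is_derive (0 : R) 1 (fun s : R => w (line u s)) (w' u).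
  exact: is_derive_quadratic_phase.
have dcos u := is_derive_after (is_derive_cos (w (line u 0))) (dwl u).
have dsin u := is_derive_after (is_derive_sin (w (line u 0))) (dwl u).
have ReE u : complex.Re (D u * expi (w u)) =
    (dp u - w' u * q u) * cos (w u) - (dq u + w' u * p u) * sin (w u).
  by rewrite DE Re_mul.
have ImE u : complex.Im (D u * expi (w u)) =
    (dp u - w' u * q u) * sin (w u) + (dq u + w' u * p u) * cos (w u).
  by rewrite DE Im_mul.
have E0 : cintegral lebn setT (fun u => D u * expi (w u)) = 0.
  rewrite /cintegral; congr (_ +i* _).
  - apply: (@integral_partial_eq0 R n k (fun u => complex.Re (h u * expi (w u))) _ K).
    + exact: mDe.1.
    + move=> u; have d := is_derive_sub (is_derive_mul (dpl u) (dcos u))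
        (is_derive_mul (dql u) (dsin u)).
      rewrite (_ : (fun s => _) = fun s : R => p (line u s) * cos (w (line u s)) -
        q (line u s) * sin (w (line u s))); last first.
        by apply/funext => s; rewrite Re_mul.
      by apply: is_derive_eq d _; rewrite ReE l0; ring.
    + move=> u; rewrite (_ : (fun s => _) = fun s : R =>
        (dp (line u s) - w' (line u s) * q (line u s)) * cos (w (line u s)) -
        (dq (line u s) + w' (line u s) * p (line u s)) * sin (w (line u s))); last first.
        by apply/funext => s; rewrite ReE.
      move=> s; exact: (cvgB (cvgM (cvgB (cdp u s) (cvgM (cw' u s) (cq u s))) (ccos u s))
        (cvgM (cvgD (cdq u s) (cvgM (cw' u s) (cp u s))) (csin u s))).
    + by move=> u; rewrite (le_trans (normRe_le _))// (le_trans (heC u)).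
    + by move=> u; rewrite (le_trans (normRe_le _))// (le_trans (DeC u)).
  - apply: (@integral_partial_eq0 R n k (fun u => complex.Im (h u * expi (w u))) _ K).
    + exact: mDe.2.
    + move=> u; have d := is_derive_add (is_derive_mul (dpl u) (dsin u))
        (is_derive_mul (dql u) (dcos u)).
      rewrite (_ : (fun s => _) = fun s : R => p (line u s) * sin (w (line u s)) +
        q (line u s) * cos (w (line u s))); last first.
        by apply/funext => s; rewrite Im_mul.
      by apply: is_derive_eq d _; rewrite ImE l0; ring.
    + move=> u; rewrite (_ : (fun s => _) = fun s : R =>
        (dp (line u s) - w' (line u s) * q (line u s)) * sin (w (line u s)) +
        (dq (line u s) + w' (line u s) * p (line u s)) * cos (w (line u s))); last first.
        by apply/funext => s; rewrite ImE.
      move=> s; exact: (cvgD (cvgM (cvgB (cdp u s) (cvgM (cw' u s) (cq u s))) (csin u s))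
        (cvgM (cvgD (cdq u s) (cvgM (cw' u s) (cp u s))) (ccos u s))).
    + by move=> u; rewrite (le_trans (normIm_le _))// (le_trans (heC u)).
    + by move=> u; rewrite (le_trans (normIm_le _))// (le_trans (DeC u)).
have : cintegral lebn setT (fun u => D u * expi (w u)) =
    cintegral lebn setT (fun u => twisted_derive A k h u * expi (w u)) +
    (0 +i* B k) * cintegral lebn setT (fun u => h u * expi (w u)).
  rewrite -cintegralZl// -cintegralD//; last exact: cintegrableZl.
  by apply: eq_cintegral => u; rewrite /D mulrDl mulrA.
rewrite E0 => /esym/eqP; rewrite addr_eq0 => /eqP ->; rewrite -mulNr.
by congr (_ * _); apply/eqP; rewrite eq_complex /= oppr0 !eqxx.
Qed.

(** Each power of [|B k|] is paid for by one twisted derivative, which is again an admissible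
    amplitude. The bound is uniform in the whole of [B], including its entries away from [k]. *)
Lemma oscillatory_power A k m h : dir_cschwartz k h ->
  exists M : R, forall B, `|B k| ^+ m *
    normc (cintegral lebn setT (fun u => h u * expi (quadratic_phase A B u))) <= M.
Proof.
elim: m h => [|m IH] h hh.
  have [C hC] := dir_cschwartz_le hh.
  have [M hM] := oscillatory_bound (dir_cschwartz_measurable hh) hC; exists M => B.
  by rewrite expr0 mul1r; exact: (hM _ (measurable_quadratic_phase A B)).2.
have [M hM] := IH _ (dir_cschwartz_twisted A hh); exists M => B.
apply: le_trans (hM B); rewrite (oscillatory_parts A B hh) normcM mulrA.
have -> : normc (0 -i* B k) = `|B k| by rewrite normcE /= expr0n add0r sqrrN sqrtr_sqr.
by rewrite -exprSr.
Qed.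

(** With r the largest modulus, every factor 1 + x_i^2 is at most 2 max(1, r^2). The resulting
    degree 2 n in r fixes the number of integrations by parts. *)
Lemma japanese_rV_ge x (k : 'I_n) : (forall i, `|x ord0 i| <= `|x ord0 k|) ->
  (japanese_rV x)^-1 <= 2 ^+ n * (1 + `|x ord0 k| ^+ (2 * n)).
Proof.
move=> hk; set r := `|x ord0 k|.
have r0 : 0 <= r by exact: normr_ge0.
rewrite /japanese_rV -prodfV.
apply: (@le_trans _ _ (\prod_(i < n) (2 * Num.max 1 (r ^+ 2)))).
  apply: ler_prod => i _; rewrite /japanese invrK addr_ge0 ?sqr_ge0//= mulr_natl mulr2n lerD//.
    by rewrite le_max lexx.
  by rewrite le_max -real_normK ?num_real// lerXn2r ?nnegrE ?hk ?orbT.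
rewrite prodr_const card_ord exprMn ler_wpM2l ?exprn_ge0//.
have [h|h] := leP 1 (r ^+ 2).
  by rewrite -exprM lerDr.
by rewrite expr1n lerDl exprn_ge0.
Qed.

Lemma oscillatory_decay A (b : 'I_n -> R) (phi : 'rV[R]_n -> R[i]) : (0 < n)%N ->
  (forall i, b i != 0) -> schwartz phi ->
  exists M : R, forall x, normc (cintegral lebn setT (fun u => phi u *
    expi (quadratic_phase A (fun i => b i * x ord0 i) u))) <= M * japanese_rV x.
Proof.
move=> n0 b0 sphi.
have hphi k : dir_cschwartz k phi := dir_schwartz_schwartz k sphi.
have /choice[M hM] : forall k : 'I_n, exists M : R, forall B, `|B k| ^+ (2 * n) *
    normc (cintegral lebn setT (fun u => phi u * expi (quadratic_phase A B u))) <= M.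
  by move=> k; exact: oscillatory_power.
have [M0 hM0] := oscillatory_power A 0 (hphi (Ordinal n0)).
have M00 : 0 <= M0 by apply: le_trans (hM0 (fun=> 0)); rewrite expr0 mul1r normc_ge0.
have Mk0 k : 0 <= M k.
  by apply: le_trans (hM k (fun=> 0)); rewrite mulr_ge0 ?exprn_ge0 ?normc_ge0.
(* [M0] answers the summand 1 of [japanese_rV_ge]. The maximal coordinate varies with [x], so the
   constants of all coordinates are added. *)
exists (2 ^+ n * (M0 + \sum_k M k / `|b k| ^+ (2 * n))) => x.
set N := normc _; have N0 : 0 <= N by exact: normc_ge0.
have [k _ hk] := @arg_maxP _ _ _ (Ordinal n0) xpredT (fun i => `|x ord0 i|) isT.
have h0 : N <= M0 by have := hM0 (fun i => b i * x ord0 i); rewrite expr0 mul1r.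
have hMk : `|x ord0 k| ^+ (2 * n) * N <= M k / `|b k| ^+ (2 * n).
  rewrite ler_pdivlMr ?exprn_gt0 ?normr_gt0// mulrC mulrA -exprMn -normrM.
  exact: (hM k (fun i => b i * x ord0 i)).
rewrite -ler_pdivrMr ?japanese_rV_gt0//.
apply: (@le_trans _ _ (N * (2 ^+ n * (1 + `|x ord0 k| ^+ (2 * n))))).
  by rewrite ler_wpM2l// japanese_rV_ge// => i; exact: hk.
rewrite mulrCA ler_wpM2l ?exprn_ge0// mulrDr mulr1 lerD// mulrC.
apply: le_trans hMk _; rewrite (bigD1 k)//= lerDl sumr_ge0// => i _.
by rewrite divr_ge0 ?exprn_ge0.
Qed.

End oscillatory_integrals.

(** * Tempered functions *)

Section tempered_functions.
Variables (R : realType) (n : nat).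
Local Notation lebn := (lebesgue_rV R n).
Implicit Types (f g phi psi : 'rV[R]_n -> R[i]) (x : 'rV[R]_n).

Lemma partials_linear (c : R[i]) phi psi s : smooth phi -> smooth psi ->
  partials s (fun x => c * phi x + psi x) =
  (fun x => c * partials s phi x + partials s psi x).
Proof.
move=> sp sq; elim: s => // i s /= ->; apply/funext => x.
have [_ _ /(_ i x)[pR pI]] := sp s; have [_ _ /(_ i x)[qR qI]] := sq s.
have d1 := is_derive_linear (complex.Re c) (derivableP pR)
  (is_derive_linear (- complex.Im c) (derivableP pI) (derivableP qR)).
have d2 := is_derive_linear (complex.Re c) (derivableP pI)
  (is_derive_linear (complex.Im c) (derivableP pR) (derivableP qI)).
rewrite /partial; set u := partials s phi; set v := partials s psi.
have -> : (fun y => complex.Re (c * u y + v y)) = fun y =>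
    complex.Re c * complex.Re (u y) + (- complex.Im c * complex.Im (u y) + complex.Re (v y)).
  by apply/funext => y; rewrite Re_add Re_mul addrA mulNr.
have -> : (fun y => complex.Im (c * u y + v y)) = fun y =>
    complex.Re c * complex.Im (u y) + (complex.Im c * complex.Re (u y) + complex.Im (v y)).
  by apply/funext => y; rewrite Im_add Im_mul addrA.
rewrite (@derive_val _ _ _ _ _ _ _ d1) (@derive_val _ _ _ _ _ _ _ d2).
case: (c) => a b; apply/eqP; rewrite eq_complex /=.
by apply/andP; split; apply/eqP; ring.
Qed.

Lemma schwartz_linear (c : R[i]) phi psi : schwartz phi -> schwartz psi ->
  schwartz (fun x => c * phi x + psi x).
Proof.
move=> hp hq; have [sp _] := hp; have [sq _] := hq; split.
  move=> s; rewrite partials_linear//.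
  have [pR pI dp] := sp s; have [qR qI dq] := sq s.
  set u := partials s phi; set v := partials s psi.
  have ER : (fun y => complex.Re (c * u y + v y)) = fun y =>
    complex.Re c * complex.Re (u y) + (- complex.Im c * complex.Im (u y) + complex.Re (v y)).
    by apply/funext => y; rewrite Re_add Re_mul addrA mulNr.
  have EI : (fun y => complex.Im (c * u y + v y)) = fun y =>
    complex.Re c * complex.Im (u y) + (complex.Im c * complex.Re (u y) + complex.Im (v y)).
    by apply/funext => y; rewrite Im_add Im_mul addrA.
  split.
  - rewrite ER => x; exact: (cvgD (cvgM (cvg_cst (complex.Re c)) (pR x))
      (cvgD (cvgM (cvg_cst (- complex.Im c)) (pI x)) (qR x))).
  - rewrite EI => x; exact: (cvgD (cvgM (cvg_cst (complex.Re c)) (pI x))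
      (cvgD (cvgM (cvg_cst (complex.Im c)) (pR x)) (qI x))).
  - move=> i x; rewrite ER EI; have [dpR dpI] := dp i x; have [dqR dqI] := dq i x.
    split.
    + by have [] := is_derive_linear (complex.Re c) (derivableP dpR)
        (is_derive_linear (- complex.Im c) (derivableP dpI) (derivableP dqR)).
    + by have [] := is_derive_linear (complex.Re c) (derivableP dpI)
        (is_derive_linear (complex.Im c) (derivableP dpR) (derivableP dqI)).
move=> a b; have [C hC] := schwartz_monomial_le a b hp.
have [D hD] := schwartz_monomial_le a b hq.
apply: (@le_lt_trans _ _ (normc c * C + D)%:E); last by rewrite ltry.
apply: ge_ereal_sup => _ [x _ <-]; rewrite lee_fin /multi_partial partials_linear//.
rewrite normc_realM; apply: le_trans (ler_wpM2l (normr_ge0 _) (le_normcD _ _)) _.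
by rewrite mulrDr normcM lerD// mulrCA ler_wpM2l ?normc_ge0.
Qed.

Lemma schwartz_measurable phi : schwartz phi -> cmeasurable phi.
Proof.
by move=> [/(_ [::])[cR cI _] _]; split; exact: continuous_measurable_fun_rV.
Qed.

Lemma monomial0 x : monomial (fun=> 0%N) x = 1.
Proof. by rewrite /monomial big1// => i _; rewrite expr0. Qed.

Lemma multi_partial0 phi : multi_partial (fun=> 0%N) phi = phi.
Proof. by rewrite /multi_partial; elim: (enum 'I_n) => //= i s. Qed.

(** The inverse weight has 2^n monomials of order at most 2 n; hence finitely many seminorms, none
    involving derivatives, control the weighted supremum linearly in [delta]. *)
Lemma schwartz_weight_le phi (delta : R) x :
  (forall a, (multi_order a <= 2 * n)%N ->
     (schwartz_seminorm a (fun=> 0%N) phi <= delta%:E)%E) ->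
  normc (phi x) <= (#|{ffun 'I_n -> bool}|%:R * delta) * japanese_rV x.
Proof.
move=> h; have := @weight_bound R n (fun=> 0%N) (fun=> delta) x (normc (phi x)) (normc_ge0 _).
rewrite monomial0 normr1 mul1r sumr_const mulr_natl; apply=> f.
set a := weight_exponent _ f.
have ha : (multi_order a <= 2 * n)%N.
  rewrite /multi_order mulnC -[X in (_ <= X * _)%N]card_ord -sum_nat_const.
  by apply: leq_sum => i _; rewrite /a /weight_exponent addn0; case: (f i).
rewrite -lee_fin; apply: le_trans (h a ha).
by apply: ereal_sup_ubound; exists x => //; rewrite multi_partial0 normc_realM.
Qed.

Lemma schwartz_japanese_le phi : schwartz phi ->
  exists C : R, forall x, normc (phi x) <= C * japanese_rV x.
Proof.
move=> sphi; have /choice[B hB] : forall f : {ffun 'I_n -> bool}, exists C : R, forall x,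
    `|monomial (weight_exponent (fun=> 0%N) f) x| *
      normc (multi_partial (fun=> 0%N) phi x) <= C.
  by move=> f; exact: schwartz_monomial_le.
exists (\sum_f B f) => x.
have := @weight_bound R n (fun=> 0%N) B x (normc (phi x)) (normc_ge0 _).
by rewrite monomial0 normr1 mul1r; apply=> f; have := hB f x; rewrite multi_partial0.
Qed.

Lemma japanese_rV_locally K : compact K ->
  exists c : R, 0 < c /\ forall x : 'rV[R]_n, K x -> c <= japanese_rV x.
Proof.
move=> /compact_bounded[M [_ hM]].
pose B := `|M| + 1.
have hB x : K x -> `|x| <= B.
  by apply: hM; rewrite /B (le_lt_trans (ler_norm _))// ltrDl.
exists (\prod_(i < n) (1 + B ^+ 2)^-1); split.
  by apply: prodr_gt0 => i _; rewrite invr_gt0 ltr_pwDl// sqr_ge0.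
move=> x Kx; apply: ler_prod => i _; rewrite invr_ge0 addr_ge0 ?sqr_ge0//=.
rewrite /japanese lef_pV2 ?posrE ?ltr_pwDl ?sqr_ge0// lerD2l.
rewrite -real_normK ?num_real// lerXn2r ?nnegrE//.
  by rewrite /B addr_ge0.
apply: le_trans (hB x Kx).
rewrite [leRHS](_ : _ = mx_norm x)// mx_normrE.
by apply/bigmax_geP; right => /=; exists (ord0, i).
Qed.

(** All three requirements come from the weight: it is bounded below on compact sets, it dominates
    Schwartz functions, and the pairing with [g] is continuous for the weighted supremum, which
    [schwartz_weight_le] controls by seminorms. *)
Lemma tempered_function_weighted g : cmeasurable g ->
  lebn.-integrable setT (EFin \o (fun x => normc (g x) * japanese_rV x)) ->
  tempered_function g.
Proof.
move=> mg ig; have mn := measurable_normc mg.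
have iphi phi : schwartz phi -> cintegrable lebn setT (fun x => g x * phi x).
  move=> sphi; have [C hC] := schwartz_japanese_le sphi.
  apply: (@cintegrable_le _ _ _ _ _ (fun x => C * (normc (g x) * japanese_rV x))).
  - by apply: cmeasurableM => //; exact: schwartz_measurable.
  - by apply: eq_integrable (integrableZl measurableT C ig).
  - by move=> x; rewrite normcM mulrCA ler_wpM2l ?normc_ge0.
have G0 : 0 <= \int[lebn]_x (normc (g x) * japanese_rV x).
  by apply: Rintegral_ge0 => x _; rewrite mulr_ge0 ?normc_ge0 ?japanese_rV_ge0.
split => //.
- move=> K cK; have mK := compact_measurable_rV cK.
  have [c [c0 hc]] := japanese_rV_locally cK.
  have iK := integrableZl mK c^-1 (integrableS measurableT mK (@subsetT _ K) ig).
  have gc x : K x -> normc (g x) <= c^-1 * (normc (g x) * japanese_rV x).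
    move=> Kx; rewrite mulrCA ler_peMr ?normc_ge0//.
    by rewrite mulrC ler_pdivlMr// mul1r hc.
  split; apply: le_integrable iK => //.
  + by apply/measurable_EFinP; apply: measurable_funTS; exact: mg.1.
  + move=> x Kx /=; rewrite lee_fin (le_trans (normRe_le _))//.
    by rewrite (le_trans (gc x Kx))// ler_norm.
  + by apply/measurable_EFinP; apply: measurable_funTS; exact: mg.2.
  + move=> x Kx /=; rewrite lee_fin (le_trans (normIm_le _))//.
    by rewrite (le_trans (gc x Kx))// ler_norm.
- split.
    move=> c phi psi sp sq; rewrite /distribution_of.
    rewrite -cintegralZl; last exact: iphi.
    rewrite -cintegralD; [|by apply: cintegrableZl; exact: iphi|exact: iphi].
    by apply: eq_cintegral => x; rewrite mulrDr mulrCA.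
  move=> phi sphi e e0.
  pose B : R := #|{ffun 'I_n -> bool}|%:R.
  pose G := \int[lebn]_x (normc (g x) * japanese_rV x).
  have BG : 0 < 2 * (B * G) + 1.
    by rewrite ltr_wpDl// mulr_ge0// mulr_ge0// ler0n.
  (* The pairing changes by at most 2 B delta G, with the 2 of [normc_cintegral_le]. The added 1
     makes this strictly less than [e], also when [G] vanishes. *)
  exists (2 * n)%N, (e / (2 * (B * G) + 1)); split; first by rewrite divr_gt0.
  move=> psi spsi hsmall; set delta := e / _ in hsmall *.
  have d0 : 0 < delta by rewrite divr_gt0.
  have dE : distribution_of g psi - distribution_of g phi =
      cintegral lebn setT (fun x => g x * (psi x - phi x)).
    rewrite /distribution_of -mulN1r -cintegralZl; last exact: iphi.
    rewrite -cintegralD; [|exact: iphi|by apply: cintegrableZl; exact: iphi].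
    by apply: eq_cintegral => x; rewrite mulN1r mulrBr.
  have idiff : cintegrable lebn setT (fun x => g x * (psi x - phi x)).
    have := cintegrableD (iphi _ spsi) (cintegrableZl (-1) (iphi _ sphi)).
    by under eq_fun do rewrite mulN1r -mulrBr.
  rewrite dE; apply: (@le_lt_trans _ _ (2 * (B * delta * G))).
    apply: (@normc_cintegral_le _ _ _ _ _
      (fun x => (B * delta) * (normc (g x) * japanese_rV x))) => //.
    + by apply: eq_integrable (integrableZl measurableT (B * delta) ig).
    + move=> x; rewrite normcM mulrCA ler_wpM2l ?normc_ge0//.
      apply: (@schwartz_weight_le (fun y => psi y - phi y)) => a ha.
      by apply/ltW/hsmall => //; rewrite /multi_order big1.
    + by rewrite RintegralZl.
  have -> : 2 * (B * delta * G) = e * (2 * (B * G) / (2 * (B * G) + 1)).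
    by rewrite /delta; field; rewrite gt_eqF.
  by rewrite gtr_pMr// ltr_pdivrMr// mul1r ltrDl.
Qed.

(** This is how the distribution defined by duality becomes tempered: it inherits the property from
    the explicit right-hand side once the two are known to agree. *)
Lemma tempered_eq (v w : ('rV[R]_n -> R[i]) -> R[i]) : tempered w ->
  (forall phi, schwartz phi -> v phi = w phi) -> tempered v.
Proof.
move=> [wlin wcont] vw; split.
  move=> c phi psi sp sq; rewrite !vw//; first exact: wlin.
  exact: schwartz_linear.
move=> phi sphi e e0; have [N [delta [d0 h]]] := wcont _ sphi _ e0.
exists N, delta; split=> // psi spsi hs; rewrite !vw//; exact: h.
Qed.

End tempered_functions.

(** * The Fourier transform of the Riesz kernel *)

Section riesz_fourier.
Variables (R : realType) (n : nat).
Local Notation leb := (@lebesgue_measure R).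
Local Notation lebn := (lebesgue_rV R n).
Implicit Types (x y u : 'rV[R]_n) (d : 'I_n -> R) (s t : R) (Phi : 'rV[R]_n -> R[i]).

(** A point lies in the hyperplane that fixes its first coordinate, a null set. In dimension 0 the
    measure is a Dirac mass and the claim is false. *)
Lemma ae_neq_rV y : (0 < n)%N -> {ae lebn, forall x, x != y}.
Proof.
case: n y => [//|m] y _.
pose N : set 'rV[R]_m.+1 := [set x | x ord0 ord0 = y ord0 ord0].
have mN : measurable N.
  have := @measurable_rV_entry R m.+1 ord0 measurableT [set y ord0 ord0] (measurable_set1 _).
  by rewrite setTI.
exists N; split => //; last by move=> x /= /negP; rewrite negbK => /eqP ->.
rewrite /= /pushforward.
have -> : @cons_rV R m @^-1` N = [set (y ord0 ord0 : R)] `*` setT.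
  apply/seteqP; split => [[a z]|[a z]] /=; rewrite /N /= cons_rV0 //=.
  by move=> [].
by rewrite product_measure1E// [X in (X * _)%E](lebesgue_measure_set1 (y ord0 ord0 : R)) mul0e.
Qed.

(** Off the diagonal this is an equality. On it the negative power of 0 is 0 by convention, so the
    inequality survives and can be used at every point. *)
Lemma riesz_kernel_le d s x y : 0 < s -> (forall i, d i != 0) ->
  ((Gamma s * sqdist d x y `^ (- s))%:E <=
   \int[leb]_t (hpow s t * heat d t x y)%:E)%E.
Proof.
move=> s0 d0; have [->|xy] := eqVneq x y.
  rewrite (_ : sqdist d y y = 0); last first.
    by apply: big1 => i _; rewrite subrr mulr0 expr0n.
  rewrite powR0 ?oppr_eq0 ?gt_eqF// mulr0; apply: integral_ge0 => t _.
  by rewrite lee_fin mulr_ge0 ?hpow_ge0 ?heat_ge0.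
have [i E] := integral_hpow_expR s0 (sqdist_gt0 d0 xy).
by rewrite -E /Rintegral fineK//; exact: integrable_fin_num i.
Qed.

Lemma measurable_riesz dT (T : measurableType dT) d s (p q : T -> 'rV[R]_n) :
  measurable_fun setT p -> measurable_fun setT q ->
  measurable_fun setT (fun z => sqdist d (p z) (q z) `^ (- s)).
Proof.
move=> mp mq; apply: (measurableT_comp (measurable_powR (- s))).
exact: measurable_sqdist.
Qed.

Lemma integral_japanese_riesz_kernel d s :
  0 < s -> s < n%:R / 2 -> (forall i, d i != 0) ->
  exists C : R, 0 <= C /\ forall y,
  (\int[lebn]_x (japanese_rV x * sqdist d x y `^ (- s))%:E <= C%:E)%E.
Proof.
move=> s0 sn d0; have [C [C0 hC]] := integral_japanese_riesz s0 sn d0.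
have G0 := Gamma_gt0 s0.
exists ((Gamma s)^-1 * C); split; first by rewrite mulr_ge0// invr_ge0 ltW.
move=> y; rewrite EFinM; apply: le_trans (lee_wpmul2l _ (hC y)); last first.
  by rewrite lee_fin invr_ge0 ltW.
have mH : measurable_fun setT (fun z : 'rV[R]_n * R => hpow s z.2 * heat d z.2 z.1 y).
  apply: measurable_funM.
    exact: (measurableT_comp (@measurable_hpow R s) measurable_snd).
  exact: measurable_heat.
have mF : measurable_fun setT
    (fun x => \int[leb]_t (japanese_rV x * (hpow s t * heat d t x y))%:E)%E.
  apply: (measurable_fun_fubini_tonelli_F (m2 := leb)
    (fun z : 'rV[R]_n * R => (japanese_rV z.1 * (hpow s z.2 * heat d z.2 z.1 y))%:E)).
    apply/measurable_EFinP; apply: measurable_funM => //.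
    exact: (measurableT_comp (@measurable_japanese_rV R n) measurable_fst).
  by move=> z; rewrite lee_fin mulr_ge0 ?japanese_rV_ge0// mulr_ge0 ?hpow_ge0 ?heat_ge0.
have F0 x : (0 <= \int[leb]_t (japanese_rV x * (hpow s t * heat d t x y))%:E)%E.
  apply: integral_ge0 => t _.
  by rewrite lee_fin mulr_ge0 ?japanese_rV_ge0// mulr_ge0 ?hpow_ge0 ?heat_ge0.
rewrite -ge0_integralZl; [|exact: measurableT|exact: mF|by move=> x _; exact: F0|
  by rewrite lee_fin invr_ge0 ltW].
apply: ge0_le_integral => //.
- by move=> x _; rewrite lee_fin mulr_ge0 ?japanese_rV_ge0 ?powR_ge0.
- apply/measurable_EFinP; apply: measurable_funM; first exact: measurable_japanese_rV.
  exact: measurable_riesz.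
- by apply: emeasurable_funM.
move=> x _; under eq_integral do rewrite EFinM.
have mHx : measurable_fun setT (fun t => (hpow s t * heat d t x y)%:E).
  apply/measurable_EFinP; apply: measurable_funM; first exact: measurable_hpow.
  by apply: measurable_heat.
have H0 t : setT t -> (0 <= (hpow s t * heat d t x y)%:E)%E.
  by rewrite lee_fin mulr_ge0 ?hpow_ge0 ?heat_ge0.
rewrite ge0_integralZl; [|exact: measurableT|exact: mHx|exact: H0|
  by rewrite lee_fin japanese_rV_ge0].
rewrite muleCA EFinM lee_wpmul2l ?lee_fin ?japanese_rV_ge0//.
rewrite -[X in (X%:E <= _)%E](mulKf (lt0r_neq0 G0)) EFinM lee_wpmul2l//.
  by rewrite lee_fin invr_ge0 ltW.
exact: riesz_kernel_le.
Qed.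

(** For [d] the vector of cosecants, this is the Fourier kernel at the frequency [tilde u], that is,
    [frft_kernel] without its constant and its chirps. *)
Definition plane_wave d u x : R[i] :=
  expi (- (2 * pi * \sum_i x ord0 i * u ord0 i * d i)).

Lemma plane_waveC d u x : plane_wave d u x = plane_wave d x u.
Proof.
by rewrite /plane_wave; congr (expi (- (_ * _))); apply: eq_bigr => i _; rewrite [X in X * _]mulrC.
Qed.

Lemma measurable_phase dT (T : measurableType dT) d (p q : T -> 'rV[R]_n) :
  measurable_fun setT p -> measurable_fun setT q ->
  measurable_fun setT (fun z => - (2 * pi * \sum_i p z ord0 i * q z ord0 i * d i)).
Proof.
move=> mp mq; apply: measurableT_comp => //; apply: measurable_funM => //.
apply: (@measurable_sum _ _ _ _ _ _
  (fun i z => p z ord0 i * q z ord0 i * d i)) => i.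
apply: measurable_funM => //; apply: measurable_funM.
- exact: (measurableT_comp (@measurable_rV_entry R n i) mp).
- exact: (measurableT_comp (@measurable_rV_entry R n i) mq).
Qed.

Lemma cmeasurable_plane_wave dT (T : measurableType dT) d (p q : T -> 'rV[R]_n) :
  measurable_fun setT p -> measurable_fun setT q ->
  cmeasurable (fun z => plane_wave d (p z) (q z)).
Proof. by move=> mp mq; apply: cmeasurable_expi; exact: measurable_phase. Qed.

Lemma cintegral_heat_plane_wave d t y u : 0 < t ->
  cintegrable lebn setT (fun x => (heat (fun=> 1) t x y)%:C * plane_wave d u x) /\
  cintegral lebn setT (fun x => (heat (fun=> 1) t x y)%:C * plane_wave d u x) =
  (pi `^ (n%:R / 2) * t `^ (- (n%:R / 2)) * expR (- (pi ^+ 2 * sqdist d u 0 / t)))%:C *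
  plane_wave d u y.
Proof.
(* The frequency of each tensor factor; xi_i^2 / (4 t) = pi^2 (d_i u_i)^2 / t accounts for the
   exponent of the result. *)
move=> t0; pose xi i := - (2 * pi * (u ord0 i * d i)).
pose h i r := (gaussian t (y ord0 i) r)%:C * expi (xi i * r).
have wE x : plane_wave d u x = \prod_i expi (xi i * x ord0 i).
  rewrite /plane_wave -expi_sum; congr expi; rewrite mulr_sumr -sumrN.
  by apply: eq_bigr => i _; rewrite /xi; ring.
have hE x : (heat (fun=> 1) t x y)%:C * plane_wave d u x = \prod_i h i (x ord0 i).
  rewrite heat_tensor wE rmorph_prod -big_split/=; apply: eq_bigr => i _.
  by rewrite /h expr1n mulr1.
have [ih E] := cintegral_tensor (fun i => (cintegral_gaussian (y ord0 i) (xi i) t0).1).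
have hfun : (fun x : 'rV[R]_n => (heat (fun=> 1) t x y)%:C * plane_wave d u x) =
    (fun x => \prod_i h i (x ord0 i)) by apply/funext.
rewrite hfun; split=> //; rewrite {}E.
under eq_bigr => i _ do rewrite (cintegral_gaussian (y ord0 i) (xi i) t0).2.
rewrite big_split/= -wE -rmorph_prod; congr (_%:C * _).
rewrite big_split/= prodr_const card_ord; congr (_ * _).
  have -> : Num.sqrt (pi / t) = pi `^ 2^-1 * t `^ (- 2^-1).
    by rewrite sqrtrM ?pi_ge0// sqrtrV ?ltW// powRN !powR12_sqrt ?pi_ge0 ?ltW.
  rewrite exprMn -!powR_mulrn ?powR_ge0// -!powRrM mulNr.
  by rewrite [2^-1 * _]mulrC.
rewrite -expR_sum; congr expR; rewrite sumrN; congr (- _).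
rewrite /sqdist mulr_sumr mulr_suml; apply: eq_bigr => i _.
by rewrite mxE subr0 /xi; field; rewrite gt_eqF.
Qed.

End riesz_fourier.

Section riesz_fourier_core.
Variables (R : realType) (n : nat).
Local Notation leb := (@lebesgue_measure R).
Local Notation lebn := (lebesgue_rV R n).
Local Notation one := (fun _ : 'I_n => 1 : R).
Implicit Types (x y u : 'rV[R]_n) (d : 'I_n -> R) (s b t : R) (Phi : 'rV[R]_n -> R[i]).

Lemma measurable_japanese_rV_inv : measurable_fun setT (fun x => (japanese_rV x)^-1 : R).
Proof.
rewrite (_ : (fun x => _) = fun x : 'rV[R]_n => \prod_i (1 + x ord0 i ^+ 2)).
  apply: (@measurable_prod _ _ _ _ _ _ (fun i (x : 'rV[R]_n) => 1 + x ord0 i ^+ 2)).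
  move=> i _; apply: measurable_funD => //; apply: measurable_funX.
  exact: measurable_rV_entry.
by apply/funext => x; rewrite /japanese_rV -prodfV; apply: eq_bigr => i _; rewrite invrK.
Qed.

Lemma japanese_integrable (C : R) :
  lebn.-integrable setT (EFin \o (fun u => C * japanese_rV u)).
Proof.
by apply: eq_integrable (integrableZl measurableT C (integrable_japanese_rV R n)).
Qed.

(** Fubini's theorem supplies measurability, but [k] is merely bounded in [x]. It is therefore
    multiplied by the weight in [x], and the positive weight is divided out of the integral
    afterwards. *)
Lemma cmeasurable_parametric (k : 'rV[R]_n * 'rV[R]_n -> R[i]) (C : R) :
  cmeasurable k -> (forall x u, normc (k (x, u)) <= C * japanese_rV u) ->
  cmeasurable (fun x => cintegral lebn setT (fun u => k (x, u))).
Proof.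
move=> mk kC.
have kx x : cintegrable lebn setT (fun u => k (x, u)).
  apply: (cintegrable_le _ (japanese_integrable C)) => //.
  exact: (cmeasurable_comp (pair1_measurable x) mk).
pose k' (z : 'rV[R]_n * 'rV[R]_n) := (japanese_rV z.1)%:C * k z.
have ik' : cintegrable (lebn \x lebn)%E setT k'.
  apply: (cintegrable_tensor _ (integrable_japanese_rV R n) (japanese_integrable C)).
    apply: cmeasurableM => //; apply: cmeasurable_real.
    exact: (measurableT_comp (@measurable_japanese_rV R n) measurable_fst).
  move=> x u; rewrite normc_realM ger0_norm ?japanese_rV_ge0//.
  by rewrite ler_wpM2l ?japanese_rV_ge0.
have [/cintegrable_cmeasurable h _ _] := cfubini ik'.
have -> : (fun x => cintegral lebn setT (fun u => k (x, u))) =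
    (fun x => ((japanese_rV x)^-1)%:C *
      cintegral lebn setT (fun u => k' (x, u))).
  apply/funext => x; rewrite /k' /= cintegralZl// mulrA -rmorphM/=.
  by rewrite mulVf ?mul1r// gt_eqF// japanese_rV_gt0.
by apply: cmeasurableM => //; apply: cmeasurable_real; exact: measurable_japanese_rV_inv.
Qed.

Lemma riesz_japanese_integrable d s y : 0 < s -> s < n%:R / 2 -> (forall i, d i != 0) ->
  lebn.-integrable setT (EFin \o (fun x => japanese_rV x * sqdist d x y `^ (- s))).
Proof.
move=> s0 sn d0; have [C [C0 hC]] := integral_japanese_riesz_kernel s0 sn d0.
apply/integrableP; split.
  apply/measurable_EFinP; apply: measurable_funM; first exact: measurable_japanese_rV.
  exact: measurable_riesz.
under eq_integral do rewrite /= ger0_norm ?mulr_ge0 ?japanese_rV_ge0 ?powR_ge0//.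
by rewrite (le_lt_trans (hC y))// ltry.
Qed.

Lemma cintegrable_riesz d s y h (C : R) : 0 < s -> s < n%:R / 2 ->
  (forall i, d i != 0) -> cmeasurable h ->
  (forall x, normc (h x) <= C * japanese_rV x) ->
  cintegrable lebn setT (fun x => (sqdist d x y `^ (- s))%:C * h x).
Proof.
move=> s0 sn d0 mh hC.
have i := integrableZl measurableT C (riesz_japanese_integrable y s0 sn d0).
apply: (@cintegrable_le _ _ _ _ _ (fun x => C * (japanese_rV x * sqdist d x y `^ (- s)))).
- by apply: cmeasurableM => //; apply: cmeasurable_real; exact: measurable_riesz.
- exact: eq_integrable i.
- move=> x; rewrite normc_realM ger0_norm ?powR_ge0// mulrA mulrC.
  by rewrite ler_wpM2r ?powR_ge0.
Qed.

Lemma heat_japanese_integrable d s y : 0 < s -> s < n%:R / 2 -> (forall i, d i != 0) ->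
  cintegrable (lebn \x leb)%E setT (fun z : 'rV[R]_n * R =>
    (japanese_rV z.1 * (hpow s z.2 * heat d z.2 z.1 y))%:C).
Proof.
move=> s0 sn d0; have [C [C0 hC]] := integral_japanese_riesz s0 sn d0.
apply: cintegrable_prod1.
  apply: cmeasurable_real; apply: measurable_funM.
    exact: (measurableT_comp (@measurable_japanese_rV R n) measurable_fst).
  apply: measurable_funM.
    exact: (measurableT_comp (@measurable_hpow R s) measurable_snd).
  exact: measurable_heat.
apply: (@le_lt_trans _ _ C%:E); last by rewrite ltry.
apply: le_trans (hC y); rewrite le_eqVlt; apply/orP; left; apply/eqP.
apply: eq_integral => x _; apply: eq_integral => t _.
by rewrite normc_real ger0_norm// mulr_ge0 ?japanese_rV_ge0// mulr_ge0 ?hpow_ge0 ?heat_ge0.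
Qed.

(** * Duality of the kernels with exponents s and b, where s + b = n / 2 *)

Section fourier_transform.
Variables (d : 'I_n -> R) (s b : R) (Phi : 'rV[R]_n -> R[i]) (C M : R).
Hypotheses (n0 : (0 < n)%N) (d0 : forall i, d i != 0) (s0 : 0 < s) (b0 : 0 < b).
Hypothesis sb : s + b = n%:R / 2.
Hypotheses (mPhi : cmeasurable Phi) (PhiC : forall u, normc (Phi u) <= C * japanese_rV u).
Let G x := cintegral lebn setT (fun u => Phi u * plane_wave d u x).
Hypothesis GM : forall x, normc (G x) <= M * japanese_rV x.

Let sn : s < n%:R / 2. Proof. by rewrite -sb ltrDl. Qed.
Let bn : b < n%:R / 2. Proof. by rewrite -sb ltrDr. Qed.
Let one0 (i : 'I_n) : one i != 0. Proof. exact: oner_neq0. Qed.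

Lemma fourier_cmeasurable : cmeasurable G.
Proof.
apply: (@cmeasurable_parametric (fun z => Phi z.2 * plane_wave d z.2 z.1) C).
  apply: cmeasurableM; first exact: (cmeasurable_comp measurable_snd mPhi).
  exact: cmeasurable_plane_wave.
by move=> x u; rewrite normcM normc_expi mulr1.
Qed.

(** The multiplication formula. At fixed positive [t] the Gaussian is integrable in [x], so the
    integrand is dominated by a tensor product and Fubini applies. *)
Lemma heat_fourier y t : 0 < t ->
  cintegral lebn setT (fun x => (heat one t x y)%:C * G x) =
  cintegral lebn setT (fun u =>
    (pi `^ (n%:R / 2) * t `^ (- (n%:R / 2)) *
     expR (- (pi ^+ 2 * sqdist d u 0 / t)))%:C * (Phi u * plane_wave d u y)).
Proof.
move=> t0; pose k2 (z : 'rV[R]_n * 'rV[R]_n) :=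
  (heat one t z.1 y)%:C * (Phi z.2 * plane_wave d z.2 z.1).
have mPw x : cmeasurable (fun u => Phi u * plane_wave d u x).
  by apply: cmeasurableM => //; exact: cmeasurable_plane_wave.
have iPw x : cintegrable lebn setT (fun u => Phi u * plane_wave d u x).
  apply: (cintegrable_le _ (japanese_integrable C)) => // u.
  by rewrite normcM normc_expi mulr1.
have iheat : lebn.-integrable setT (EFin \o (fun x => heat one t x y)).
  have [+ _] := (cintegral_heat_plane_wave d y 0 t0).
  move=> /cintegrable_normc; apply: eq_integrable => // x _.
  by rewrite /comp normcM normc_expi mulr1 normc_real ger0_norm ?heat_ge0.
have ik2 : cintegrable (lebn \x lebn)%E setT k2.
  apply: (cintegrable_tensor _ iheat (japanese_integrable C)).
    apply: cmeasurableM; first by apply: cmeasurable_real; exact: measurable_heat.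
    apply: cmeasurableM; first exact: (cmeasurable_comp measurable_snd mPhi).
    exact: cmeasurable_plane_wave.
  move=> x u; rewrite /k2 !normcM normc_expi mulr1 normc_real.
  by rewrite ger0_norm ?heat_ge0// ler_wpM2l ?heat_ge0.
have [_ _ E2] := cfubini ik2.
transitivity (cintegral lebn setT (fun x => cintegral lebn setT (fun u => k2 (x, u)))).
  by apply: eq_cintegral => x; rewrite /k2 /= cintegralZl.
rewrite E2; apply: eq_cintegral => u.
have [ihp hpE] := cintegral_heat_plane_wave d y u t0.
have -> : (fun x => k2 (x, u)) =
    (fun x => Phi u * ((heat one t x y)%:C * plane_wave d u x)).
  by apply/funext => x; exact: mulrCA.
rewrite (cintegralZl (Phi u) ihp) hpE; exact: mulrCA.
Qed.

(** The integrals of [k1] and [k3] are each exchanged by Fubini, and [heat_fourier] identifies the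
    inner ones at fixed [t]. The hypothesis [GM] makes [k1] integrable; the integrability of [k3] is
    that of the kernel with exponent [b]. *)
Lemma riesz_fourier y :
  (Gamma s)%:C * cintegral lebn setT (fun x => (sqdist one x y `^ (- s))%:C * G x) =
  (pi `^ (n%:R / 2) * (Gamma b * pi `^ (- (2 * b))))%:C *
  cintegral lebn setT (fun u =>
    (sqdist d u 0 `^ (- b))%:C * (Phi u * plane_wave d u y)).
Proof.
have mG := fourier_cmeasurable.
have mPw : cmeasurable (fun u => Phi u * plane_wave d u y).
  by apply: cmeasurableM => //; exact: cmeasurable_plane_wave.
have PwC u : normc (Phi u * plane_wave d u y) <= C * japanese_rV u.
  by rewrite normcM normc_expi mulr1.
have iG := cintegrable_riesz y s0 sn one0 mG GM.
have iPhi := cintegrable_riesz 0 b0 bn d0 mPw PwC.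
rewrite -cintegralZl// -[RHS]cintegralZl//.
pose k1 (z : 'rV[R]_n * R) := (hpow s z.2 * heat one z.2 z.1 y)%:C * G z.1.
have mk1 : cmeasurable k1.
  apply: cmeasurableM; last exact: (cmeasurable_comp measurable_fst mG).
  apply: cmeasurable_real; apply: measurable_funM.
    exact: (measurableT_comp (@measurable_hpow R s) measurable_snd).
  exact: measurable_heat.
have ik1 : cintegrable (lebn \x leb)%E setT k1.
  have i0 := cintegrable_normc (heat_japanese_integrable y s0 sn one0).
  have iM := integrableZl measurableT M i0.
  apply: (@cintegrable_le _ _ _ (lebn \x leb)%E k1 (fun z : 'rV[R]_n * R => M * normc
    (japanese_rV z.1 * (hpow s z.2 * heat one z.2 z.1 y))%:C)) => //.
  move=> z; rewrite /k1 normc_realM [X in _ <= _ * X]normc_real [X in _ <= _ * X]normrM.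
  rewrite (ger0_norm (japanese_rV_ge0 z.1)) mulrA mulrC ler_wpM2r//.
have [/cintegrable_cmeasurable m1 _ E1] := cfubini ik1.
(* The integrand once the Gaussians are transformed: t^(s-1) t^(-n/2) = t^(-b-1), because s + b = n
   / 2. *)
pose k3 (z : 'rV[R]_n * R) := (pi `^ (n%:R / 2) *
  (hpow (- b) z.2 * expR (- (pi ^+ 2 * sqdist d z.1 0 / z.2))))%:C *
  (Phi z.1 * plane_wave d z.1 y).
have pS u : u != 0 -> 0 < pi ^+ 2 * sqdist d u 0.
  by move=> u0; rewrite mulr_gt0 ?exprn_gt0 ?pi_gt0// sqdist_gt0.
have k3E u : u != 0 -> cintegrable leb setT (fun t => k3 (u, t)) /\
    cintegral leb setT (fun t => k3 (u, t)) =
    (pi `^ (n%:R / 2) * (Gamma b * pi `^ (- (2 * b))))%:C *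
    ((sqdist d u 0 `^ (- b))%:C * (Phi u * plane_wave d u y)).
  move=> u0; have [i E] := integral_hpow_expRV b0 (pS u u0).
  have ci := cintegrable_real i.
  have -> : (fun t => k3 (u, t)) = (fun t => ((pi `^ (n%:R / 2))%:C *
      (Phi u * plane_wave d u y)) *
      (hpow (- b) t * expR (- (pi ^+ 2 * sqdist d u 0 / t)))%:C).
    by apply/funext => t; rewrite /k3 /= rmorphM/= mulrAC.
  split; first exact: cintegrableZl.
  rewrite cintegralZl// cintegral_real E.
  rewrite powRM ?exprn_ge0 ?pi_ge0 ?sqdist_ge0//.
  have -> : (pi ^+ 2 : R) `^ (- b) = pi `^ (- (2 * b)).
    by rewrite -powR_mulrn ?pi_ge0// -powRrM mulrN.
  rewrite !rmorphM/=; ring.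
have mk3 : cmeasurable k3.
  (* Division by [t] is traded for the measurable power -1. They agree for positive [t], and [hpow]
     vanishes for all other [t]. *)
  have -> : k3 = fun z => (pi `^ (n%:R / 2) * (hpow (- b) z.2 *
      expR (- (pi ^+ 2 * sqdist d z.1 0 * z.2 `^ (-1)))))%:C *
      (Phi z.1 * plane_wave d z.1 y).
    apply/funext => -[u t]; rewrite /k3 /= /hpow; case: ifP => [t0|_].
      by rewrite powR_inv1 ?ltW.
    by rewrite !mul0r.
  apply: cmeasurableM; last exact: (cmeasurable_comp measurable_fst mPw).
  apply: cmeasurable_real; apply: measurable_funM => //; apply: measurable_funM.
    exact: (measurableT_comp (@measurable_hpow R (- b)) measurable_snd).
  apply: measurableT_comp => //; apply: measurableT_comp => //.
  apply: measurable_funM; last first.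
    exact: (measurableT_comp (measurable_powR (-1)) measurable_snd).
  by apply: measurable_funM => //; exact: measurable_sqdist.
have ik3 : cintegrable (lebn \x leb)%E setT k3.
  apply: cintegrable_prod1 => //.
  pose K := pi `^ (n%:R / 2) * (Gamma b * pi `^ (- (2 * b))) * C.
  have iK := integrableZl measurableT K (riesz_japanese_integrable 0 b0 bn d0).
  apply: le_lt_trans (integrable_lty measurableT iK).
  apply: ae_ge0_le_integral => //.
  - by move=> u _; apply: integral_ge0 => t _; rewrite lee_fin normc_ge0.
  - apply: (measurable_fun_fubini_tonelli_F (m2 := leb) (fun z => (normc (k3 z))%:E)).
      by apply/measurable_EFinP; exact: measurable_normc.
    by move=> z; rewrite lee_fin normc_ge0.
  - move=> u _; rewrite /comp -EFinM lee_fin mulr_ge0 ?mulr_ge0 ?powR_ge0 ?japanese_rV_ge0//.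
      by rewrite ltW// Gamma_gt0.
    by have := le_trans (normc_ge0 _) (PhiC 0); rewrite pmulr_lge0// japanese_rV_gt0.
  - exact: measurable_int iK.
  (* At [u = 0] the exponential is 1 and the integral in [t] may diverge, so the domination is
     claimed only almost everywhere. *)
  apply: filterS (ae_neq_rV 0 n0) => u u0 _.
  have [i E] := integral_hpow_expRV b0 (pS u u0).
  pose r := pi `^ (n%:R / 2) * normc (Phi u * plane_wave d u y).
  have kr t : (normc (k3 (u, t)))%:E =
      (r%:E * (hpow (- b) t * expR (- (pi ^+ 2 * sqdist d u 0 / t)))%:E)%E.
    rewrite /k3 normc_realM -EFinM /r ger0_norm; last first.
      by rewrite !mulr_ge0 ?powR_ge0 ?hpow_ge0 ?expR_ge0.
    by rewrite mulrAC.
  under eq_integral do rewrite kr.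
  rewrite integralZl// -(fineK (integrable_fin_num measurableT i)).
  rewrite -/(Rintegral _ _ _) E -!EFinM lee_fin /r /K.
  rewrite powRM ?exprn_ge0 ?pi_ge0 ?sqdist_ge0//.
  have -> : (pi ^+ 2 : R) `^ (- b) = pi `^ (- (2 * b)).
    by rewrite -powR_mulrn ?pi_ge0// -powRrM mulrN.
  set P := pi `^ _; set Q := pi `^ _; set S := _ `^ _.
  have -> : P * normc (Phi u * plane_wave d u y) * (Gamma b * (Q * S)) =
    P * (Gamma b * Q) * S * normc (Phi u * plane_wave d u y) by ring.
  have -> : P * (Gamma b * Q) * C * (japanese_rV u * S) =
    P * (Gamma b * Q) * S * (C * japanese_rV u) by ring.
  rewrite ler_wpM2l// !mulr_ge0 ?powR_ge0//.
  by rewrite ltW// Gamma_gt0.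
have [/cintegrable_cmeasurable m3 _ E3] := cfubini ik3.
transitivity (cintegral lebn setT (fun x => cintegral leb setT (fun t => k1 (x, t)))).
  apply: ae_eq_cintegral => //.
    apply: cmeasurableM; first exact: cmeasurable_cst.
    apply: cmeasurableM => //; apply: cmeasurable_real; exact: measurable_riesz.
  (* The subordination formula is restricted to [x] different from [y]. *)
  apply: filterS (ae_neq_rV y n0) => x xy.
  have [i E] := integral_hpow_expR s0 (sqdist_gt0 one0 xy).
  rewrite /k1 /=; under [in RHS]eq_fun do rewrite mulrC.
  rewrite cintegralZl; last exact: cintegrable_real.
  by rewrite cintegral_real E [RHS]mulrC rmorphM/= mulrA.
rewrite E1.
transitivity (cintegral leb setT (fun t => cintegral lebn setT (fun u => k3 (u, t)))).
  apply: eq_cintegral => t; rewrite /k1 /k3 /=.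
  have [t0|t0] := ltP 0 t; last first.
    rewrite /hpow ltNge t0/=; under eq_fun do rewrite mul0r mul0r.
    under [in RHS]eq_fun do rewrite mul0r mulr0 mul0r.
    by [].
  have heat1 x : normc (heat one t x y)%:C <= 1.
    rewrite normc_real ger0_norm ?heat_ge0// -[leRHS]expR0 ler_expR oppr_le0.
    by rewrite mulr_ge0 ?sqdist_ge0// ltW.
  have iHG : cintegrable lebn setT (fun x => (heat one t x y)%:C * G x).
    apply: (cintegrable_le _ (japanese_integrable M)).
      by apply: cmeasurableM => //; apply: cmeasurable_real; exact: measurable_heat.
    by move=> x; rewrite normcM (le_trans _ (GM x))// ler_piMl ?normc_ge0.
  transitivity ((hpow s t)%:C * cintegral lebn setT (fun x => (heat one t x y)%:C * G x)).
    rewrite -(cintegralZl _ iHG); apply: eq_cintegral => x.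
    by rewrite rmorphM/= mulrA.
  rewrite heat_fourier// -cintegralZl.
    apply: eq_cintegral => u; rewrite mulrA -rmorphM/=; congr (_%:C * _).
    rewrite /hpow t0 [t `^ (- b - 1)](_ : _ = t `^ (s - 1) * t `^ (- (n%:R / 2))).
      by ring.
    rewrite -powRD ?(gt_eqF t0) ?implybT//; congr (_ `^ _).
    by rewrite -sb; ring.
  pose K := pi `^ (n%:R / 2) * t `^ (- (n%:R / 2)).
  apply: (cintegrable_le _ (japanese_integrable (K * C))).
    apply: cmeasurableM => //; apply: cmeasurable_real; apply: measurable_funM => //.
    apply: measurableT_comp => //; apply: measurableT_comp => //.
    by apply: measurable_funM => //; apply: measurable_funM => //; exact: measurable_sqdist.
  move=> u; rewrite normc_realM ger0_norm ?mulr_ge0 ?powR_ge0 ?expR_ge0//.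
  rewrite -[leRHS]mulrA ler_pM ?normc_ge0 ?mulr_ge0 ?powR_ge0 ?expR_ge0//.
  rewrite ler_piMr ?mulr_ge0 ?powR_ge0// -[leRHS]expR0 ler_expR oppr_le0.
  by rewrite divr_ge0 ?mulr_ge0 ?exprn_ge0 ?pi_ge0 ?sqdist_ge0// ltW.
rewrite -E3; apply: ae_eq_cintegral => //.
- apply: cmeasurableM; first exact: cmeasurable_cst.
  by apply: cmeasurableM => //; apply: cmeasurable_real; exact: measurable_riesz.
by apply: filterS (ae_neq_rV 0 n0) => u u0; rewrite (k3E u u0).2.
Qed.

End fourier_transform.
End riesz_fourier_core.

(** * The fractional Fourier transform and Riesz potentials *)

Section trigonometry.
Variable R : realType.

Lemma sin_natmul_pi (k : nat) : sin (k%:R * pi : R) = 0.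
Proof.
elim: k => [|k IH]; first by rewrite mul0r sin0.
by rewrite -natr1 mulrDl mul1r sinDpi IH oppr0.
Qed.

Lemma sin_intmul_pi (m : int) : sin (m%:~R * pi : R) = 0.
Proof.
case: m => k; first by rewrite -pmulrn sin_natmul_pi.
by rewrite NegzE mulrNz mulNr sinN -pmulrn sin_natmul_pi oppr0.
Qed.

(** Subtracting the multiple of pi given by the floor leaves a remainder in (0, pi), where the sine
    is positive; the cosine of the multiple has modulus 1. *)
Lemma sin_neq0 (x : R) : (forall m : int, x <> m%:~R * pi) -> sin x != 0.
Proof.
move=> xpi; pose m := Num.floor (x / pi); pose r := x - m%:~R * pi.
have pi0 := pi_gt0 R.
have /andP[m1 m2] := floor_itv (x / pi).
have r0 : 0 < r.
  rewrite subr_gt0 lt_neqAle -ler_pdivlMr// m1 andbT.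
  by apply/eqP => /esym; exact: xpi.
have rpi : r < pi.
  by rewrite ltrBlDr -[X in X + _]mul1r -mulrDl -ltr_pdivrMr// -[1]/(1%:~R) -intrD addrC.
have sr : 0 < sin r by apply: sin_gt0_pi; rewrite r0 rpi.
have sm := sin_intmul_pi m.
rewrite -(subrK (m%:~R * pi) x) -/r sinD sm mulr0 addr0.
apply: mulf_neq0; first by rewrite gt_eqF.
by rewrite -normr_eq0 (sin0cos1 sm) oner_neq0.
Qed.

End trigonometry.

Section fractional_fourier.
Variables (R : realType) (n : nat).
Local Notation lebn := (lebesgue_rV R n).
Local Notation one := (fun _ : 'I_n => 1 : R).
Implicit Types (x y u : 'rV[R]_n) (f phi : 'rV[R]_n -> R[i]).

Lemma sqdistC (d : 'I_n -> R) x y : sqdist d x y = sqdist d y x.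
Proof. by apply: eq_bigr => i _; rewrite -[in RHS]sqrrN -mulrN opprB. Qed.

Lemma enorm_pow (r : R) x : enorm x `^ r = sqdist one x 0 `^ (r / 2).
Proof.
rewrite /enorm -powR12_sqrt; last by apply: sumr_ge0 => i _; rewrite sqr_ge0.
rewrite -powRrM mulrC; congr (_ `^ _); apply: eq_bigr => i _.
by rewrite !mxE mul1r subr0.
Qed.

Lemma enorm_sub_pow (r : R) x y : enorm (x - y) `^ r = sqdist one x y `^ (r / 2).
Proof.
rewrite enorm_pow; congr (_ `^ _); apply: eq_bigr => i _.
by rewrite !mxE subr0.
Qed.

Lemma enorm_tilde_pow (alpha : 'rV[R]_n) (r : R) u :
  enorm (tilde alpha u) `^ r = sqdist (fun i => csc (alpha ord0 i)) u 0 `^ (r / 2).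
Proof.
rewrite enorm_pow; congr (_ `^ _); apply: eq_bigr => i _.
by rewrite !mxE mul1r !subr0 mulrC.
Qed.

Lemma chirpN (alpha : 'rV[R]_n) x : chirp (- alpha) x * chirp alpha x = 1.
Proof.
rewrite /chirp -expiD -mulrDr -big_split /= big1 ?mulr0 ?expi0// => i _.
by rewrite mxE /cot cosN sinN invrN mulrN -mulrDl -mulrDl addNr !mul0r.
Qed.

Lemma normc_chirp (alpha : 'rV[R]_n) x : normc (chirp alpha x) = 1.
Proof. exact: normc_expi. Qed.

Lemma cmeasurable_chirp (alpha : 'rV[R]_n) : cmeasurable (chirp alpha).
Proof.
apply: cmeasurable_expi; apply: measurable_funM => //.
apply: (@measurable_sum _ _ _ _ _ _
  (fun i (x : 'rV[R]_n) => cot (alpha ord0 i) / 2 * x ord0 i ^+ 2)) => i.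
by apply: measurable_funM => //; apply: measurable_funX; exact: measurable_rV_entry.
Qed.

(** The bound of the kernel against the weight is uniform in its centre [y]. Integrating in [x]
    first thus leaves a multiple of the weight in [y]. *)
Lemma cintegrable_riesz_prod (d : 'I_n -> R) (s C1 C2 : R) (H1 H2 : 'rV[R]_n -> R[i]) :
  0 < s -> s < n%:R / 2 -> (forall i, d i != 0) ->
  cmeasurable H1 -> cmeasurable H2 ->
  (forall x, normc (H1 x) <= C1 * japanese_rV x) ->
  (forall x, normc (H2 x) <= C2 * japanese_rV x) ->
  cintegrable (lebn \x lebn)%E setT (fun z : 'rV[R]_n * 'rV[R]_n =>
    (sqdist d z.1 z.2 `^ (- s))%:C * (H2 z.2 * H1 z.1)).
Proof.
move=> s0 sn d0 m1 m2 h1 h2.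
have [C [C0 hC]] := integral_japanese_riesz_kernel s0 sn d0.
have C10 : 0 <= C1.
  by have := le_trans (normc_ge0 _) (h1 0); rewrite pmulr_lge0// japanese_rV_gt0.
have C20 : 0 <= C2.
  by have := le_trans (normc_ge0 _) (h2 0); rewrite pmulr_lge0// japanese_rV_gt0.
have mk : cmeasurable (fun z : 'rV[R]_n * 'rV[R]_n =>
    (sqdist d z.1 z.2 `^ (- s))%:C * (H2 z.2 * H1 z.1)).
  apply: cmeasurableM; first by apply: cmeasurable_real; exact: measurable_riesz.
  apply: cmeasurableM; first exact: (cmeasurable_comp measurable_snd m2).
  exact: (cmeasurable_comp measurable_fst m1).
apply: cintegrable_prod2 => //.
have iK := japanese_integrable n (C2 * (C1 * C)).
apply: le_lt_trans (integrable_lty measurableT iK).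
apply: ge0_le_integral => //.
- by move=> y _; apply: integral_ge0 => x _; rewrite lee_fin normc_ge0.
- apply: (measurable_fun_fubini_tonelli_G (m1 := lebn) (fun z : 'rV[R]_n * 'rV[R]_n =>
    (normc ((sqdist d z.1 z.2 `^ (- s))%:C * (H2 z.2 * H1 z.1)))%:E)).
    by apply/measurable_EFinP; exact: measurable_normc.
  by move=> z; rewrite lee_fin normc_ge0.
- exact: measurable_int iK.
move=> y _.
apply: (@le_trans _ _ (\int[lebn]_x ((C2 * japanese_rV y * C1)%:E *
    (japanese_rV x * sqdist d x y `^ (- s))%:E))%E).
  apply: ge0_le_integral => //.
  - by move=> x _; rewrite lee_fin normc_ge0.
  - apply/measurable_EFinP; apply: measurable_normc.
    exact: (cmeasurable_comp (pair2_measurable y) mk).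
  - apply: emeasurable_funM => //; apply/measurable_EFinP; apply: measurable_funM.
      exact: measurable_japanese_rV.
    exact: measurable_riesz.
  - move=> x _; rewrite -EFinM lee_fin normc_realM normcM ger0_norm ?powR_ge0//.
    have -> : C2 * japanese_rV y * C1 * (japanese_rV x * sqdist d x y `^ (- s)) =
      sqdist d x y `^ (- s) * ((C2 * japanese_rV y) * (C1 * japanese_rV x)) by ring.
    by rewrite ler_wpM2l ?powR_ge0// ler_pM ?normc_ge0.
rewrite ge0_integralZl//; last 3 first.
- by apply/measurable_EFinP; apply: measurable_funM;
      [exact: measurable_japanese_rV|exact: measurable_riesz].
- by move=> x _; rewrite lee_fin mulr_ge0 ?japanese_rV_ge0 ?powR_ge0.
- by rewrite lee_fin !mulr_ge0 ?japanese_rV_ge0.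
apply: le_trans (lee_wpmul2l _ (hC y)) _.
  by rewrite lee_fin !mulr_ge0 ?japanese_rV_ge0.
rewrite -EFinM lee_fin le_eqVlt; apply/orP; left; apply/eqP; ring.
Qed.

Section fixed_order.
Variable alpha : 'rV[R]_n.
Hypothesis n0 : (0 < n)%N.
Hypothesis halpha : forall (k : 'I_n) (m : int), alpha 0 k <> m%:~R * pi.

Let d i : R := csc (alpha ord0 i).
Let d0 i : d i != 0.
Proof. by rewrite invr_neq0// sin_neq0. Qed.

Definition fourier_chirp (phi : 'rV[R]_n -> R[i]) x : R[i] :=
  cintegral lebn setT
    (fun u => phi u * chirp alpha u *
              plane_wave (fun i => csc (alpha ord0 i)) u x).

Lemma fourier_chirp_decay phi : schwartz phi ->
  exists M : R, forall x, normc (fourier_chirp phi x) <= M * japanese_rV x.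
Proof.
move=> sphi.
have b0 i : - (2 * pi * d i) != 0.
  by rewrite oppr_eq0 !mulf_neq0// ?gt_eqF// pi_gt0.
(* Chirp and plane wave together have the quadratic coefficients 2 pi cot / 2 = pi cot and the
   linear ones - 2 pi csc x_i. *)
have [M hM] := oscillatory_decay (fun i => pi * cot (alpha ord0 i)) n0 b0 sphi.
exists M => x; apply: le_trans (hM x); rewrite /fourier_chirp.
rewrite le_eqVlt; apply/orP; left; apply/eqP; congr (normc _).
apply: eq_cintegral => u; rewrite -mulrA; congr (_ * _).
rewrite /chirp /plane_wave -expiD; congr expi.
rewrite /quadratic_phase 2!mulr_sumr -sumrN -big_split; apply: eq_bigr => i _ /=.
by rewrite -/(d i); field.
Qed.

Lemma chirp_schwartz phi : schwartz phi ->
  cmeasurable (fun u => phi u * chirp alpha u) /\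
  exists C : R, forall u, normc (phi u * chirp alpha u) <= C * japanese_rV u.
Proof.
move=> sphi; split.
  by apply: cmeasurableM; [exact: schwartz_measurable|exact: cmeasurable_chirp].
have [C hC] := schwartz_japanese_le sphi; exists C => u.
by rewrite normcM normc_chirp mulr1.
Qed.

Lemma frftE phi u : schwartz phi ->
  frft alpha phi u = frft_const alpha * (chirp alpha u * fourier_chirp phi u).
Proof.
move=> sphi; have [mphi [C hC]] := chirp_schwartz sphi.
rewrite mulrA /frft /fourier_chirp -cintegralZl.
  apply: eq_cintegral => x; rewrite /frft_kernel /plane_wave.
  rewrite (eq_bigr (fun i => u ord0 i * x ord0 i * csc (alpha ord0 i))).
    by ring.
  by move=> i _; rewrite [X in X * _]mulrC.
apply: (cintegrable_le _ (japanese_integrable n C)).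
  by apply: cmeasurableM => //; exact: cmeasurable_plane_wave.
by move=> x; rewrite normcM normc_expi mulr1.
Qed.

End fixed_order.

End fractional_fourier.

(** * The potential and the multiplier as tempered functions, and their identification *)

Section riesz_potential.
Variables (R : realType) (n : nat) (beta : R) (alpha : 'rV[R]_n).
Local Notation lebn := (lebesgue_rV R n).
Local Notation one := (fun _ : 'I_n => 1 : R).
Implicit Types (x y u : 'rV[R]_n) (f phi : 'rV[R]_n -> R[i]).
Hypothesis hbeta : 0 < beta < n%:R.
Hypothesis halpha : forall (k : 'I_n) (m : int), alpha 0 k <> m%:~R * pi.

Let d i : R := csc (alpha ord0 i).
Let s : R := (n%:R - beta) / 2.
Let b : R := beta / 2.

Let d0 i : d i != 0. Proof. by rewrite invr_neq0// sin_neq0. Qed.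
Let one0 i : one i != 0. Proof. exact: oner_neq0. Qed.
Let beta0 : 0 < beta. Proof. by have /andP[] := hbeta. Qed.
Let betan : beta < n%:R. Proof. by have /andP[] := hbeta. Qed.
Let n0 : (0 < n)%N. Proof. by rewrite -(ltr_nat R) (lt_trans beta0). Qed.
Let s0 : 0 < s. Proof. by rewrite divr_gt0// subr_gt0. Qed.
Let b0 : 0 < b. Proof. by rewrite divr_gt0. Qed.
Let sb : s + b = n%:R / 2. Proof. by rewrite /s /b -mulrDl subrK. Qed.
Let sn : s < n%:R / 2. Proof. by rewrite -sb ltrDl. Qed.
Let bn : b < n%:R / 2. Proof. by rewrite -sb ltrDr. Qed.

(** The classical Riesz potential of the chirped function, without its normalising constant. *)
Definition newton_potential f x : R[i] :=
  cintegral lebn setT (fun y =>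
    (sqdist one x y `^ (- ((n%:R - beta) / 2)))%:C * (f y * chirp alpha y)).

Lemma riesz_potentialE f x : riesz_potential beta alpha f x =
  ((riesz_const n beta)^-1)%:C * chirp (- alpha) x * newton_potential f x.
Proof.
rewrite /riesz_potential; congr (_ * _); apply: eq_cintegral => y.
by rewrite enorm_sub_pow powRN fmorphV/= mulrA [_^-1 * _]mulrC.
Qed.

(** The potential need not be integrable itself. Fubini, applied to the kernel between the weight in
    [x] and the chirped function in [y], gives the weighted form and, with it, the measurability of
    the potential. *)
Lemma newton_potential_weighted f : schwartz f ->
  cintegrable lebn setT (fun x => (japanese_rV x)%:C * newton_potential f x).
Proof.
move=> sf; have [mf [C hC]] := chirp_schwartz alpha sf.
have mj : cmeasurable (fun x : 'rV[R]_n => (japanese_rV x)%:C).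
  by apply: cmeasurable_real; exact: measurable_japanese_rV.
have hj x : normc (japanese_rV x)%:C <= 1 * japanese_rV x.
  by rewrite normc_real mul1r ger0_norm ?japanese_rV_ge0.
have [+ _ _] := cfubini (cintegrable_riesz_prod s0 sn one0 mj mf hj hC).
congr (cintegrable _ _ _); apply/funext => x.
rewrite /newton_potential -cintegralZl.
  by apply: eq_cintegral => y /=; rewrite mulrA mulrC.
have := cintegrable_riesz x s0 sn one0 mf hC.
by under eq_fun do rewrite sqdistC.
Qed.

Lemma cmeasurable_newton_potential f : schwartz f -> cmeasurable (newton_potential f).
Proof.
move=> /newton_potential_weighted /cintegrable_cmeasurable h.
rewrite (_ : newton_potential f = fun x => ((japanese_rV x)^-1)%:C *
    ((japanese_rV x)%:C * newton_potential f x)).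
  by apply: cmeasurableM => //; apply: cmeasurable_real; exact: measurable_japanese_rV_inv.
apply/funext => x; rewrite mulrA -rmorphM/= mulVf ?mul1r//.
by rewrite gt_eqF// japanese_rV_gt0.
Qed.

Lemma tempered_riesz_potential f : schwartz f ->
  tempered_function (riesz_potential beta alpha f).
Proof.
move=> sf; rewrite (_ : riesz_potential beta alpha f = fun x =>
  ((riesz_const n beta)^-1)%:C * chirp (- alpha) x * newton_potential f x); last first.
  by apply/funext => x; exact: riesz_potentialE.
apply: tempered_function_weighted.
  apply: cmeasurableM; last exact: cmeasurable_newton_potential.
  by apply: cmeasurableM; [exact: cmeasurable_cst|exact: cmeasurable_chirp].
have i := cintegrable_normc (newton_potential_weighted sf).
apply: eq_integrable (integrableZl measurableT `|(riesz_const n beta)^-1| i) => // x _.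
rewrite /comp -EFinM; congr EFin.
by rewrite !normcM !normc_real normc_chirp mulr1 (ger0_norm (japanese_rV_ge0 x)) mulrA mulrAC.
Qed.

Definition multiplier u : R :=
  (2 * pi) `^ (- beta) * enorm (tilde alpha u) `^ (- beta).

Lemma multiplierE u :
  multiplier u = (2 * pi) `^ (- beta) * sqdist d u 0 `^ (- b).
Proof. by rewrite /multiplier enorm_tilde_pow mulNr. Qed.

(** The transform of [f] decays like the weight, and the multiplier is a constant times a kernel of
    exponent b < n/2. The product is thus already integrable, and the additional weight is bounded
    by 1. *)
Lemma tempered_multiplier_frft f : schwartz f ->
  tempered_function (fun u => (multiplier u)%:C * frft alpha f u).
Proof.
move=> sf; have [mf [C hC]] := chirp_schwartz alpha sf.
have [M hM] := fourier_chirp_decay n0 halpha sf.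
have mF : cmeasurable (fourier_chirp alpha f) := fourier_cmeasurable d mf hC.
rewrite (_ : (fun u => _) = fun u =>
    ((2 * pi) `^ (- beta))%:C * frft_const alpha *
    (chirp alpha u * ((sqdist d u 0 `^ (- b))%:C * fourier_chirp alpha f u))); last first.
  by apply/funext => u; rewrite frftE// multiplierE rmorphM/=; ring.
have mg : cmeasurable (fun u =>
    ((2 * pi) `^ (- beta))%:C * frft_const alpha *
    (chirp alpha u * ((sqdist d u 0 `^ (- b))%:C * fourier_chirp alpha f u))).
  apply: cmeasurableM; first exact: cmeasurable_cst.
  apply: cmeasurableM; first exact: cmeasurable_chirp.
  by apply: cmeasurableM => //; apply: cmeasurable_real; exact: measurable_riesz.
apply: tempered_function_weighted => //.
have i := cintegrable_normc (cintegrable_riesz 0 b0 bn d0 mF hM).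
pose K := normc (((2 * pi) `^ (- beta))%:C * frft_const alpha).
apply: le_integrable (integrableZl measurableT K i) => //.
  apply/measurable_EFinP; apply: measurable_funM; first exact: measurable_normc.
  exact: measurable_japanese_rV.
move=> u _; rewrite /comp -EFinM !abse_EFin lee_fin.
rewrite [normc (_ * (chirp _ _ * _))]normcM -/K [normc (chirp _ _ * _)]normcM normc_chirp mul1r.
set N := normc (_ * fourier_chirp _ _ _).
have KN0 : 0 <= K * N by rewrite mulr_ge0// normc_ge0.
rewrite !ger0_norm ?mulr_ge0 ?japanese_rV_ge0 ?normc_ge0//.
rewrite ler_piMr//.
by apply: prodr_ile1 => i0 _; rewrite japanese_ge0 japanese_le1.
Qed.

(** The factors pi^(n/2), Gamma(b) and Gamma(s) cancel against the normalisation of the potential;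
    2^(-beta) remains, and pi^(-2b) = pi^(-beta). *)
Lemma riesz_constE :
  (riesz_const n beta)^-1 * (Gamma s)^-1 *
    (pi `^ (n%:R / 2) * (Gamma b * pi `^ (- (2 * b)))) = (2 * pi) `^ (- beta).
Proof.
have Gs := Gamma_gt0 s0; have Gb := Gamma_gt0 b0.
rewrite powRM// ?pi_ge0// !powRN mulrC.
have -> : 2 * b = beta by rewrite /b; field.
rewrite /riesz_const -/s -/b; field.
by rewrite !gt_eqF// ?powR_gt0// ?pi_gt0.
Qed.

(** With the potential written out, the pairing is a double integral in [x] and [y]. Exchanging them
    makes [x] the inner variable, so that [riesz_fourier] applies for each [y]; exchanging [y] and
    [u] then makes the integral in [y] the transform of the chirped [f], by the symmetry of the
    plane wave. *)
Lemma riesz_multiplier f phi : schwartz f -> schwartz phi ->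
  frft_distribution alpha (distribution_of (riesz_potential beta alpha f)) phi =
  distribution_of (fun u => (multiplier u)%:C * frft alpha f u) phi.
Proof.
move=> sf sphi; rewrite /frft_distribution /distribution_of.
have [mf [C1 hC1]] := chirp_schwartz alpha sf.
have [mphi [C2 hC2]] := chirp_schwartz alpha sphi.
have [M hM] := fourier_chirp_decay n0 halpha sphi.
have mG : cmeasurable (fourier_chirp alpha phi) := fourier_cmeasurable d mphi hC2.
pose F y := f y * chirp alpha y; pose Phi u := phi u * chirp alpha u.
pose G := fourier_chirp alpha phi.
pose K : R[i] := ((riesz_const n beta)^-1)%:C * frft_const alpha.
pose Q : R[i] := (pi `^ (n%:R / 2) * (Gamma b * pi `^ (- (2 * b))))%:C.
have PhiC y u : normc (Phi u * plane_wave d u y) <= C2 * japanese_rV u.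
  by rewrite normcM normc_expi mulr1; exact: hC2.
have ik4 := cintegrable_riesz_prod s0 sn one0 mG mf hM hC1.
have [i4 _ E4] := cfubini ik4.
have iF x : cintegrable lebn setT (fun y => (sqdist one x y `^ (- s))%:C * F y).
  have := cintegrable_riesz x s0 sn one0 mf hC1.
  by under eq_fun do rewrite sqdistC.
have iG y := cintegrable_riesz y s0 sn one0 mG hM.
(* The integrand of the second exchange. It is dominated by a tensor product, since the singular
   factor now depends on [u] alone. *)
pose k5 (z : 'rV[R]_n * 'rV[R]_n) :=
  F z.1 * ((sqdist d z.2 0 `^ (- b))%:C * (Phi z.2 * plane_wave d z.2 z.1)).
have ik5 : cintegrable (lebn \x lebn)%E setT k5.
  have i1 := japanese_integrable n C1.
  have i2 := integrableZl measurableT C2 (riesz_japanese_integrable 0 b0 bn d0).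
  apply: (cintegrable_tensor _ i1 (b := fun u => C2 * (japanese_rV u * sqdist d u 0 `^ (- b)))).
  - apply: cmeasurableM; first exact: (cmeasurable_comp measurable_fst mf).
    apply: cmeasurableM; first by apply: cmeasurable_real; exact: measurable_riesz.
    apply: cmeasurableM; first exact: (cmeasurable_comp measurable_snd mphi).
    exact: cmeasurable_plane_wave.
  - by apply: eq_integrable i2.
  - move=> y u; rewrite [leLHS]normcM.
    apply: ler_pM; [exact: normc_ge0|exact: normc_ge0|exact: hC1|].
    rewrite normc_realM (ger0_norm (powR_ge0 _ _)) mulrA [leRHS]mulrC.
    by apply: ler_wpM2l; [exact: powR_ge0|exact: PhiC].
have [i5 i5' E5] := cfubini ik5.
have LHS : cintegral lebn setT (fun x => riesz_potential beta alpha f x * frft alpha phi x)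
  = K * cintegral lebn setT (fun x => cintegral lebn setT (fun y =>
      (sqdist one x y `^ (- s))%:C * (F y * G x))).
  rewrite -(cintegralZl _ i4); apply: eq_cintegral => x.
  rewrite riesz_potentialE (frftE _ _ sphi) /K.
  have -> : cintegral lebn setT (fun y => (sqdist one x y `^ (- s))%:C * (F y * G x)) =
      G x * newton_potential f x.
    rewrite -cintegralZl; last exact: iF.
    by apply: eq_cintegral => y; rewrite mulrA mulrC.
  rewrite -/G -[RHS]mul1r -(chirpN alpha x); ring.
rewrite LHS E4.
have Gs0 : Gamma s != 0 := lt0r_neq0 (Gamma_gt0 s0).
have step y : cintegral lebn setT (fun x => (sqdist one x y `^ (- s))%:C * (F y * G x)) =
    ((Gamma s)^-1)%:C * Q * cintegral lebn setT (fun u => k5 (y, u)).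
  have mPw : cmeasurable (fun u => Phi u * plane_wave d u y).
    by apply: cmeasurableM; [exact: mphi|exact: cmeasurable_plane_wave].
  have iPhi := cintegrable_riesz 0 b0 bn d0 mPw (PhiC y).
  rewrite /k5 (cintegralZl (F y) iPhi).
  have -> : cintegral lebn setT (fun x => (sqdist one x y `^ (- s))%:C * (F y * G x)) =
      F y * cintegral lebn setT (fun x => (sqdist one x y `^ (- s))%:C * G x).
    rewrite -(cintegralZl (F y) (iG y)); apply: eq_cintegral => x; exact: mulrCA.
  have core := riesz_fourier n0 d0 s0 b0 sb mphi hC2 hM y.
  rewrite -[cintegral _ _ (fun x => _ * G x)]mul1r.
  have -> : 1 = ((Gamma s)^-1)%:C * (Gamma s)%:C :> R[i].
    by rewrite -rmorphM/= mulVf.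
  rewrite -[_ * _ * cintegral _ _ _]mulrA core.
  move: (cintegral _ _ _) (F y) => J Fy; rewrite /Q; ring.
have -> : cintegral lebn setT (fun y => cintegral lebn setT (fun x =>
      (sqdist one x y `^ (- s))%:C * (F y * G x))) =
    ((Gamma s)^-1)%:C * Q *
      cintegral lebn setT (fun y => cintegral lebn setT (fun u => k5 (y, u))).
  by rewrite -(cintegralZl _ i5); apply: eq_cintegral => y; exact: step.
rewrite E5 mulrA.
have -> : K * (((Gamma s)^-1)%:C * Q) = ((2 * pi) `^ (- beta))%:C * frft_const alpha.
  by rewrite -riesz_constE /K /Q !rmorphM/=; ring.
rewrite -(cintegralZl _ i5'); apply: eq_cintegral => u.
have iFu : cintegrable lebn setT (fun y => F y * plane_wave d y u).
  apply: (cintegrable_le _ (japanese_integrable n C1)).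
    by apply: cmeasurableM; [exact: mf|exact: cmeasurable_plane_wave].
  by move=> y; rewrite normcM normc_expi mulr1; exact: hC1.
have -> : cintegral lebn setT (fun y => k5 (y, u)) =
    (sqdist d u 0 `^ (- b))%:C * Phi u * fourier_chirp alpha f u.
  rewrite /fourier_chirp -(cintegralZl _ iFu); apply: eq_cintegral => y.
  rewrite /k5 /= (plane_waveC d u y).
  move: (F y) (Phi u) (plane_wave _ _ _) => a1 a2 a3; ring.
rewrite multiplierE (frftE _ _ sf) rmorphM/= /Phi; ring.
Qed.

Lemma eq_tempered_riesz f : schwartz f ->
  eq_tempered
    (frft_distribution alpha (distribution_of (riesz_potential beta alpha f)))
    (distribution_of (fun u => (multiplier u)%:C * frft alpha f u)).
Proof.
move=> sf; have [_ _ tw] := tempered_multiplier_frft sf.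
have vw phi : schwartz phi -> _ := riesz_multiplier sf.
by split => //; exact: tempered_eq tw vw.
Qed.

End riesz_potential.

Unset Implicit Arguments.

Theorem theorem2p9 (R : realType) (n : nat) (beta : R) (alpha : 'rV[R]_n)
  (hbeta : 0 < beta < n%:R)
  (halpha : forall (k : 'I_n) (m : int), alpha 0 k <> m%:~R * pi)
  (f : 'rV[R]_n -> R[i]) (hf : schwartz f) :
  let g := fun u : 'rV[R]_n =>
    ((2 * pi) `^ (- beta) * enorm (tilde alpha u) `^ (- beta))%:C *
    frft alpha f u in
  [/\ tempered_function (riesz_potential beta alpha f),
      tempered_function g &
      eq_tempered
        (frft_distribution alpha
           (distribution_of (riesz_potential beta alpha f)))
        (distribution_of g)].
Proof.
move=> g; split.
- exact: tempered_riesz_potential.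
- exact: tempered_multiplier_frft.
- exact: eq_tempered_riesz.
Qed.
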